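(* Let $n\ge1$, let $a_0,\dots,a_{n-1}$ be given complex numbers, and define $T_1,\dots,T_n$ as the lower triangular Toeplitz matrices described in the context. Put $N=I_n-T_nT_n^*$, $d=\dim\ker N$ and $\rho=\rho(N)$. Below, ''solution'' means a function $S(z)$, in the indicated class, which is holomorphic at the origin and satisfies $S(z)=a_0+a_1z+\cdots+a_{n-1}z^{n-1}+O(z^n)$ in a neighborhood of the origin. Assume $|N|\ne0$. (a$'$) There exist infinitely many solutions in $\mathbf S_{\nu(N)}$, even in the smaller set $\mathbf S_{\nu(N),\pi(N)}$. (b$'$) There exist infinitely many solutions in $\mathbf S_{\nu,\pi}$ for all pairs $(\nu,\pi)$ with $\nu\ge\nu(N)$ and $\pi\ge\pi(N)$. Assume $|N|=0$ and $|I_\rho-T_\rho T_\rho^*|\ne0$. (c$'$) There is a unique solution in $\mathbf S_{\nu(N)}$; it belongs to $\mathbf S_{\nu(N),\pi(N)}$. (d$'$) There are no solutions in $\mathbf S_\nu$ for $\nu(N)<\nu<\nu(N)+d$; there are no solutions in $\mathbf S_{\nu,\pi}$ if $\nu(N)<\nu<\nu(N)+d$ or if $\pi(N)<\pi<\pi(N)+d$. (e$'$) There are infinitely many solutions in $\mathbf S_{\nu,\pi}$ for all pairs $(\nu,\pi)$ with $\nu\ge\nu(N)+d$ and $\pi\ge\pi(N)+d$. Assume $|N|=0$ and $|I_\rho-T_\rho T_\rho^*|=0$. (f$'$) There are no solutions in $\mathbf S_{\nu(N)}$. (g$'$) There are no solutions in $\mathbf S_\nu$ if $\nu<\nu(N)+d$;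 there are no solutions in $\mathbf S_{\nu,\pi}$ if $\nu<\nu(N)+d$ or if $\pi<\pi(N)+d$. (h$'$) There are infinitely many solutions in $\mathbf S_{\nu,\pi}$ for every pair $(\nu,\pi)$ with $\nu\ge\nu(N)+d$ and $\pi\ge\pi(N)+d$.
   Context: $T_r$ is the $r\times r$ lower triangular Toeplitz matrix with entries $(T_r)_{ij}=a_{i-j}$ for $i\ge j$ and $0$ for $i<j$ ($0\le i,j\le r-1$); $I_r$ is the identity matrix. For a Hermitian matrix $A$: $\pi(A)$ and $\nu(A)$ are the numbers of positive and negative eigenvalues counting multiplicity, $\rho(A)=\pi(A)+\nu(A)$ is the rank, and $|A|$ is the determinant. The determinant of the empty matrix ($\rho=0$) is $1$. A Hermitian kernel $K(w,z)$ on a set has $\kappa$ negative (resp. positive) squares if every matrix $(K(w_j,w_i))_{i,j}$ built from finitely many points has at most $\kappa$ negative (resp. positive) eigenvalues and some such matrix has exactly $\kappa$. $\mathbf S_\kappa$ is the set of complex-valued functions $S$ holomorphic on some subregion of the open unit disk $\mathbf D$ such that the kernel $K_S(w,z)=\frac{1-S(z)\overline{S(w)}}{1-z\bar w}$ has $\kappa$ negative squares; such functions extend meromorphically to $\mathbf D$ and are identified with their extensions. $\mathbf S_{\nu,\pi}$ is the class of meromorphic functions $S$ on $\mathbf D$ for which $K_S$ has $\nu$ negative squares and $\pi$ positive squares. *)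

(* Defs.v *)
From HB Require Import structures.
From mathcomp Require Import all_boot all_order all_algebra.
From mathcomp Require Import all_classical all_reals all_analysis.
From mathcomp.real_closed Require Import complex.

Set Implicit Arguments.
Unset Strict Implicit.
Unset Printing Implicit Defensive.

Import Order.TTheory GRing.Theory Num.Theory numFieldNormedType.Exports.

Local Open Scope classical_set_scope.
Local Open Scope ring_scope.
Local Open Scope sesquilinear_scope.

Section Inertia.
Variable C : numClosedFieldType.

(* Complex roots of the characteristic polynomial, repeated according to
   their multiplicity. *)
Definition eigenvalues m (A : 'M[C]_m) : seq C :=
  sval (closed_field_poly_normal (char_poly A)).

(* The order on C satisfies: 0 < x (resp. x < 0) iff x is real and positive
   (resp. negative). *)
Definition pos_index m (A : 'M[C]_m) : nat := count (fun x => 0 < x) (eigenvalues A).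
Definition neg_index m (A : 'M[C]_m) : nat := count (fun x => x < 0) (eigenvalues A).
Definition rho m (A : 'M[C]_m) : nat := (pos_index A + neg_index A)%N.

(* [cokermx] is the kernel for the action on column vectors. *)
Definition dim_ker m (A : 'M[C]_m) : nat := \rank (cokermx A).

Definition toeplitz (a : seq C) (r : nat) : 'M[C]_r :=
  \matrix_(i, j) (if (j <= i)%N then a`_(i - j) else 0).

Definition gram_defect (a : seq C) (r : nat) : 'M[C]_r :=
  1%:M - toeplitz a r *m (toeplitz a r)^t*.

End Inertia.

Section SchurClasses.
Variable R : realType.

(* [R[i]^o] is R[i] with its structure of normed space over itself, so that
   [derivable] below is complex differentiability. *)
Local Notation C := (R[i]^o).
Implicit Types (S : C -> C) (X : set C).

Definition unit_disk : set C := [set z | `|z| < 1].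

Definition region X := [/\ open X, connected X & X !=set0].

Definition holomorphic_at S (z : C) : Prop := \forall w \near z, derivable S w 1.

Definition pole S (z : C) : Prop :=
  (\forall w \near z^', derivable S w 1) /\
  (forall M : R, \forall w \near z^', M%:C%C < `|S w|).

(* A meromorphic function on the disk is encoded by a total function with the
   value 0 at the poles and outside the disk. This makes the encoding unique:
   equality of functions is equality of meromorphic functions. *)
Definition meromorphic_disk S : Prop :=
  (forall z, unit_disk z -> holomorphic_at S z \/ (pole S z /\ S z = 0)) /\
  (forall z, ~ unit_disk z -> S z = 0).

Definition holo_domain S : set C := unit_disk `&` [set z | holomorphic_at S z].

Definition schur_kernel S (w z : C) : C := (1 - S z * (S w)^*) / (1 - z * w^*).

Definition kernel_mx (K : C -> C -> C) m (w : 'I_m -> C) : 'M[R[i]]_m :=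
  \matrix_(i, j) K (w j) (w i).

Definition has_squares (index : forall m, 'M[R[i]]_m -> nat)
    X (K : C -> C -> C) (kappa : nat) : Prop :=
  (forall m (w : 'I_m -> C), (forall i, X (w i)) ->
     (index m (kernel_mx K w) <= kappa)%N) /\
  (exists m (w : 'I_m -> C), (forall i, X (w i)) /\
     index m (kernel_mx K w) = kappa).

Definition negative_squares := has_squares (@neg_index R[i]).
Definition positive_squares := has_squares (@pos_index R[i]).

(* The functions of the class are represented by their meromorphic extensions
   to the disk. *)
Definition schur_class (kappa : nat) : set (C -> C) :=
  [set S | meromorphic_disk S /\
     exists (X : set C) (f : C -> C),
       [/\ region X /\ X `<=` unit_disk,
           forall z, X z -> derivable f z 1,
           negative_squares X (schur_kernel f) kappa
         & forall z, X z -> S z = f z]].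

Definition schur_class2 (nu pi : nat) : set (C -> C) :=
  [set S | [/\ meromorphic_disk S,
     negative_squares (holo_domain S) (schur_kernel S) nu
   & positive_squares (holo_domain S) (schur_kernel S) pi]].

Definition interpolates (a : seq C) (n : nat) S : Prop :=
  holomorphic_at S 0 /\
  exists M : R, \forall z \near (0 : C),
    `|S z - \sum_(k < n) a`_k * z ^+ k| <= M%:C%C * `|z| ^+ n.

Definition solutions (F : set (C -> C)) (a : seq C) (n : nat) : set (C -> C) :=
  F `&` interpolates a n.

End SchurClasses.

(* Main.v *)
Require Import Defs.
From HB Require Import structures.
From mathcomp Require Import all_boot all_order all_algebra.
From mathcomp Require Import all_classical all_reals all_analysis.
From mathcomp.real_closed Require Import complex.
From mathcomp Require Import zify ring lra.

Set Implicit Arguments.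
Unset Strict Implicit.
Unset Printing Implicit Defensive.

Import Order.TTheory GRing.Theory Num.Theory numFieldNormedType.Exports.

Local Open Scope classical_set_scope.
Local Open Scope ring_scope.
Local Open Scope sesquilinear_scope.

(** The kernel [K_S] of a function with Taylor coefficients [s] at the origin
    is governed by the defect matrices [defect s m], equal to [I - T T^*] for
    the [m] by [m] Toeplitz matrix [T] of [s]: their entries are the Taylor
    coefficients of the kernel in [z] and [w^*]. On a small disk around the
    origin the kernel has at most [nu] negative squares if and only if every
    [defect s m] has at most [nu] negative eigenvalues ([defect_index_le],
    [kernel_index_le]), because each family of matrices is a limit of matrices
    congruent to members of the other. A Moebius map moves any point of the
    disk to the origin, and replacing [S] by [1 / S] handles the poles, so a
    bound on one region spreads along segments to the whole disk
    ([local_uniform], [propagate]). The problem becomes one about extending the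
    data [s] so that the inertia of all [defect s m] stays under control.

    Kernel vectors of [defect s m] are pairs of polynomials with [s q = p] and
    [s crev(p) = crev(q)] to order [m]. A kernel vector that does not extend by
    zero to the next matrices is isotropic but not radical there, so it adds a
    square of each sign ([pos_index_jump]). Hence there are two alternatives for
    singular data with kernel of dimension [d]. Either the extension breaks all
    kernel vectors, and both indices grow by at least [d]; or some kernel vector
    survives for ever, and then [s = p / q] is a quotient of Blaschke products
    ([defect_rational]). Such a fraction of degree [k] has a kernel of rank [k],
    so [k] is the rank of the defect matrix, the leading block of size [k] is
    nonsingular, and its indices are the numbers of squares of the fraction
    ([rank_defect_blaschke], [defect_blaschke_unit], [rational_squares]). This
    yields the gaps in the possible numbers of squares, uniqueness in the class
    with the fewest negative squares, and the nonexistence of such a solution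
    when the leading block of size equal to the rank is singular. When that block
    is nonsingular, its kernel successor gives the solution
    ([defect_rank_rational]).

    Conversely, nonsingular data can be extended by one coefficient so that
    either index grows by one, or so that the matrix becomes singular, the latter
    in infinitely many ways ([extension_indices]); singular data can be extended
    so that both indices grow by one and the kernel loses a dimension
    ([defect_jump]). Reaching a nonsingular matrix of indices [pi] and [nu] and
    then a singular one produces infinitely many fractions with exactly these
    numbers of squares ([blaschke_family]).

    The analysis needed is the existence of Taylor expansions of complex
    differentiable functions with a geometric remainder ([taylor_at0]), which
    rests on Goursat's theorem and Cauchy's formula on a square. *)

(** * Inertia of Hermitian matrices *)

Section InertiaTheory.
Variable C : numClosedFieldType.

Lemma adjmx_mul m n p (A : 'M[C]_(m, n)) (B : 'M[C]_(n, p)) :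
  (A *m B)^t* = B^t* *m A^t*.
Proof. by rewrite trmx_mul map_mxM. Qed.

Lemma adjmxB m n (A B : 'M[C]_(m, n)) : (A - B)^t* = A^t* - B^t*.
Proof. by rewrite linearB /= map_mxB. Qed.

Lemma adjmxN m n (A : 'M[C]_(m, n)) : (- A)^t* = - A^t*.
Proof. by rewrite linearN /= map_mxN. Qed.

Lemma adjmx1 n : (1%:M : 'M[C]_n)^t* = 1%:M.
Proof. by rewrite trmx1 map_mx1. Qed.

Lemma congr_herm m n (P : 'M[C]_(m, n)) A :
  A^t* = A -> (P *m A *m P^t*)^t* = P *m A *m P^t*.
Proof. by move=> hA; rewrite !adjmx_mul trmxCK hA mulmxA. Qed.

Definition qf n (A : 'M[C]_n) (x : 'rV[C]_n) : C := (x *m A *m x^t*) 0 0.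

Lemma qf_congr m n (P : 'M[C]_(m, n)) A x :
  qf (P *m A *m P^t*) x = qf A (x *m P).
Proof. by rewrite /qf adjmx_mul !mulmxA. Qed.

Lemma qfB n (A B : 'M[C]_n) x : qf (A - B) x = qf A x - qf B x.
Proof. by rewrite /qf mulmxBr mulmxBl !mxE. Qed.

Lemma qf_diag n (d x : 'rV[C]_n) :
  qf (diag_mx d) x = \sum_i d 0 i * `|x 0 i| ^+ 2.
Proof.
rewrite /qf mul_mx_diag mxE; apply: eq_bigr => i _.
by rewrite !mxE normCK mulrCA mulrA.
Qed.

Lemma qf1 n (x : 'rV[C]_n) : qf 1%:M x = \sum_i `|x 0 i| ^+ 2.
Proof.
have -> : 1%:M = diag_mx (const_mx 1) :> 'M[C]_n.
  by apply/matrixP=> i j; rewrite !mxE.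
by rewrite qf_diag; apply: eq_bigr => i _; rewrite mxE mul1r.
Qed.

Lemma qf1_gt0 n (x : 'rV[C]_n) : x != 0 -> 0 < qf 1%:M x.
Proof.
move=> x0; rewrite qf1 lt_def sumr_ge0 ?andbT; last by move=> i _; rewrite exprn_ge0.
rewrite psumr_neq0 => [|i _]; last by rewrite exprn_ge0.
have /rV0Pn[i xi] := x0.
by apply/hasP; exists i; rewrite ?mem_index_enum //= exprn_gt0 ?normr_gt0.
Qed.

Lemma char_poly_unitary_diag n (P A : 'M[C]_n) (d : 'rV[C]_n) :
  P *m P^t* = 1%:M -> P *m A *m P^t* = diag_mx d ->
  char_poly A = \prod_(i < n) ('X - (d 0 i)%:P).
Proof.
move=> PP PA; transitivity (char_poly (diag_mx d)); last first.
  rewrite char_poly_trig; last by apply: diag_mx_is_trig.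
  by apply: eq_bigr => i _; rewrite mxE eqxx.
rewrite /char_poly -PA /char_poly_mx.
set Pp := map_mx polyC P; set Pq := map_mx polyC (P^t*).
have PPq : Pp *m Pq = 1%:M by rewrite -map_mxM PP map_mx1.
have -> : 'X%:M - map_mx polyC (P *m A *m P^t*) =
          Pp *m ('X%:M - map_mx polyC A) *m Pq.
  by rewrite !map_mxM mulmxBr mulmxBl mul_mx_scalar -scalemxAl PPq scalemx1.
by rewrite !det_mulmx mulrAC -det_mulmx PPq det1 mul1r.
Qed.

Lemma eigenvalues_unitary_diag n (P A : 'M[C]_n) (d : 'rV[C]_n) :
  P *m P^t* = 1%:M -> P *m A *m P^t* = diag_mx d ->
  perm_eq (eigenvalues A) [seq d 0 i | i : 'I_n].
Proof.
move=> PP PA; apply: prod_XsubC_eq; rewrite /eigenvalues.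
case: closed_field_poly_normal => /= r Dr.
rewrite big_map big_enum /= -(char_poly_unitary_diag PP PA).
by rewrite Dr (monicP (char_poly_monic A)) scale1r.
Qed.

Lemma rank_diag_mx n (d : 'rV[C]_n) :
  \rank (diag_mx d) = #|[pred i | d 0 i != 0]|.
Proof.
set B := [pred i | _].
pose E : 'M[C]_(#|B|, n) := \matrix_(k, i) (enum_val k == i)%:R.
pose D : 'M[C]_#|B| := diag_mx (\row_k d 0 (enum_val k)).
have EE : E *m E^T = 1%:M.
  apply/matrixP => k l; rewrite !mxE (bigD1 (enum_val k)) //= big1 ?addr0.
    by rewrite !mxE eqxx mul1r (inj_eq enum_val_inj) eq_sym.
  by move=> i /negbTE ik; rewrite !mxE eq_sym ik mul0r.
have Efree : row_free E by apply/row_freeP; exists E^T.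
have -> : diag_mx d = E^T *m D *m E.
  apply/matrixP => i j; rewrite /D mul_mx_diag !mxE.
  have [iB|iB] := boolP (i \in B); last first.
    have di : d 0 i = 0 by apply/eqP; rewrite inE negbK in iB.
    rewrite di mul0rn big1 // => k _; rewrite !mxE.
    by case: eqP => [ki|]; rewrite ?mul0r // ki di mulr0 mul0r.
  rewrite (bigD1 (enum_rank_in iB i)) //= big1 ?addr0.
    by rewrite !mxE enum_rankK_in // eqxx mul1r mulr_natr.
  move=> k kr; rewrite !mxE; case: eqP => [ki|]; rewrite ?mul0r //.
  by case/eqP: kr; apply: enum_val_inj; rewrite enum_rankK_in.
rewrite mxrankMfree // eqmxMfull; last by rewrite /row_full mxrank_tr.
apply: mxrank_unit; rewrite unitmxE det_diag unitfE.
by apply/prodf_neq0 => k _; rewrite mxE; have := enum_valP k; rewrite inE.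
Qed.

Section Spectral.
Variables (n : nat) (A : 'M[C]_n).
Hypothesis hA : A^t* = A.

Let P := spectralmx A.
Let d := spectral_diag A.

Lemma spectral_congr : P *m A *m P^t* = diag_mx d.
Proof.
have Anorm : A \is normalmx by apply/normalmxP; rewrite hA.
have /orthomx_spectralP E := Anorm.
rewrite {1}E !mulmxA mulmxV ?spectral_unit // mul1mx -mulmxA.
by rewrite -invmx_unitary ?spectral_unitarymx // mulmxV ?spectral_unit // mulmx1.
Qed.

Lemma spectral_diag_real i : d 0 i \is Num.real.
Proof.
have Aherm : A \is hermsymmx by apply/is_hermitianmxP; rewrite expr0 scale1r hA.
by have /mxOverP := hermitian_spectral_diag_real Aherm; apply.
Qed.

Lemma spectral_unitaryV : P *m P^t* = 1%:M.
Proof.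
by rewrite -invmx_unitary ?spectral_unitarymx // mulmxV // spectral_unit.
Qed.

Lemma eigenvalues_spectral : perm_eq (eigenvalues A) [seq d 0 i | i : 'I_n].
Proof. exact: eigenvalues_unitary_diag spectral_unitaryV spectral_congr. Qed.

Lemma pos_indexE : pos_index A = #|[pred i | 0 < d 0 i]|.
Proof.
rewrite /pos_index (permP eigenvalues_spectral) count_map.
by rewrite -sum1_count big_enum_cond sum1_card.
Qed.

Lemma neg_indexE : neg_index A = #|[pred i | d 0 i < 0]|.
Proof.
rewrite /neg_index (permP eigenvalues_spectral) count_map.
by rewrite -sum1_count big_enum_cond sum1_card.
Qed.

Lemma rank_index : (pos_index A + neg_index A)%N = \rank A.
Proof.
have Pu : P \in unitmx := spectral_unit A.
have Qu : P^t* \in unitmx by rewrite -invmx_unitary ?spectral_unitarymx // unitmx_inv.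
have -> : \rank A = \rank (diag_mx d).
  rewrite -spectral_congr mxrankMfree ?row_free_unit //.
  by rewrite eqmxMfull // row_full_unit.
rewrite rank_diag_mx pos_indexE neg_indexE.
rewrite -cardUI.
rewrite [X in (_ + X)%N]eq_card0 ?addn0.
  apply: eq_card => i; rewrite !inE /=.
  by rewrite orbC -real_neqr_lt ?spectral_diag_real // real0.
move=> i; rewrite !inE; apply/negP => /andP[]/= a b.
by have := lt_trans a b; rewrite ltxx.
Qed.

(** The eigenvectors of positive eigenvalues, scaled to normalise the form. *)
Lemma pos_index_frame : exists W : 'M[C]_(pos_index A, n),
  W *m A *m W^t* = 1%:M.
Proof.
rewrite pos_indexE; set B := [pred i | 0 < d 0 i].
exists (\matrix_(k, j) ((sqrtC (d 0 (enum_val k)))^-1 * P (enum_val (A:=B) k) j)).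
set W := \matrix_(k, j) _.
pose E : 'M[C]_(#|B|, n) := \matrix_(k, i) ((sqrtC (d 0 i))^-1 *+ (enum_val k == i)).
have -> : W = E *m P.
  apply/matrixP => k j; rewrite !mxE (bigD1 (enum_val k)) //= big1 ?addr0.
    by rewrite !mxE eqxx mulr1n.
  by move=> i /negbTE ik; rewrite mxE eq_sym ik mulr0n mul0r.
rewrite adjmx_mul !mulmxA -(mulmxA E) -(mulmxA E) spectral_congr.
apply/matrixP => k l; rewrite mul_mx_diag !mxE (bigD1 (enum_val k)) //= big1 ?addr0.
  rewrite !mxE eqxx mulr1n (inj_eq enum_val_inj) [l == k]eq_sym.
  have dk : 0 < d 0 (enum_val k) by have := enum_valP k; rewrite inE.
  case: eqVneq => [->|_]; last by rewrite mulr0n conjC0 mulr0.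
  rewrite mulr1n -mulrA mulrC (CrealP _); last first.
    by rewrite rpredV ger0_real // sqrtC_ge0 ltW // -[l]/(l); have := enum_valP l; rewrite inE.
  rewrite -mulrA -invfM -expr2 sqrtCK mulfV ?gt_eqF //.
  by have := enum_valP l; rewrite inE.
by move=> i /negbTE ik; rewrite !mxE eq_sym ik mulr0n !mul0r.
Qed.

(** On a subspace where the form is nonnegative and that meets the radical of
    the form trivially, the projection to the positive eigenspaces is
    injective: a vector killed by it has a nonpositive form value, hence lies
    in the radical. *)
Lemma pos_index_lower r (W : 'M[C]_(r, n)) :
  (forall x, x != 0 -> 0 <= qf A (x *m W) /\ x *m W *m A != 0) ->
  (r <= pos_index A)%N.
Proof.
move=> HW; rewrite pos_indexE; set B := [pred i | 0 < d 0 i].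
have PP : P^t* *m P = 1%:M.
  by rewrite -invmx_unitary ?spectral_unitarymx // mulVmx ?spectral_unit.
have AE : A = P^t* *m diag_mx d *m P.
  by rewrite -spectral_congr !mulmxA PP mul1mx -mulmxA PP mulmx1.
pose M : 'M[C]_(r, #|B|) := \matrix_(i, k) (W *m P^t*) i (enum_val k).
suff /eqP <- : row_free M by apply: rank_leq_col.
apply: inj_row_free => x xM; apply/eqP; apply: contraT => x0.
have [qge rad] := HW x x0.
set y := x *m W *m P^t*.
have yB i : i \in B -> y 0 i = 0.
  move=> iB; have /rowP/(_ (enum_rank_in iB i)) := xM.
  rewrite mxE [RHS]mxE => E; rewrite /y -mulmxA mxE -[RHS]E.
  by apply: eq_bigr => j _; rewrite [M _ _]mxE enum_rankK_in.
have qE : qf A (x *m W) = \sum_i d 0 i * `|y 0 i| ^+ 2.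
  rewrite -qf_diag /y AE.
  have {1}-> : P^t* *m diag_mx d *m P = P^t* *m diag_mx d *m (P^t*)^t*.
    by rewrite trmxCK.
  by rewrite qf_congr.
have term_le0 i : d 0 i * `|y 0 i| ^+ 2 <= 0.
  have [iB|iB] := boolP (i \in B); first by rewrite yB // normr0 expr0n mulr0.
  rewrite mulr_le0_ge0 ?exprn_ge0 //.
  by rewrite inE -real_leNgt ?real0 ?spectral_diag_real in iB.
have term0 i : d 0 i * `|y 0 i| ^+ 2 = 0.
  have le0 : \sum_i - (d 0 i * `|y 0 i| ^+ 2) <= 0 by rewrite sumrN oppr_le0 -qE.
  have ge0 : forall j, true -> 0 <= - (d 0 j * `|y 0 j| ^+ 2).
    by move=> j _; rewrite oppr_ge0.
  have /eqP : \sum_i - (d 0 i * `|y 0 i| ^+ 2) = 0.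
    by apply/eqP; rewrite eq_le le0 sumr_ge0.
  rewrite psumr_eq0 // => /allP/(_ i); rewrite mem_index_enum => /(_ isT)/=.
  by rewrite oppr_eq0 => /eqP.
move: rad; rewrite AE !mulmxA -/y.
suff -> : y *m diag_mx d = 0 by rewrite mul0mx eqxx.
apply/rowP => i; rewrite mul_mx_diag mxE [RHS]mxE.
have /eqP := term0 i; rewrite mulf_eq0 expf_eq0 /= normr_eq0.
by case/orP => /eqP ->; rewrite ?mulr0 ?mul0r.
Qed.

End Spectral.

Lemma neg_index_opp n (A : 'M[C]_n) : A^t* = A -> neg_index A = pos_index (- A).
Proof.
move=> hA; rewrite neg_indexE // /pos_index.
have -> : count (> 0) (eigenvalues (- A)) =
          count (> 0) [seq (- spectral_diag A) 0 i | i : 'I_n].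
  apply/permP/(eigenvalues_unitary_diag (spectral_unitaryV A)).
  by rewrite mulmxN mulNmx spectral_congr // linearN.
rewrite count_map -sum1_count big_enum_cond sum1_card.
by apply: eq_card => i; rewrite -!topredE /= [X in _ = (0 < X)]mxE oppr_gt0.
Qed.

Lemma qf_herm_real n (A : 'M[C]_n) x : A^t* = A -> qf A x \is Num.real.
Proof.
move=> hA; apply/CrealP.
have <- : (x *m A *m x^t*)^t* 0 0 = (qf A x)^* by rewrite mxE mxE.
by rewrite congr_herm.
Qed.

Lemma qf0_of_rad n (A : 'M[C]_n) x : x *m A = 0 -> qf A x = 0.
Proof. by rewrite /qf => ->; rewrite mul0mx mxE. Qed.

Lemma pos_index_lower_pos n (A : 'M[C]_n) r (W : 'M[C]_(r, n)) : A^t* = A ->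
  (forall x, x != 0 -> 0 < qf A (x *m W)) -> (r <= pos_index A)%N.
Proof.
move=> hA HW; apply: (pos_index_lower hA) (W) _ => x /HW q0; split; first exact: ltW.
by apply: contraL q0 => /eqP/qf0_of_rad ->; rewrite ltxx.
Qed.

Lemma pos_index_congr_le m n (P : 'M[C]_(m, n)) A : A^t* = A ->
  (pos_index (P *m A *m P^t*) <= pos_index A)%N.
Proof.
move=> hA; have [W HW] := pos_index_frame (congr_herm P hA).
apply: (pos_index_lower_pos (W := W *m P) hA) => x x0.
by rewrite mulmxA -qf_congr -qf_congr HW qf1_gt0.
Qed.

Lemma neg_index_congr_le m n (P : 'M[C]_(m, n)) A : A^t* = A ->
  (neg_index (P *m A *m P^t*) <= neg_index A)%N.
Proof.
move=> hA; rewrite !neg_index_opp ?congr_herm // -mulNmx -mulmxN.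
by apply: pos_index_congr_le; rewrite adjmxN hA.
Qed.

Lemma congr_unitK n (P : 'M[C]_n) A : P \in unitmx ->
  invmx P *m (P *m A *m P^t*) *m (invmx P)^t* = A.
Proof.
move=> Pu; rewrite -!mulmxA -adjmx_mul mulVmx // adjmx1 mulmx1.
by rewrite mulKmx.
Qed.

Lemma pos_index_congr n (P : 'M[C]_n) A : A^t* = A -> P \in unitmx ->
  pos_index (P *m A *m P^t*) = pos_index A.
Proof.
move=> hA Pu; apply/eqP; rewrite eqn_leq pos_index_congr_le //=.
by rewrite -{1}(congr_unitK A Pu) pos_index_congr_le // congr_herm.
Qed.

Lemma neg_index_congr n (P : 'M[C]_n) A : A^t* = A -> P \in unitmx ->
  neg_index (P *m A *m P^t*) = neg_index A.
Proof.
move=> hA Pu; apply/eqP; rewrite eqn_leq neg_index_congr_le //=.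
by rewrite -{1}(congr_unitK A Pu) neg_index_congr_le // congr_herm.
Qed.

(** Normalising the form to the identity on a maximal positive subspace makes
    a perturbation with small entries harmless there. *)
Lemma pos_index_semicont n (A : 'M[C]_n) : A^t* = A ->
  exists2 e : C, 0 < e & forall G : 'M[C]_n, G^t* = G ->
    (forall i j, `|G i j - A i j| <= e) -> (pos_index A <= pos_index G)%N.
Proof.
move=> hA; have [W HW] := pos_index_frame hA; set r := pos_index A in W HW *.
pose c := \sum_k \sum_i `|W k i|.
have c0 : 0 <= c by rewrite !sumr_ge0 // => k _; rewrite sumr_ge0.
have cW k : \sum_i `|W k i| <= c.
  rewrite /c (bigD1 k) //= lerDl sumr_ge0 // => i _.
  by rewrite sumr_ge0.
pose K := c * c * (r * r)%:R + 1.
have K0 : 0 < K by rewrite ltr_wpDl // !mulr_ge0.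
have Ki0 : 0 <= K^-1 by rewrite invr_ge0 ltW.
exists K^-1; first by rewrite invr_gt0.
move=> G hG HG; apply: (pos_index_lower_pos (W := W) hG) => x x0.
pose E := W *m (G - A) *m W^t*.
have hE : E^t* = E by rewrite congr_herm // adjmxB hG hA.
have -> : qf G (x *m W) = qf 1%:M x + qf E x.
  by rewrite qf_congr qfB -HW qf_congr addrCA subrr addr0.
have qx := qf1_gt0 x0; set q := qf 1%:M x in qx *.
have EE k l : `|E k l| <= K^-1 * (c * c).
  rewrite mxE; apply: le_trans (ler_norm_sum _ _ _) _.
  apply: (@le_trans _ _ (\sum_j (K^-1 * c) * `|W l j|)); last first.
    by rewrite -mulr_sumr -mulrA; apply: ler_wpM2l => //; apply: ler_wpM2l.
  apply: ler_sum => j _; rewrite normrM !mxE norm_conjC ler_wpM2r //.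
  apply: le_trans (ler_norm_sum _ _ _) _.
  apply: (@le_trans _ _ (\sum_i K^-1 * `|W k i|)).
    by apply: ler_sum => i _; rewrite normrM mulrC ler_wpM2r // !mxE HG.
  by rewrite -mulr_sumr; apply: ler_wpM2l.
have xq k : `|x 0 k| ^+ 2 <= q.
  rewrite /q qf1 (bigD1 k) //= lerDl; apply: sumr_ge0 => i _.
  exact: exprn_ge0.
have xxq k l : `|x 0 k| * `|x 0 l| <= q.
  have [h|h] := real_leP (normr_real (x 0 k)) (normr_real (x 0 l)).
    by apply: le_trans (xq l); rewrite expr2 ler_wpM2r.
  by apply: le_trans (xq k); rewrite expr2 ler_wpM2l // ltW.
have Ex : `|qf E x| <= K^-1 * (c * c) * (r * r)%:R * q.
  rewrite /qf mxE; apply: le_trans (ler_norm_sum _ _ _) _.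
  have -> : K^-1 * (c * c) * (r * r)%:R * q =
      \sum_(l < r) (\sum_(k < r) K^-1 * (c * c) * q).
    rewrite !sumr_const !card_ord -mulrnA mulrAC mulr_natr //.
  apply: ler_sum => l _; rewrite mxE mulr_suml.
  apply: le_trans (ler_norm_sum _ _ _) _; apply: ler_sum => k _.
  rewrite [_^t* _ _]mxE [_^T _ _]mxE !normrM norm_conjC mulrAC mulrC.
  by apply: ler_pM; rewrite ?mulr_ge0.
have lt1 : K^-1 * (c * c) * (r * r)%:R < 1.
  by rewrite -mulrA mulrC ltr_pdivrMr // mul1r /K ltrDl.
have : - (K^-1 * (c * c) * (r * r)%:R * q) <= qf E x.
  rewrite lerNl; apply: le_trans Ex; rewrite -normrN.
  by rewrite real_ler_norm // rpredN qf_herm_real.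
move=> h; rewrite -ltrBlDl sub0r; apply: lt_le_trans h.
by rewrite ltrN2 gtr_pMl.
Qed.

Lemma neg_index_semicont n (A : 'M[C]_n) : A^t* = A ->
  exists2 e : C, 0 < e & forall G : 'M[C]_n, G^t* = G ->
    (forall i j, `|G i j - A i j| <= e) -> (neg_index A <= neg_index G)%N.
Proof.
move=> hA; have hN : (- A)^t* = - A by rewrite adjmxN hA.
have [e e0 He] := pos_index_semicont hN; exists e => // G hG HG.
rewrite !neg_index_opp //; apply: He => [|i j]; first by rewrite adjmxN hG.
by rewrite !mxE -opprD normrN.
Qed.

Lemma adj_block m1 m2 n1 n2 (A : 'M[C]_(m1, n1)) B D (E : 'M[C]_(m2, n2)) :
  (block_mx A B D E)^t* = block_mx (A^t*) (D^t*) (B^t*) (E^t*).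
Proof. by rewrite tr_block_mx map_block_mx. Qed.

Lemma adj0 m n : (0 : 'M[C]_(m, n))^t* = 0.
Proof. by rewrite trmx0 map_mx0. Qed.

Lemma block_herm m n (A : 'M[C]_m) (B : 'M[C]_(m, n)) D :
  (block_mx A B (B^t*) D)^t* = block_mx A B (B^t*) D <-> A^t* = A /\ D^t* = D.
Proof.
rewrite adj_block trmxCK; split=> [/eq_block_mx[]//|[-> ->]//].
Qed.

Lemma eigenvalues_block_diag m n (A : 'M[C]_m) (D : 'M[C]_n) :
  A^t* = A -> D^t* = D ->
  perm_eq (eigenvalues (block_mx A 0 0 D)) (eigenvalues A ++ eigenvalues D).
Proof.
move=> hA hD; set P := spectralmx A; set Q := spectralmx D.
have h0 m' n' : (0 : 'M[C]_(m', n'))^t* = 0 := adj0 m' n'.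
have /eigenvalues_unitary_diag : block_mx P 0 0 Q *m (block_mx P 0 0 Q)^t* = 1%:M.
  rewrite adj_block !h0 mulmx_block !mulmx0 !mul0mx !addr0 !add0r.
  by rewrite !spectral_unitaryV -scalar_mx_block.
move=> /(_ (block_mx A 0 0 D) (row_mx (spectral_diag A) (spectral_diag D))) H.
apply: perm_trans (H _) _; last first.
  apply: (@perm_trans _ ([seq spectral_diag A 0 i | i : 'I_m] ++ [seq spectral_diag D 0 i | i : 'I_n])).
    apply: prod_XsubC_eq; rewrite big_cat /= !big_image /= big_split_ord /=.
    by congr (_ * _); apply: eq_bigr => i _; rewrite ?row_mxEl ?row_mxEr.
  by apply: perm_cat; rewrite perm_sym eigenvalues_spectral.
rewrite adj_block !h0 !mulmx_block !mulmx0 !mul0mx !addr0 !add0r.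
by rewrite !mul0mx !spectral_congr // diag_mx_row.
Qed.

Lemma pos_index_block_diag m n (A : 'M[C]_m) (D : 'M[C]_n) :
  A^t* = A -> D^t* = D ->
  pos_index (block_mx A 0 0 D) = (pos_index A + pos_index D)%N.
Proof.
by move=> hA hD; rewrite /pos_index (permP (eigenvalues_block_diag hA hD)) count_cat.
Qed.

Lemma neg_index_block_diag m n (A : 'M[C]_m) (D : 'M[C]_n) :
  A^t* = A -> D^t* = D ->
  neg_index (block_mx A 0 0 D) = (neg_index A + neg_index D)%N.
Proof.
by move=> hA hD; rewrite /neg_index (permP (eigenvalues_block_diag hA hD)) count_cat.
Qed.

Lemma eigenvalues_scalar1 (c : C) : eigenvalues (c%:M : 'M[C]_1) = [:: c].
Proof.
rewrite /eigenvalues; case: closed_field_poly_normal => /= r Dr.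
have E : \prod_(x <- r) ('X - x%:P) = \prod_(x <- [:: c]) ('X - x%:P).
  transitivity (char_poly (c%:M : 'M[C]_1)).
    by rewrite Dr (monicP (char_poly_monic _)) scale1r.
  by rewrite /char_poly det_mx11 !mxE eqxx big_seq1.
by have /perm_small_eq -> := prod_XsubC_eq E.
Qed.

Lemma pos_index_scalar1 (c : C) : pos_index (c%:M : 'M[C]_1) = (0 < c).
Proof. by rewrite /pos_index eigenvalues_scalar1 /= addn0. Qed.

Lemma neg_index_scalar1 (c : C) : neg_index (c%:M : 'M[C]_1) = (c < 0).
Proof. by rewrite /neg_index eigenvalues_scalar1 /= addn0. Qed.

Lemma schur_congr m n (A : 'M[C]_m) (B : 'M[C]_(m, n)) (D : 'M[C]_n) :
  A^t* = A -> A \in unitmx ->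
  exists2 P, P \in unitmx &
  P *m block_mx A B (B^t*) D *m P^t* =
    block_mx A 0 0 (D - B^t* *m invmx A *m B).
Proof.
move=> hA Au.
exists (block_mx 1%:M 0 (- (B^t* *m invmx A)) 1%:M).
  by rewrite unitmxE det_lblock !det1 mulr1 unitr1.
have hAi : (invmx A)^t* = invmx A by rewrite trmx_inv map_invmx hA.
rewrite adj_block !adjmx1 adjmxN adjmx_mul hAi trmxCK adj0.
rewrite !mulmx_block !mul1mx !mul0mx !mulmx1 !mulmx0 !addr0.
rewrite !mulNmx !mulmxN mulmxA mulmxV // mul1mx addNr.
by rewrite -(mulmxA _ (invmx A)) mulVmx // mulmx1 addNr mul0mx oppr0 add0r addrC.
Qed.

(** Inertia additivity: the index of a Hermitian block matrix is that of an
    invertible corner plus that of its Schur complement. *)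
Lemma index_schur m n (A : 'M[C]_m) (B : 'M[C]_(m, n)) (D : 'M[C]_n) :
  A^t* = A -> D^t* = D -> A \in unitmx ->
  let H := block_mx A B (B^t*) D in let S := D - B^t* *m invmx A *m B in
  pos_index H = (pos_index A + pos_index S)%N /\
  neg_index H = (neg_index A + neg_index S)%N.
Proof.
move=> hA hD Au H S.
have hH : H^t* = H by apply/block_herm.
have hAi : (invmx A)^t* = invmx A by rewrite trmx_inv map_invmx hA.
have hS : S^t* = S.
  rewrite adjmxB hD; congr (_ - _).
  by rewrite -{2}(trmxCK B) congr_herm // trmxCK.
have [P Pu E] := schur_congr B D hA Au.
split.
  by rewrite -(pos_index_congr hH Pu) E pos_index_block_diag.
by rewrite -(neg_index_congr hH Pu) E neg_index_block_diag.
Qed.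

Lemma index_block_ge m n (A : 'M[C]_m) (B : 'M[C]_(m, n)) (D : 'M[C]_n) :
  A^t* = A -> D^t* = D ->
  let H := block_mx A B (B^t*) D in
  (pos_index A <= pos_index H)%N /\ (neg_index A <= neg_index H)%N.
Proof.
move=> hA hD H; have hH : H^t* = H by apply/block_herm.
have -> : A = row_mx 1%:M 0 *m H *m (row_mx 1%:M 0)^t*.
  rewrite mul_row_block tr_row_mx map_col_mx adjmx1 adj0 !mul1mx !mul0mx.
  by rewrite !addr0 mul_row_col mulmx1 mulmx0 addr0.
by rewrite pos_index_congr_le // neg_index_congr_le.
Qed.

(** Each kernel direction of a corner that the off-diagonal block does not kill
    is isotropic but not radical, so it adds both a positive and a negative
    square. *)
Lemma pos_index_jump m n (A : 'M[C]_m) (B : 'M[C]_(m, n)) (D : 'M[C]_n) :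
  A^t* = A -> D^t* = D ->
  (pos_index A + \rank (kermx A *m B) <= pos_index (block_mx A B (B^t*) D))%N.
Proof.
move=> hA hD; set H := block_mx _ _ _ _.
have hH : H^t* = H by apply/block_herm.
have [W1 HW1] := pos_index_frame hA.
have /submxP[M HM] : (row_base (kermx A *m B) <= kermx A *m B)%MS by rewrite eq_row_base.
pose K := M *m kermx A.
have KA : K *m A = 0 by rewrite -[LHS]mulmxA mulmx_ker mulmx0.
have KB : row_free (K *m B) by rewrite -[K *m B]mulmxA -HM row_base_free.
apply: (pos_index_lower hH) (col_mx (row_mx W1 0) (row_mx K 0)) _ => x x0.
rewrite -[x]hsubmxK mul_row_col !mul_mx_row !mulmx0 add_row_mx addr0.
set x1 := lsubmx x; set x2 := rsubmx x; set y := _ + _.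
have yA : y *m A = x1 *m W1 *m A by rewrite mulmxDl -(mulmxA x2) KA mulmx0 addr0.
have qy : qf A y = qf A (x1 *m W1).
  rewrite /qf yA /y linearD /= map_mxD mulmxDr.
  have AK : A *m K^t* = 0 by have := adjmx_mul K A; rewrite KA adj0 hA => <-.
  have -> : x1 *m W1 *m A *m (x2 *m K)^t* = 0.
    by rewrite (adjmx_mul x2) mulmxA -(mulmxA (x1 *m W1)) AK mulmx0 mul0mx.
  by rewrite addr0.
have q1 : qf A y = qf 1%:M x1 by rewrite qy -HW1 qf_congr.
have Ey : row_mx y 0 *m H = row_mx (y *m A) (y *m B).
  by rewrite mul_row_block !mul0mx !addr0.
split.
  have -> : qf H (row_mx y 0) = qf A y.
    rewrite /qf Ey tr_row_mx map_col_mx adj0 mul_row_col mulmx0 addr0 //.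
  rewrite q1; have [->|/qf1_gt0/ltW//] := eqVneq x1 0.
  by rewrite qf0_of_rad // mul0mx.
apply: contra x0 => /eqP; rewrite Ey -row_mx0 => /eq_row_mx[yA0 yB0].
have x10 : x1 = 0.
  apply/eqP; apply: contraT => /qf1_gt0; rewrite -q1 qf0_of_rad //.
  by rewrite ltxx.
move: yB0; rewrite /y x10 mul0mx add0r -mulmxA => /eqP.
rewrite mulmx_free_eq0 // => /eqP x20.
by rewrite -[x]hsubmxK -/x1 -/x2 x10 x20 row_mx0.
Qed.

Lemma neg_index_jump m n (A : 'M[C]_m) (B : 'M[C]_(m, n)) (D : 'M[C]_n) :
  A^t* = A -> D^t* = D ->
  (neg_index A + \rank (kermx A *m B) <= neg_index (block_mx A B (B^t*) D))%N.
Proof.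
move=> hA hD.
have hNA : (- A)^t* = - A by rewrite adjmxN hA.
have hND : (- D)^t* = - D by rewrite adjmxN hD.
rewrite !neg_index_opp //; last by apply/block_herm.
have -> : - block_mx A B (B^t*) D = block_mx (- A) (- B) ((- B)^t*) (- D).
  by rewrite adjmxN opp_block_mx.
apply: leq_trans (pos_index_jump (- B) hNA hND); rewrite leq_add2l.
apply: mxrankS; rewrite mulmxN eqmx_opp.
by apply: submxMr; apply/sub_kermxP; rewrite mulmxN mulmx_ker oppr0.
Qed.

Lemma dim_kerE n (A : 'M[C]_n) : dim_ker A = (n - \rank A)%N.
Proof. exact: mxrank_coker. Qed.

Lemma det0_rank n (A : 'M[C]_n) : (\det A == 0) = (\rank A < n)%N.
Proof.
rewrite ltn_neqAle rank_leq_row andbT -[_ == n]/(row_free A) row_free_unit.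
by rewrite unitmxE unitfE negbK.
Qed.

End InertiaTheory.

(** * Truncated power series and conjugate reversal of polynomials *)

Section Series.
Variable C : numClosedFieldType.
Implicit Types (p q r g : {poly C}) (s : nat -> C).

Lemma size_pmul p q : p != 0 -> q != 0 -> (size (p * q)%R = (size p + size q).-1)%N.
Proof. exact: size_mul. Qed.

Lemma size_pmul_leq p q : (size (p * q)%R <= (size p + size q).-1)%N.
Proof. exact: size_polyMleq. Qed.

Lemma size_psub_leq p q : (size (p - q)%R <= maxn (size p) (size q))%N.
Proof. by apply: leq_trans (size_polyD _ _) _; rewrite size_polyN. Qed.

Lemma size_pgt0 p : p != 0 -> (0 < size p)%N.
Proof. by rewrite lt0n size_poly_eq0. Qed.

Lemma dvdXnP m p : reflect (forall k, (k < m)%N -> p`_k = 0) ('X^m %| p).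
Proof.
apply: (iffP idP) => [/dvdpP[q ->] k km|H]; first by rewrite coefMXn km.
rewrite -(poly_take_drop m p).
have -> : take_poly m p = 0.
  by apply/polyP => k; rewrite coef_take_poly coef0; case: ifP => // /H.
by rewrite add0r dvdp_mull.
Qed.

Definition series_poly s m : {poly C} := \poly_(k < m) s k.

(** The congruence [s * q = p] modulo [X^m], for the power series with
    coefficients [s]. *)
Definition scong s m q p : bool := 'X^m %| series_poly s m * q - p.

Lemma series_poly_le s m M : (m <= M)%N ->
  'X^m %| series_poly s M - series_poly s m.
Proof.
move=> mM; apply/dvdXnP => k km.
by rewrite coefB !coef_poly km (leq_trans km mM) subrr.
Qed.

Lemma scong_le s m M q p : (m <= M)%N ->
  ('X^m %| series_poly s M * q - p) = scong s m q p.
Proof.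
move=> mM; rewrite /scong.
have -> : series_poly s M * q - p = (series_poly s M - series_poly s m) * q
   + (series_poly s m * q - p) by ring.
by rewrite dvdp_addr // dvdp_mulr // series_poly_le.
Qed.

Lemma scong_trunc s m M q p : (m <= M)%N -> scong s M q p -> scong s m q p.
Proof. by move=> mM; rewrite -(scong_le s q p mM); apply/dvdp_trans/dvdp_exp2l. Qed.

Lemma scong_mul s m q p r : scong s m q p -> scong s m (q * r) (p * r).
Proof.
rewrite /scong => h; have -> : series_poly s m * (q * r) - p * r =
  (series_poly s m * q - p) * r by ring.
by rewrite dvdp_mulr.
Qed.

Lemma scong_cross s m q p q' p' : scong s m q p -> scong s m q' p' ->
  'X^m %| p * q' - p' * q.
Proof.
rewrite /scong => h h'; set A := series_poly s m in h h' *.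
have -> : p * q' - p' * q = (A * q' - p') * q - (A * q - p) * q' by ring.
by rewrite dvdp_sub // dvdp_mulr.
Qed.

Lemma coprimep_Xn m g : g`_0 != 0 -> coprimep 'X^m g.
Proof.
move=> g0; apply: coprimep_expl; rewrite coprimep_sym coprimepX.
by rewrite rootE horner_coef0.
Qed.

Lemma scong_cancel s m g q p : g`_0 != 0 ->
  scong s m (g * q) (g * p) -> scong s m q p.
Proof.
move=> g0; rewrite /scong mulrCA -mulrBr Gauss_dvdpr //.
exact: coprimep_Xn.
Qed.

Lemma scong_XnM s m j q p : scong s (m + j) ('X^j * q) ('X^j * p) = scong s m q p.
Proof.
rewrite -(scong_le s q p (leq_addr j m)) /scong mulrCA -mulrBr addnC exprD.
by rewrite dvdp_mul2l // expf_neq0 // polyX_eq0.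
Qed.

Lemma coef_series_mul s m q k : (k < m)%N ->
  (series_poly s m * q)`_k = \sum_(j < k.+1) s (k - j)%N * q`_j.
Proof.
move=> km; rewrite coefMr; apply: eq_bigr => j _.
by rewrite coef_poly (leq_ltn_trans (leq_subr _ _) km).
Qed.

Lemma scongP s m q p :
  reflect (forall k, (k < m)%N -> \sum_(j < k.+1) s (k - j)%N * q`_j = p`_k)
          (scong s m q p).
Proof.
apply: (iffP (dvdXnP _ _)) => H k km.
  by have := H k km; rewrite coefB (coef_series_mul _ _ km) => /subr0_eq.
by rewrite coefB (coef_series_mul _ _ km) H // subrr.
Qed.

Lemma scong_ext s m q p :
  scong s m.+1 q p = scong s m q p && (\sum_(j < m.+1) s (m - j)%N * q`_j == p`_m).
Proof.
apply/scongP/andP => [H|[/scongP H /eqP Hm] k]; last first.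
  by rewrite ltnS leq_eqVlt => /predU1P[->|/H].
by split; [apply/scongP => k km; apply: H; apply: ltnW | apply/eqP/H].
Qed.

Lemma scong_eq s t m q p : (forall k, (k < m)%N -> s k = t k) ->
  scong s m q p = scong t m q p.
Proof.
move=> st; rewrite /scong; congr (_ %| _ * _ - _).
by apply/polyP => k; rewrite !coef_poly; case: ifP => // /st.
Qed.

(** The reversal [z^e conj(p(1/conj z))]: on the unit circle its modulus is
    that of [p]. *)
Definition crev e p : {poly C} := \poly_(k < e.+1) (p`_(e - k))^*.

Lemma coef_crev e p k : (crev e p)`_k = if (k <= e)%N then (p`_(e - k))^* else 0.
Proof. by rewrite coef_poly ltnS. Qed.

Lemma size_crev e p : (size (crev e p) <= e.+1)%N.
Proof. exact: size_poly. Qed.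

Lemma crevK e p : (size p <= e.+1)%N -> crev e (crev e p) = p.
Proof.
move=> sp; apply/polyP => k; rewrite !coef_crev leq_subr.
case: leqP => ke; first by rewrite conjCK subKn.
by rewrite nth_default // (leq_trans sp).
Qed.

Lemma crevB e p q : crev e (p - q) = crev e p - crev e q.
Proof.
apply/polyP => k; rewrite coefB !coef_crev.
by case: ifP; rewrite ?subr0 // coefB rmorphB.
Qed.

Lemma crevD e p q : crev e (p + q) = crev e p + crev e q.
Proof.
apply/polyP => k; rewrite coefD !coef_crev.
by case: ifP; rewrite ?addr0 // coefD rmorphD.
Qed.

Lemma crev0 e : crev e 0 = 0.
Proof. by apply/polyP => k; rewrite coef_crev !coef0 conjC0 if_same. Qed.

Lemma crevZ e c p : crev e (c *: p) = c^* *: crev e p.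
Proof.
apply/polyP => k; rewrite coefZ !coef_crev.
by case: ifP; rewrite ?mulr0 // coefZ rmorphM.
Qed.

Lemma crev_Xn e i : (i <= e)%N -> crev e 'X^i = 'X^(e - i).
Proof.
move=> ie; apply/polyP => k; rewrite coef_crev !coefXn.
case: leqP => ke; last by case: eqP => // E; lia.
have -> : (e - k == i)%N = (k == e - i)%N by lia.
by rewrite conjC_nat.
Qed.

Lemma crev_sum e I (r : seq I) P (F : I -> {poly C}) :
  crev e (\sum_(i <- r | P i) F i) = \sum_(i <- r | P i) crev e (F i).
Proof. exact: (big_morph _ (crevD e) (crev0 e)). Qed.

Lemma poly_monomials e p : (size p <= e.+1)%N -> p = \sum_(i < e.+1) p`_i *: 'X^i.
Proof.
move=> sp; rewrite -poly_def; apply/polyP => k; rewrite coef_poly.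
by case: ltnP => // ke; rewrite nth_default // (leq_trans sp).
Qed.

Lemma crevM a b p q : (size p <= a.+1)%N -> (size q <= b.+1)%N ->
  crev (a + b) (p * q) = crev a p * crev b q.
Proof.
move=> /poly_monomials ep /poly_monomials eq.
rewrite ep eq mulr_suml !crev_sum mulr_suml; apply: eq_bigr => i _.
rewrite mulr_sumr !crev_sum mulr_sumr; apply: eq_bigr => j _.
have [ia jb] : (i <= a)%N /\ (j <= b)%N by split; rewrite -ltnS.
rewrite -scalerAl -scalerAr scalerA -exprD !crevZ !crev_Xn ?leq_add //.
rewrite -scalerAl -scalerAr scalerA -exprD rmorphM; congr (_ *: 'X^_); lia.
Qed.

Lemma crev_shift e j p : (size p <= e.+1)%N -> crev (j + e) p = 'X^j * crev e p.
Proof.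
move=> sp; rewrite -[p in LHS]mul1r crevM ?size_poly1 //; congr (_ * _).
by rewrite -(expr0 'X) crev_Xn // subn0.
Qed.

Lemma crev_XnM e j p : (size p <= e.+1)%N -> crev (j + e) ('X^j * p) = crev e p.
Proof. by move=> sp; rewrite crevM ?size_polyXn // crev_Xn // subnn mul1r. Qed.

Lemma crev_eq0 e p : (size p <= e.+1)%N -> crev e p = 0 -> p = 0.
Proof. by move=> sp p0; rewrite -(crevK sp) p0 crev0. Qed.

(** A polynomial of degree at most [e] vanishes as soon as its low and its high
    coefficients together exhaust all of them. *)
Lemma crev_vanish e m m' p : (size p <= e.+1)%N -> (e.+1 <= m + m')%N ->
  'X^m %| p -> 'X^m' %| crev e p -> p = 0.
Proof.
move=> sp em /dvdXnP H /dvdXnP H'; apply/polyP => k; rewrite coef0.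
have [/H//|mk] := ltnP k m.
have [ke|ke] := leqP k e; last by rewrite nth_default // (leq_trans sp).
have /H' : (e - k < m')%N by lia.
rewrite coef_crev leq_subr subKn // => /eqP.
by rewrite conjC_eq0 => /eqP.
Qed.

(** A pair with [s q = p] and [s crev(p) = crev(q)] to order [m] has
    [p crev(p) = q crev(q)] exactly: the difference is self-reversed of degree
    at most [2m - 2], and its lower half vanishes. *)
Lemma scong_sym_exact s m p q : (size p <= m.+1)%N -> (size q <= m.+1)%N ->
  scong s m.+1 q p -> scong s m.+1 (crev m p) (crev m q) ->
  p * crev m p = q * crev m q.
Proof.
move=> sp sq h1 h2; apply/eqP; rewrite -subr_eq0; apply/eqP.
have s1 := size_crev m p; have s2 := size_crev m q.
have D0 : 'X^(m.+1) %| p * crev m p - q * crev m q.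
  by rewrite [q * _]mulrC; apply: scong_cross h1 h2.
apply: (@crev_vanish (m + m) m.+1 m.+1 _ _ _ D0); last 1 first.
- by rewrite crevB !crevM // !crevK // [crev m p * _]mulrC [crev m q * _]mulrC.
- apply: leq_trans (size_psub_leq _ _) _; rewrite geq_max.
  by apply/andP; split; apply: leq_trans (size_pmul_leq _ _) _; lia.
- by lia.
Qed.

(** Cancelling the greatest common divisor of a self-reversed pair leaves a
    numerator that is, up to a unimodular factor, the reversal of the
    denominator: the boundary values of the fraction have modulus one. *)
Lemma crev_reduce m p q : (size p <= m.+1)%N -> (size q <= m.+1)%N ->
  q != 0 -> p * crev m p = q * crev m q ->
  exists k g q1 c, [/\ (k <= m)%N, g != 0, (size q1 <= k.+1)%N, c * c^* = 1 &
    [/\ q = g * q1, p = g * (c *: crev k q1) & coprimep (c *: crev k q1) q1]].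
Proof.
move=> sp sq q0 E; pose g : {poly C} := gcdp p q.
have g0 : g != 0 by rewrite gcdp_eq0 negb_and q0 orbT.
have [p1 [q1 [pE qE cop]]] : exists p1 q1 : {poly C},
    [/\ p = g * p1, q = g * q1 & coprimep p1 q1].
  exists (p %/ g), (q %/ g); split; last by apply: coprimep_div_gcd; rewrite q0 orbT.
    by rewrite mulrC divpK // dvdp_gcdl.
  by rewrite mulrC divpK // dvdp_gcdr.
have q10 : q1 != 0 by apply: contraNneq q0 => h; rewrite qE h mulr0.
have p0 : p != 0.
  apply: contraNneq q0 => h; move: E; rewrite h mul0r => /esym/eqP.
  rewrite mulf_eq0 => /orP[//|/eqP]; by move/(crev_eq0 sq) => ->.
have p10 : p1 != 0 by apply: contraNneq p0 => h; rewrite pE h mulr0.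
pose e := (size g).-1.
have sg : size g = e.+1 by rewrite /e prednK // size_pgt0.
have sp1 : (size p1 + e <= m.+1)%N.
  by move: sp; rewrite pE size_pmul // sg; lia.
have sq1 : (size q1 + e <= m.+1)%N.
  by move: sq; rewrite qE size_pmul // sg; lia.
have em : (e <= m)%N.
  by move: sq1; have := size_pgt0 q10; lia.
pose k := (m - e)%N; have mE : m = (e + k)%N by rewrite /k subnKC //.
have sp1k : (size p1 <= k.+1)%N by lia.
have sq1k : (size q1 <= k.+1)%N by lia.
have E1 : p1 * crev k p1 = q1 * crev k q1.
  have gg0 : g * crev e g != 0.
    rewrite mulf_neq0 //; apply: contraNneq g0.
    by move/(crev_eq0 (eq_leq sg)) ->.
  apply: (mulfI gg0); move: E; rewrite mE pE qE !crevM ?sg //.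
  by rewrite mulrACA => ->; rewrite mulrACA.
have /dvdpP[h hE] : p1 %| crev k q1.
  by rewrite -(Gauss_dvdpr _ cop) -E1 dvdp_mulr.
have hE' : crev k p1 = h * q1.
  by apply: (mulfI p10); rewrite E1 hE; ring.
have h0 : h != 0.
  apply: contraNneq q10 => h0; apply/eqP/(crev_eq0 sq1k).
  by rewrite hE h0 mul0r.
pose t := (size h).-1.
have sh : size h = t.+1 by rewrite /t prednK // size_pgt0.
have sp1t : (size p1 + t <= k.+1)%N.
  by have := size_crev k q1; rewrite hE size_pmul // sh; lia.
have sq1t : (size q1 + t <= k.+1)%N.
  by have := size_crev k p1; rewrite hE' size_pmul // sh; lia.
have tk : (t <= k)%N.
  by move: sq1t; have := size_pgt0 q10; lia.
pose k' := (k - t)%N; have kE : k = (t + k')%N by rewrite /k' subnKC //.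
have sp1' : (size p1 <= k'.+1)%N by lia.
have sq1' : (size q1 <= k'.+1)%N by lia.
have q1E : q1 = crev t h * crev k' p1.
  by rewrite -crevM ?sh // -hE -kE crevK.
have p1E : p1 = crev t h * crev k' q1.
  by rewrite -crevM ?sh // -hE' -kE crevK.
have /size_poly1P[c c0 cE] : size (crev t h) == 1%N.
  have d1 : crev t h %| p1 by rewrite p1E dvdp_mulr.
  have d2 : crev t h %| q1 by rewrite q1E dvdp_mulr.
  by rewrite size_poly_eq1; have /coprimepP/(_ _ d1 d2) := cop.
exists k', g, q1, c.
have p1E' : p1 = c *: crev k' q1 by rewrite {1}p1E cE mul_polyC.
have q1E' : q1 = c *: crev k' p1 by rewrite {1}q1E cE mul_polyC.
split=> //; first by lia.
- have : q1 = (c * c^*) *: q1.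
    by rewrite {1}q1E' {1}p1E' crevZ crevK // scalerA.
  move/eqP; rewrite -{1}[q1]scale1r -subr_eq0 -scalerBl scaler_eq0 (negPf q10) orbF.
  by rewrite subr_eq0 => /eqP.
- by rewrite -p1E'.
Qed.

(** * The defect matrices of a power series *)

Lemma entryD m n (A B : 'M[C]_(m, n)) i j : (A + B) i j = A i j + B i j.
Proof. by rewrite mxE. Qed.

Lemma entryN m n (A : 'M[C]_(m, n)) i j : (- A) i j = - A i j.
Proof. by rewrite mxE. Qed.

Lemma entryZ m n (a : C) (A : 'M[C]_(m, n)) i j : (a *: A) i j = a * A i j.
Proof. by rewrite mxE. Qed.

Definition toep s m : 'M[C]_m :=
  \matrix_(i, j) (if (j <= i)%N then s (i - j)%N else 0).

Definition defect s m : 'M[C]_m := 1%:M - toep s m *m (toep s m)^t*.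

Definition defect_coef s i j : C :=
  (i == j)%:R - \sum_(l < (minn i j).+1) s (i - l)%N * (s (j - l)%N)^*.

Lemma gram_defectE (a : seq C) (r : nat) : gram_defect a r = defect (nth 0 a) r.
Proof. by []. Qed.

Lemma defect_herm s m : (defect s m)^t* = defect s m.
Proof. by rewrite adjmxB adjmx1 adjmx_mul trmxCK. Qed.

Lemma toep_gram (f g : nat -> C) m (i j : 'I_m) : (toep f m *m (toep g m)^t*) i j =
  \sum_(l < (minn i j).+1) f (i - l)%N * (g (j - l)%N)^*.
Proof.
rewrite mxE.
rewrite (big_ord_widen m (fun l => f (i - l)%N * (g (j - l)%N)^*)); last first.
  by rewrite gtn_min ltn_ord.
rewrite [RHS]big_mkcond; apply: eq_bigr => l _; rewrite !mxE ltnS leq_min.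
by case: (leqP l i); case: (leqP l j); rewrite ?mul0r ?conjC0 ?mulr0 //= ?mul0r ?conjC0 ?mulr0.
Qed.

Lemma defectE s m (i j : 'I_m) : defect s m i j = defect_coef s i j.
Proof.
by rewrite /defect [LHS]mxE [X in X + _]mxE [X in _ + X]mxE toep_gram.
Qed.

Lemma defect_coefC s i j : (defect_coef s i j)^* = defect_coef s j i.
Proof.
rewrite /defect_coef rmorphB rmorph_sum rmorph_nat eq_sym minnC; congr (_ - _).
by apply: eq_bigr => l _; rewrite rmorphM /= conjCK mulrC.
Qed.

Lemma defect_eq s t m : (forall k, (k < m)%N -> s k = t k) ->
  defect s m = defect t m.
Proof.
move=> st; apply/matrixP => i j; rewrite !defectE; congr (_ - _).
by apply: eq_bigr => l _; rewrite !st //; apply: leq_ltn_trans (leq_subr _ _) (ltn_ord _).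
Qed.

Lemma defect_block s n k : exists B D, D^t* = D /\
  defect s (n + k) = block_mx (defect s n) B (B^t*) D.
Proof.
set N := defect s (n + k).
have drE i j : drsubmx N i j = defect_coef s (n + i) (n + j).
  by rewrite [LHS]mxE [LHS]mxE defectE.
have urE i j : ursubmx N i j = defect_coef s i (n + j).
  by rewrite [LHS]mxE [LHS]mxE defectE.
have dlE i j : dlsubmx N i j = defect_coef s (n + i) j.
  by rewrite [LHS]mxE [LHS]mxE defectE.
exists (ursubmx N), (drsubmx N); split.
  by apply/matrixP => i j; rewrite [LHS]mxE [X in X^*]mxE !drE defect_coefC.
rewrite -[LHS]submxK; congr block_mx; apply/matrixP => i j.
  by rewrite [LHS]mxE [LHS]mxE !defectE.
by rewrite dlE [RHS]mxE [X in X^*]mxE urE defect_coefC.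
Qed.

Lemma index_defect_le s n m : (n <= m)%N ->
  (pos_index (defect s n) <= pos_index (defect s m))%N /\
  (neg_index (defect s n) <= neg_index (defect s m))%N.
Proof.
move=> nm; rewrite -(subnKC nm); have [B [D [hD ->]]] := defect_block s n (m - n).
exact: index_block_ge (defect_herm s n) hD.
Qed.

(** The first column of the Toeplitz matrix splits off as a rank one term, and the
    other columns form the next smaller matrix. Appending a coefficient thus
    becomes a rank one perturbation, whose effect a Schur complement measures. *)
Lemma defect_displacement s n (w := \col_(i < 1 + n) s i) :
  defect s (1 + n) = block_mx 1%:M 0 0 (defect s n) - w *m w^t*.
Proof.
apply/matrixP => i j.
have wE : (w *m w^t*) i j = s i * (s j)^* by rewrite mxE big_ord1 !mxE.
rewrite defectE [RHS]mxE [(- (w *m w^t*)) i j]mxE wE [block_mx _ _ _ _ _ _]mxE.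
rewrite /defect_coef; case: splitP => i' ->; rewrite ?ord1 [row_mx _ _ _ _]mxE;
  case: splitP => j' ->; rewrite ?ord1.
- by rewrite min0n big_ord1 !subn0 mxE.
- by rewrite min0n big_ord1 !subn0 mxE.
- by rewrite minn0 big_ord1 !subn0 mxE.
rewrite defectE /defect_coef !add1n eqSS minnSS big_ord_recl opprD addrCA addrC.
by rewrite !subn0.
Qed.

(** Kernel vectors are encoded by polynomials with conjugate coefficients, so
    that multiplying by the adjoint Toeplitz matrix becomes multiplying by the
    power series, and multiplying by the Toeplitz matrix does so after
    reversal. *)
Definition conj_row m p : 'rV[C]_m := \row_i (p`_i)^*.

Lemma conj_row_toepC s m p q :
  (conj_row m q *m (toep s m)^t* == conj_row m p) = scong s m q p.
Proof.
have E (k : 'I_m) : (conj_row m q *m (toep s m)^t*) 0 k =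
    (\sum_(j < k.+1) s (k - j)%N * q`_j)^*.
  rewrite mxE (big_ord_widen m (fun j => s (k - j)%N * q`_j)) //.
  rewrite rmorph_sum [RHS]big_mkcond; apply: eq_bigr => j _; rewrite !mxE ltnS.
  by case: ifP; rewrite ?conjC0 ?mulr0 // rmorphM mulrC.
apply/eqP/scongP => [H k km|H]; last first.
  by apply/rowP => k; rewrite E H // mxE.
have /rowP/(_ (Ordinal km)) := H; rewrite E mxE /= => /(congr1 Num.conj).
by rewrite !conjCK.
Qed.

Lemma conj_row_toep s m p q :
  (conj_row m.+1 p *m toep s m.+1 == conj_row m.+1 q) =
  scong s m.+1 (crev m p) (crev m q).
Proof.
have E (k : 'I_m.+1) : (conj_row m.+1 p *m toep s m.+1) 0 (rev_ord k) =
    \sum_(j < k.+1) s (k - j)%N * (crev m p)`_j.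
  rewrite mxE (big_ord_widen m.+1 (fun j => s (k - j)%N * (crev m p)`_j)) //.
  rewrite [RHS]big_mkcond (reindex_inj rev_ord_inj).
  apply: eq_bigr => j _; have jm := ltn_ord j; have km := ltn_ord k.
  rewrite !mxE /= !subSS ltnS coef_crev.
  have -> : (m - k <= m - j)%N = (j <= k)%N by lia.
  have -> : (j <= m)%N by lia.
  case: ifP => jk; rewrite ?mulr0 // mulrC; congr (s _ * _).
  by lia.
apply/eqP/scongP => [H k km|H].
  have /rowP/(_ (rev_ord (Ordinal km))) := H; rewrite E => ->.
  by rewrite mxE coef_crev -ltnS km /= subSS.
apply/rowP => k; rewrite -[k]rev_ordK E H // mxE coef_crev -ltnS ltn_ord /=.
by rewrite subSS.
Qed.

Definition defect_pair s m p q :=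
  [/\ (size p <= m.+1)%N, (size q <= m.+1)%N, scong s m.+1 q p &
      scong s m.+1 (crev m p) (crev m q)].

Lemma conj_row_ker s m p q : scong s m.+1 (crev m p) (crev m q) ->
  (conj_row m.+1 p *m defect s m.+1 == 0) = scong s m.+1 q p.
Proof.
rewrite -conj_row_toep -conj_row_toepC => /eqP E.
by rewrite mulmxBr mulmx1 mulmxA E subr_eq0 eq_sym.
Qed.

Lemma defect_pair_ker s m p q : defect_pair s m p q ->
  conj_row m.+1 p *m defect s m.+1 = 0.
Proof. by case=> _ _ h1 h2; apply/eqP; rewrite (conj_row_ker h2). Qed.

Lemma conj_row_surj m (x : 'rV[C]_m) :
  exists2 p : {poly C}, (size p <= m)%N & conj_row m p = x.
Proof.
exists (rVpoly (map_mx Num.conj x)); first exact: size_poly.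
by apply/rowP => i; rewrite mxE coef_rVpoly_ord mxE conjCK.
Qed.

Lemma conj_row_eq0 m p : (size p <= m)%N -> (conj_row m p == 0) = (p == 0).
Proof.
move=> sp; apply/eqP/eqP => [/rowP H|->]; last first.
  by apply/rowP => i; rewrite !mxE coef0 conjC0.
apply/polyP => k; rewrite coef0; have [km|mk] := ltnP k m; last first.
  by rewrite nth_default // (leq_trans sp).
by have := H (Ordinal km); rewrite !mxE => /eqP; rewrite conjC_eq0 => /eqP.
Qed.

Lemma ker_defect_pair s m (x : 'rV[C]_m.+1) : x *m defect s m.+1 = 0 ->
  exists p q, defect_pair s m p q /\ x = conj_row m.+1 p.
Proof.
have [p sp <-] := conj_row_surj x => xN.
have [q sq qE] := conj_row_surj (conj_row m.+1 p *m toep s m.+1).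
exists p, q; split=> //.
have h2 : scong s m.+1 (crev m p) (crev m q) by rewrite -conj_row_toep qE.
by split=> //; rewrite -(conj_row_ker h2) xN.
Qed.

Lemma scong_num0 s m q p : (size p <= m)%N -> scong s m q p -> q = 0 -> p = 0.
Proof.
move=> sp /scongP H q0; apply/polyP => k; rewrite coef0.
have [km|mk] := ltnP k m; last by rewrite nth_default // (leq_trans sp).
by rewrite -H // q0 big1 // => j _; rewrite coef0 mulr0.
Qed.

Lemma defect_pair_rev s m p q : defect_pair s m p q ->
  defect_pair s m (crev m q) (crev m p).
Proof. by case=> sp sq h1 h2; split; rewrite ?size_crev // !crevK. Qed.

Lemma defect_pair_den0 s m p q : defect_pair s m p q -> (q == 0) = (p == 0).
Proof.
move=> H; have [sp sq h1 _] := H; have [sp' sq' h1' _] := defect_pair_rev H.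
apply/eqP/eqP => [/(scong_num0 sp h1)//|p0].
by apply: (crev_eq0 sq); apply: (scong_num0 sp' h1'); rewrite p0 crev0.
Qed.

(** A kernel vector of [defect s m.+1] extends by zeros to one of a larger
    defect matrix exactly when its congruence holds to the larger order. *)
Lemma defect_pair_tail s m k p q B D :
  defect s (m.+1 + k) = block_mx (defect s m.+1) B (B^t*) D ->
  defect_pair s m p q ->
  (conj_row m.+1 p *m B == 0) = scong s (m.+1 + k) q p.
Proof.
move=> NE H; have [sp sq _ h2] := H.
have h2' : scong s (m + k).+1 (crev (m + k) p) (crev (m + k) q).
  by rewrite addnC !crev_shift // [(k + m)%N]addnC -addSn scong_XnM.
rewrite -(conj_row_ker h2').
have -> : conj_row (m.+1 + k) p = row_mx (conj_row m.+1 p) 0.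
  apply/rowP => i; rewrite !mxE; case: splitP => j ->; rewrite !mxE //.
  by rewrite nth_default ?conjC0 // (leq_trans sp) ?leq_addr.
rewrite -[(m + k).+1]/(m.+1 + k)%N NE mul_row_block !mul0mx !addr0.
rewrite (defect_pair_ker H).
by apply/eqP/eqP => [->|]; rewrite ?row_mx0 // -row_mx0 => /eq_row_mx[].
Qed.

Lemma index_jump_rank s m k (r : nat) :
  (forall B D, defect s (m.+1 + k) = block_mx (defect s m.+1) B (B^t*) D ->
     (r <= \rank (kermx (defect s m.+1) *m B))%N) ->
  (pos_index (defect s m.+1) + r <= pos_index (defect s (m.+1 + k)))%N /\
  (neg_index (defect s m.+1) + r <= neg_index (defect s (m.+1 + k)))%N.
Proof.
move=> H; have [B [D [hD NE]]] := defect_block s m.+1 k.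
have hr := H _ _ NE; have hN := defect_herm s m.+1; rewrite NE; split.
  by apply: leq_trans (pos_index_jump B hN hD); rewrite leq_add2l.
by apply: leq_trans (neg_index_jump B hN hD); rewrite leq_add2l.
Qed.

(** When no kernel vector persists, the off-diagonal block is injective on the
    kernel and every kernel direction adds a square of each sign. *)
Lemma index_jump_full s m k :
  (forall p q, defect_pair s m p q -> scong s (m.+1 + k) q p -> p = 0) ->
  (pos_index (defect s m.+1) + dim_ker (defect s m.+1) <= pos_index (defect s (m.+1 + k)))%N /\
  (neg_index (defect s m.+1) + dim_ker (defect s m.+1) <= neg_index (defect s (m.+1 + k)))%N.
Proof.
move=> H; apply: index_jump_rank => B D NE.
rewrite dim_kerE -mxrank_ker -(mxrank_mul_ker (kermx (defect s m.+1)) B).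
set K := (_ :&: _)%MS.
suff -> : K = 0 by rewrite mxrank0 addn0.
apply/eqP/rowV0P => x; rewrite sub_capmx => /andP[/sub_kermxP xN /sub_kermxP xB].
have [p [q [Hpq xE]]] := ker_defect_pair xN.
move/eqP: xB; rewrite xE (defect_pair_tail NE Hpq) => /(H _ _ Hpq) ->.
by apply/eqP; rewrite conj_row_eq0 ?size_poly0.
Qed.

Lemma index_jump_one s m k p q :
  defect_pair s m p q -> ~~ scong s (m.+1 + k) q p ->
  (pos_index (defect s m.+1) < pos_index (defect s (m.+1 + k)))%N /\
  (neg_index (defect s m.+1) < neg_index (defect s (m.+1 + k)))%N.
Proof.
move=> H nc; rewrite -addn1 -[(neg_index _).+1]addn1; apply: index_jump_rank => B D NE.
rewrite lt0n mxrank_eq0; apply: contra nc => /eqP KB.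
rewrite -(defect_pair_tail NE H).
have /sub_kermxP/submxP[y ->] := defect_pair_ker H.
by rewrite -mulmxA KB mulmx0.
Qed.

Lemma rank_defect s m : \rank (defect s m) =
  (pos_index (defect s m) + neg_index (defect s m))%N.
Proof. by rewrite rank_index // defect_herm. Qed.

Lemma rank_defect_le s n m : (n <= m)%N -> (\rank (defect s n) <= \rank (defect s m))%N.
Proof. by move=> /(index_defect_le s)[h1 h2]; rewrite !rank_defect leq_add. Qed.

(** * Fractions with unimodular boundary values *)

(** [c *: crev k q / q] in lowest terms, holomorphic at the origin: a quotient
    of two Blaschke products of total degree [k]. *)
Definition blaschke_data k c q :=
  [/\ (size q <= k.+1)%N, q`_0 != 0, c * c^* = 1 & coprimep (c *: crev k q) q].

Definition bezout_coef q p i j : C :=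
  \sum_(l < (minn i j).+1) (q`_(i - l) * (q`_(j - l))^* - p`_(i - l) * (p`_(j - l))^*).

Definition bezout_mx q p m : 'M[C]_m := \matrix_(i, j) bezout_coef q p i j.

Lemma bezout_coefC q p i j : (bezout_coef q p i j)^* = bezout_coef q p j i.
Proof.
rewrite /bezout_coef rmorph_sum minnC; apply: eq_bigr => l _.
by rewrite rmorphB !rmorphM /= !conjCK [_ * q`__]mulrC [_ * p`__]mulrC.
Qed.

Lemma bezout_mxE q p m : bezout_mx q p m =
  toep (nth 0 q) m *m (toep (nth 0 q) m)^t* - toep (nth 0 p) m *m (toep (nth 0 p) m)^t*.
Proof.
by apply/matrixP => i j; rewrite [LHS]mxE [RHS]mxE [X in _ = _ + X]mxE !toep_gram -sumrB.
Qed.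

Lemma bezout_herm q p m : (bezout_mx q p m)^t* = bezout_mx q p m.
Proof. by apply/matrixP => i j; rewrite !mxE bezout_coefC. Qed.

Lemma bezout_coefS q p i j : bezout_coef q p i.+1 j.+1 =
  q`_i.+1 * (q`_j.+1)^* - p`_i.+1 * (p`_j.+1)^* + bezout_coef q p i j.
Proof. by rewrite /bezout_coef minnSS big_ord_recl !subn0. Qed.

Lemma toep_scong s m q p : scong s m q p ->
  toep (nth 0 q) m *m toep s m = toep (nth 0 p) m.
Proof.
case: m => [|m] H; first by apply/matrixP => -[].
have rowE r (i : 'I_m.+1) : row i (toep (nth 0 r) m.+1) = conj_row m.+1 (crev i r).
  apply/rowP => j; rewrite !mxE coef_crev; case: ifP; rewrite ?conjC0 //.
  by rewrite conjCK.
have coefE (i : 'I_m.+1) r k : (k < m.+1)%N ->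
    (crev m (crev i r))`_k = ('X^(m - i) * r)`_k.
  move=> km; have im := ltn_ord i; rewrite coef_crev coefXnM coef_crev.
  have -> : (k <= m)%N by lia.
  case: (leqP (m - k) i) => h.
    have -> : (k < m - i)%N = false by lia.
    by rewrite conjCK; congr (_`__); lia.
  by rewrite conjC0 ifT //; lia.
apply: (proj1 (row_matrixP _ _)) => i; rewrite row_mul !rowE; apply/eqP.
rewrite conj_row_toep; apply/scongP => k km.
have /(scong_mul ('X^(m - i)))/scongP/(_ k km) := H.
rewrite mulrC coefE // [p * _]mulrC => <-; apply: eq_bigr => j _.
by rewrite coefE 1?mulrC // (leq_trans _ km).
Qed.

Lemma toep_unit q m : q`_0 != 0 -> toep (nth 0 q) m \in unitmx.
Proof.
move=> q0; rewrite unitmxE det_trig; last first.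
  by apply/is_trig_mxP => i j ij; rewrite mxE leqNgt ij.
by rewrite unitfE; apply/prodf_neq0 => i _; rewrite mxE leqnn subnn.
Qed.

(** Multiplying by the lower triangular Toeplitz matrix of the denominator
    trades the power series for the numerator, hence the defect matrix for a
    Bezoutian of the same inertia. *)
Lemma bezout_congr s m q p : scong s m q p ->
  bezout_mx q p m = toep (nth 0 q) m *m defect s m *m (toep (nth 0 q) m)^t*.
Proof.
move=> H; rewrite mulmxBr mulmx1 mulmxBl bezout_mxE -(toep_scong H).
by rewrite !adjmx_mul !mulmxA.
Qed.

Lemma bezout_index s m q p : q`_0 != 0 -> scong s m q p ->
  pos_index (bezout_mx q p m) = pos_index (defect s m) /\
  neg_index (bezout_mx q p m) = neg_index (defect s m).
Proof.
move=> q0 H; rewrite (bezout_congr H).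
by rewrite pos_index_congr ?neg_index_congr ?toep_unit // defect_herm.
Qed.

Section BlaschkeData.
Variables (k : nat) (c : C) (q : {poly C}).
Hypothesis H : blaschke_data k c q.
Let p : {poly C} := c *: crev k q.

Let sq : (size q <= k.+1)%N. Proof. by case: H. Qed.
Let q0 : q`_0 != 0. Proof. by case: H. Qed.
Let cc : c * c^* = 1. Proof. by case: H. Qed.
Let c0 : c != 0.
Proof. by apply: contraTneq isT => c0; move/eqP: cc; rewrite c0 mul0r eq_sym oner_eq0. Qed.

Lemma blaschke_size_num : size p = k.+1.
Proof.
apply/eqP; rewrite eqn_leq; apply/andP; split.
  by rewrite /p size_scale // size_crev.
apply: contraNT q0 => /negbTE pk.
have : p`_k = 0 by rewrite nth_default // leqNgt pk.
rewrite /p coefZ coef_crev leqnn subnn => /eqP.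
by rewrite mulf_eq0 (negPf c0) conjC_eq0.
Qed.

Lemma blaschke_crev_num : crev k p = c^* *: q.
Proof. by rewrite /p crevZ crevK. Qed.

Lemma blaschke_crev_den : crev k q = c^* *: p.
Proof. by rewrite /p scalerA mulrC cc scale1r. Qed.

(** Numerator and denominator are reversals of each other, so the Bezoutian
    coefficients vanish from index [k] on: a kernel of rank [k]. *)
Lemma bezout_coef_high i j : (k <= i)%N -> bezout_coef q p i j = 0.
Proof.
have high (r : nat) : (k < r)%N -> q`_r = 0 /\ p`_r = 0.
  by move=> kr; rewrite !nth_default // ?blaschke_size_num // (leq_trans sq).
have top j0 : (j0 <= k)%N -> bezout_coef q p k j0 = 0.
  move: j0 => {}j jk; rewrite /bezout_coef (minn_idPr jk) sumrB; apply/eqP.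
  rewrite subr_eq0; apply/eqP; rewrite [RHS](reindex_inj rev_ord_inj) /=.
  apply: eq_bigr => l _; rewrite subSS /p !coefZ !coef_crev.
  have lj : (l <= j)%N by rewrite -ltnS.
  have -> : (k - (j - l) <= k)%N by lia.
  have -> : (j - (j - l) <= k)%N by lia.
  have -> : (k - (k - (j - l)))%N = (j - l)%N by lia.
  have -> : (k - (j - (j - l)))%N = (k - l)%N by lia.
  by rewrite rmorphM /= conjCK mulrACA cc mul1r mulrC.
have low t j0 : (j0 <= k + t)%N -> bezout_coef q p (k + t) j0 = 0.
  move: j0 => {}j; elim: t j => [|t IH] [|j]; rewrite ?addn0; [by apply: top|by apply: top| |].
    move=> _; have [h1 h2] := high (k + t.+1)%N ltac:(lia).
    by rewrite /bezout_coef minn0 big_ord1 !subn0 h1 h2 !mul0r subr0.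
  rewrite addnS ltnS => jt; have [h1 h2] := high (k + t).+1 ltac:(lia).
  by rewrite bezout_coefS h1 h2 !mul0r subr0 add0r IH.
move=> ki; have [ji|/ltnW ij] := leqP j i; first by rewrite -(subnKC ki) low ?subnKC.
rewrite -bezout_coefC -(subnKC (leq_trans ki ij)) low ?conjC0 //.
by rewrite subnKC // (leq_trans ki).
Qed.

Lemma rank_defect_blaschke s m : scong s m q p -> (\rank (defect s m) <= k)%N.
Proof.
move=> sc; have [mk|/ltnW km] := leqP m k; first exact: leq_trans (rank_leq_row _) mk.
have -> : \rank (defect s m) = \rank (bezout_mx q p m).
  have [h1 h2] := bezout_index q0 sc.
  by rewrite -(rank_index (defect_herm s m)) -(rank_index (bezout_herm q p m)) h1 h2.
have -> : bezout_mx q p m = pid_mx k *m bezout_mx q p m.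
  apply/matrixP => i j; rewrite [RHS]mxE (bigD1 i) //= big1 ?addr0.
    rewrite !mxE eqxx; case: ltnP => ik; rewrite ?mul1r // bezout_coef_high //.
    by rewrite mulr0.
  by move=> l /negbTE li; rewrite mxE -val_eqE /= in li *; rewrite eq_sym li mul0r.
by apply: leq_trans (mxrankM_maxl _ _) _; rewrite rank_pid_mx.
Qed.

(** A kernel pair [f, g] at order [k] satisfies [p g = q f] exactly; coprimality
    then forces [p] to divide [f], whose degree is too small. *)
Lemma defect_blaschke_unit s : scong s k q p -> defect s k \in unitmx.
Proof.
case: (posnP k) => [k0|].
  by move=> _; rewrite k0 unitmxE det_mx00 unitr1.
rewrite -row_free_unit; move: (bezout_coef_high) blaschke_size_num blaschke_crev_num blaschke_crev_den.
move=> _ sp cp cq k_gt0; rewrite -[k](prednK k_gt0).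
set m := k.-1; have kE : k = (1 + m)%N by rewrite add1n prednK.
move=> sc; apply: inj_row_free => x /ker_defect_pair[f [g [[sf sg h1 h2] ->]]].
suff g0 : f = 0 by apply/eqP; rewrite conj_row_eq0 ?g0 ?size_poly0.
have sqm : (size q <= m.+2)%N by rewrite -[m.+2]/(1 + m).+1 -kE.
have spm : (size p <= m.+2)%N by rewrite sp kE.
have E : p * g - f * q = 0.
  apply: (@crev_vanish ((1 + m) + m) m.+1 m.+1).
  - apply: leq_trans (size_psub_leq _ _) _; rewrite geq_max; apply/andP.
    by split; apply: leq_trans (size_pmul_leq _ _) _; lia.
  - by lia.
  - exact: scong_cross sc h1.
  have -> : crev (1 + m + m) (p * g - f * q) =
      crev (1 + m) p * crev m g - crev (1 + m) q * crev m f.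
    by rewrite crevB (mulrC f) !crevM.
  rewrite -kE cp cq.
  have -> : (c^* *: q) * crev m g - (c^* *: p) * crev m f =
      - (c^* *: (p * crev m f - q * crev m g)) by rewrite scalerBr !scalerAl opprB.
  rewrite dvdpNr dvdpZr ?conjC_eq0 //.
  by rewrite [q * _]mulrC; apply: scong_cross sc h2.
have /dvdpP[h fE] : p %| f.
  have [_ _ _ cop] := H; rewrite -(Gauss_dvdpl _ cop).
  by apply/dvdpP; exists g; rewrite -(subr0_eq E) mulrC.
have [h0|h0] := eqVneq h 0; first by rewrite fE h0 mul0r.
have p0 : p != 0 by rewrite -size_poly_gt0 sp.
by move: sf; rewrite fE size_pmul // sp kE; have := size_pgt0 h0; lia.
Qed.

End BlaschkeData.

(** * Singular defect matrices *)

Lemma poly_X_factor q : q != 0 ->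
  exists j g, [/\ q = 'X^j * g, g`_0 != 0 & (j < size q)%N].
Proof.
move=> q0; have [j [g]] := multiplicity_XsubC q 0; rewrite q0 /= subr0 => g0 qE.
have g00 : g`_0 != 0 by move: g0; rewrite rootE horner_coef0.
exists j, g; split=> //; first by rewrite mulrC.
have g1 : g != 0 by apply: contraNneq g00 => ->; rewrite coef0.
have X0 : 'X^j != 0 :> {poly C} by rewrite expf_neq0 // polyX_eq0.
by rewrite qE size_pmul // size_polyXn; have := size_pgt0 g1; lia.
Qed.

Lemma scong_divide s M j g q p : g != 0 -> (size g <= j.+1)%N ->
  scong s (M + j) (g * q) (g * p) -> scong s M q p.
Proof.
move=> g0 sg; have [i [h [gE h0 ij]]] := poly_X_factor g0.
rewrite gE -!mulrA => H; apply: (scong_cancel h0).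
rewrite -(scong_XnM _ _ i); apply: scong_trunc H.
by rewrite leq_add2l -ltnS (leq_trans ij).
Qed.

Lemma coprime_den0 s m q p : coprimep p q -> scong s m.+1 q p -> q`_0 != 0.
Proof.
move=> cop /scongP/(_ 0%N isT); rewrite big_ord1 subn0 => E.
apply/eqP => q0; move: E; rewrite q0 mulr0 => /esym p0.
have X_dvd r : r`_0 = 0 -> 'X %| r.
  by move=> r0; rewrite -[X in X %| _]expr1; apply/dvdXnP => -[|].
have /coprimepP/(_ 'X (X_dvd _ p0) (X_dvd _ q0)) := cop.
by rewrite -size_poly_eq1 size_polyX.
Qed.

(** The numerator [p q' - p' q] of the difference vanishes to order [k + 1] at
    the origin and, being its own reversal up to a constant, also at infinity;
    its degree is at most [2k]. *)
Lemma blaschke_unique s k c q c' q' : blaschke_data k c q -> blaschke_data k c' q' ->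
  scong s k.+1 q (c *: crev k q) -> scong s k.+1 q' (c' *: crev k q') ->
  (c *: crev k q) * q' = (c' *: crev k q') * q.
Proof.
move=> H H' sc sc'; have [sq q0 cc _] := H; have [sq' q0' cc' _] := H'.
have sp := blaschke_size_num H; have sp' := blaschke_size_num H'.
have cp := blaschke_crev_num H; have cp' := blaschke_crev_num H'.
have cq := blaschke_crev_den H; have cq' := blaschke_crev_den H'.
move: sc sc' sp sp' cp cp' cq cq'.
move: (c *: crev k q) (c' *: crev k q') => p p' sc sc' sp sp' cp cp' cq cq'.
have D := scong_cross sc sc'.
apply/eqP; rewrite -subr_eq0; apply/eqP.
apply: (@crev_vanish (k + k) k.+1 k.+1 _ _ _ D).
- apply: leq_trans (size_psub_leq _ _) _; rewrite geq_max; apply/andP.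
  by split; apply: leq_trans (size_pmul_leq _ _) _; lia.
- by lia.
have -> : crev (k + k) (p * q' - p' * q) = - ((c^* * c'^*) *: (p * q' - p' * q)).
  rewrite crevB !crevM ?sp ?sp' // cp cp' cq cq' -!scalerAl -!scalerAr !scalerA.
  by rewrite [c'^* * _]mulrC scalerBr opprB [q * p']mulrC [q' * p]mulrC.
by rewrite dvdpNr dvdpZr // mulf_neq0 // conjC_eq0; [move: cc|move: cc'];
  move=> h; apply/eqP => z; move/eqP: h; rewrite z mul0r eq_sym oner_eq0.
Qed.

(** If the indices stay below those that a full jump would force, some kernel
    vector persists at every order; it solves [s * q = p] exactly. *)
Lemma defect_rational s m (N := defect s m.+1) :
  (forall k, (pos_index (defect s (m.+1 + k)) < pos_index N + dim_ker N)%N \/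
             (neg_index (defect s (m.+1 + k)) < neg_index N + dim_ker N)%N) ->
  exists k c q, [/\ (k <= m)%N, blaschke_data k c q &
    forall M, scong s M q (c *: crev k q)].
Proof.
move=> H.
have pairs k : exists p q, [/\ defect_pair s m p q, scong s (m.+1 + k) q p & p != 0].
  apply: contrapT => nex.
  have [] := @index_jump_full s m k.
    move=> p q Hpq sc; apply/eqP; apply: contraT => p0.
    by case: nex; exists p, q.
  by rewrite -/N; case: (H k) => lt h1 h2; [move: lt; rewrite ltnNge h1|move: lt; rewrite ltnNge h2].
have [p [q [Hpq sc p0]]] := pairs m.+1.
have [sp sq h1 h2] := Hpq.
have q0 : q != 0 by rewrite (defect_pair_den0 Hpq).
have scM M : scong s M q p.
  have [p' [q' [Hpq' sc' p0']]] := pairs (M + m.+1)%N.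
  have [sp' sq' _ _] := Hpq'.
  have q0' : q' != 0 by rewrite (defect_pair_den0 Hpq').
  have E : p * q' - p' * q = 0.
    have /dvdXnP D : 'X^(m.+1 + m.+1) %| p * q' - p' * q.
      apply: (scong_cross sc); apply: scong_trunc sc'.
      by rewrite leq_add2l leq_addl.
    apply/polyP => i; rewrite coef0; have [/D//|mi] := ltnP i (m.+1 + m.+1).
    rewrite nth_default //; apply: leq_trans mi.
    apply: leq_trans (size_psub_leq _ _) _; rewrite geq_max; apply/andP.
    by split; apply: leq_trans (size_pmul_leq _ _) _; lia.
  have := scong_mul q (scong_trunc _ sc').
  move=> /(_ (M + m)%N); rewrite -(subr0_eq E) [p * _]mulrC.
  by move=> /(_ ltac:(lia)); apply: scong_divide.
have [k [g [q1 [c [km g0 sq1 cc [qE pE cop]]]]]] :=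
  crev_reduce sp sq q0 (scong_sym_exact sp sq h1 h2).
have scM1 M : scong s M q1 (c *: crev k q1).
  by apply: (@scong_divide _ _ (size g) g); rewrite // -qE -pE.
exists k, c, q1; split=> //; split=> //.
exact: (coprime_den0 cop (scM1 1%N)).
Qed.

(** An invertible defect matrix followed by a singular one: the kernel vector
    of the latter is a coprime fraction of full degree. *)
Lemma defect_singular_step s m : defect s m \in unitmx ->
  defect s m.+1 \notin unitmx ->
  exists c q, blaschke_data m c q /\ scong s m.+1 q (c *: crev m q).
Proof.
move=> Nu; rewrite -row_free_unit => Ns.
have [x x0 xN] : exists2 x : 'rV_m.+1, x != 0 & x *m defect s m.+1 = 0.
  apply: contrapT => nex; move/negP: Ns; apply; apply: inj_row_free => x xN.
  by apply/eqP; apply: contraT => x0; case: nex; exists x.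
have [p [q [Hpq xE]]] := ker_defect_pair xN.
have [sp sq h1 h2] := Hpq.
have p0 : p != 0 by rewrite -(conj_row_eq0 sp) -xE.
have pm : p`_m != 0.
  apply: contraNneq p0 => pm.
  have sp' : (size p <= m)%N.
    by apply/leq_sizeP => j mj; have [->//|jm] := eqVneq j m;
       rewrite nth_default // (leq_trans sp) // ltn_neqAle eq_sym jm.
  have : forall M, M = m.+1 -> conj_row M p *m defect s M = 0.
    by move=> _ ->; exact: defect_pair_ker Hpq.
  move=> /(_ (m + 1)%N (addn1 m)); have [B [D [_ ->]]] := defect_block s m 1.
  have -> : conj_row (m + 1) p = row_mx (conj_row m p) 0.
    apply/rowP => i; rewrite !mxE; case: splitP => j ->; rewrite !mxE //.
    by rewrite nth_default ?conjC0 // (leq_trans sp') ?leq_addr.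
  rewrite mul_row_block !mul0mx !addr0 -row_mx0 => /eq_row_mx[pN _].
  rewrite -(conj_row_eq0 sp') -[conj_row m p](mulmxK Nu) pN mul0mx //.
have [sp' sq' h1' h2'] := defect_pair_rev Hpq.
have q0' : (crev m p)`_0 != 0 by rewrite coef_crev subn0 conjC_eq0.
have q0 : crev m p != 0 by apply: contraNneq q0' => ->; rewrite coef0.
have [k [g [q1 [c [km g0 sq1 cc [qE pE cop]]]]]] :=
  crev_reduce sp' sq' q0 (scong_sym_exact sp' sq' h1' h2').
have sc1 : scong s m.+1 q1 (c *: crev k q1).
  apply: (@scong_cancel _ _ g); last by rewrite -qE -pE.
  by apply: contraNneq q0' => g00; rewrite qE coefM big_ord1 g00 mul0r.
have bd : blaschke_data k c q1 by split=> //; apply: coprime_den0 cop sc1.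
have kE : k = m.
  apply/eqP; rewrite eqn_leq km /=.
  by have := rank_defect_blaschke bd (scong_trunc (leqnSn m) sc1); rewrite mxrank_unit.
by move: kE sc1 bd => ->; exists c, q1.
Qed.

(** When the rank has already been reached at the index [r], the fraction found
    there satisfies all the conditions: a first failure would raise the rank
    by two. *)
Lemma defect_rank_rational s n (r := \rank (defect s n)) : (r < n)%N ->
  defect s r \in unitmx ->
  exists c q, blaschke_data r c q /\ scong s n q (c *: crev r q).
Proof.
move=> rn Nu.
have [c [q [bd sc]]] : exists c q, blaschke_data r c q /\ scong s r.+1 q (c *: crev r q).
  apply: defect_singular_step => //; rewrite -row_full_unit /row_full.
  by rewrite neq_ltn ltnS (rank_defect_le s rn).
exists c, q; split=> //.
suff main j : (r.+1 + j <= n)%N -> scong s (r.+1 + j) q (c *: crev r q).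
  by have := main (n - r.+1)%N; rewrite subnKC //; apply.
elim: j => [|j IH]; first by rewrite addn0.
rewrite addnS => jn; have {}IH := IH (ltnW jn).
apply: contraT => nc.
have [sq _ cc _] := bd; have sp := blaschke_size_num bd.
have pair : defect_pair s (j + r) (c *: crev r q) q.
  split.
  - by rewrite sp ltnS leq_addl.
  - by apply: leq_trans sq _; rewrite ltnS leq_addl.
  - by rewrite addnC -addSn.
  rewrite !crev_shift ?sp // (blaschke_crev_num bd) (blaschke_crev_den bd).
  have e u : u * (c^* *: 'X^j) = 'X^j * (c^* *: u) by rewrite -!scalerAr mulrC.
  by have := scong_mul (c^* *: 'X^j) IH; rewrite !e addSn [(r + j)%N]addnC.
have [] := @index_jump_one s (j + r) 1 _ _ pair.
  by rewrite addn1 [(j + r)%N]addnC -addSn.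
rewrite addn1 => lt1 lt2.
have := rank_defect_le s jn; rewrite -/r.
have := rank_defect_le s (leq_addl j.+1 r); rewrite mxrank_unit //.
rewrite addSn [(j + r)%N]addnC -addSn !rank_defect.
by move: lt1 lt2; rewrite [(j + r)%N]addnC -addSn; lia.
Qed.

(** * Extending the data by one coefficient *)

Definition upd s n z : nat -> C := fun k => if k == n then z else s k.

Lemma upd_lt s n z k : (k < n)%N -> upd s n z k = s k.
Proof. by rewrite /upd; case: ltngtP. Qed.

Lemma defect_upd s n z m : (m <= n)%N -> defect (upd s n z) m = defect s m.
Proof. by move=> mn; apply: defect_eq => k km; rewrite upd_lt // (leq_trans km). Qed.

Lemma rank_block_le m n (A : 'M[C]_m) (B : 'M[C]_(m, n)) D E :
  (\rank (block_mx A B D (E : 'M[C]_n)) <= \rank A + n + n)%N.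
Proof.
rewrite /block_mx -addsmxE; apply: leq_trans (mxrank_adds_leqif _ _).1 _.
apply: leq_add; last exact: rank_leq_row.
rewrite -mxrank_tr tr_row_mx -addsmxE; apply: leq_trans (mxrank_adds_leqif _ _).1 _.
by rewrite mxrank_tr leq_add2l rank_leq_row.
Qed.

(** Kernel pairs with vanishing constant terms whose congruence holds one order
    further can be divided by [X]; this cannot go on forever. *)
Lemma defect_pair_descent s m :
  (forall p q, defect_pair s m p q -> q`_0 = 0 /\ scong s m.+2 q p) ->
  forall p q, defect_pair s m p q -> q = 0.
Proof.
move=> H p q; have [N] := ubnP (size q); elim: N p q => // N IH p q.
rewrite ltnS => sN Hpq; have [q0 sc] := H _ _ Hpq; have [sp sq h1 h2] := Hpq.
have p0 : p`_0 = 0.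
  by move/scongP: h1 => /(_ 0%N isT) <-; rewrite big_ord1 q0 mulr0.
have divX r : r`_0 = 0 -> exists2 r', r = 'X * r' & (size r' <= (size r).-1)%N.
  move=> r0; have /dvdpP[r' rE] : 'X %| r.
    by rewrite -[X in X %| _]expr1; apply/dvdXnP => -[|].
  exists r'; first by rewrite mulrC.
  have [->|r'0] := eqVneq r' 0; first by rewrite size_poly0.
  by rewrite rE size_mulX.
have [p' pE sp'] := divX _ p0; have [q' qE sq'] := divX _ q0.
have [->//|qn0] := eqVneq q 0.
have ssq := size_pgt0 qn0.
suff q'0 : q' = 0 by rewrite qE q'0 mulr0.
apply: (IH p'); first by lia.
have mE : (1 + m.-1 = m)%N.
  case: m sq sq' {H sc h1 h2 Hpq IH sp} => [|m] // sq sq'.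
  have : size q' = 0%N by lia.
  move=> /eqP; rewrite size_poly_eq0 => /eqP q'0.
  by move: qn0; rewrite qE q'0 mulr0 eqxx.
have e1 r : (size r <= m)%N -> crev m ('X * r) = crev m.-1 r.
  by move=> sr; rewrite -{1}mE -['X]expr1 crev_XnM //; lia.
have e2 r : (size r <= m)%N -> crev m r = 'X * crev m.-1 r.
  by move=> sr; rewrite -{1}mE crev_shift ?expr1 //; lia.
have sp2 : (size p' <= m)%N by lia.
have sq2 : (size q' <= m)%N by lia.
split; [by lia|by lia| |].
  by rewrite -(scong_XnM s m.+1 1) addn1 expr1 -pE -qE.
rewrite !e2 // -!e1 // -pE -qE ![in 'X * _]mulrC.
exact: scong_mul.
Qed.

(** A singular defect matrix can always be extended so that both indices grow:
    either some kernel pair has a nonzero constant term, and then the new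
    coefficient can be chosen to break its congruence, or one of the
    congruences breaks by itself. *)
Lemma defect_jump s n : (0 < n)%N -> defect s n \notin unitmx ->
  exists z, pos_index (defect (upd s n z) n.+1) = (pos_index (defect s n)).+1 /\
            neg_index (defect (upd s n z) n.+1) = (neg_index (defect s n)).+1.
Proof.
case: n => // m _; rewrite -row_free_unit => Ns.
have [z [p [q [Hpq nc]]]] : exists z p q, defect_pair s m p q /\
    ~~ scong (upd s m.+1 z) m.+2 q p.
  have [[p [q [Hpq q0]]]|nex] := pselect (exists p q, defect_pair s m p q /\ q`_0 != 0).
    pose rest := \sum_(j < m.+1) s (m.+1 - j.+1)%N * q`_j.+1.
    exists ((1 - rest) / q`_0), p, q; split=> //.
    rewrite scong_ext negb_and; apply/orP; right.
    rewrite big_ord_recl subn0 /upd eqxx divfK //.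
    have -> : \sum_(i < m.+1) (if (m.+1 - lift ord0 i == m.+1)%N then
        (1 - rest) / q`_0 else s (m.+1 - lift ord0 i)%N) * q`_(lift ord0 i) = rest.
      by apply: eq_bigr => i _; rewrite /= /bump /= add1n ifF //; have := ltn_ord i; lia.
    have [sp _ _ _] := Hpq.
    by rewrite subrK nth_default // oner_eq0.
  exists (s m.+1); apply: contrapT => nex2; move/negP: Ns; apply.
  apply: inj_row_free => x /ker_defect_pair[p [q [Hpq ->]]].
  have updE k : upd s m.+1 (s m.+1) k = s k by rewrite /upd; case: eqP => [->|].
  suff q0 : q = 0.
    have [sp _ _ _] := Hpq; apply/eqP; rewrite conj_row_eq0 //.
    by rewrite -(defect_pair_den0 Hpq) q0.
  apply: defect_pair_descent Hpq => {}p {}q Hpq; split.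
    by apply/eqP; apply: contrapT => /negP q0; case: nex; exists p, q.
  apply: contrapT => /negP nc; case: nex2; exists p, q; split=> //.
  by rewrite (@scong_eq _ s).
exists z; set t := upd s m.+1 z in nc *.
have tN : defect t m.+1 = defect s m.+1 by rewrite defect_upd.
have tc u v : scong t m.+1 u v = scong s m.+1 u v.
  by apply: scong_eq => k; apply: upd_lt.
have Hpq' : defect_pair t m p q by case: Hpq => *; split; rewrite ?tc.
have [] := @index_jump_one t m 1 p q Hpq'; rewrite addn1 //.
rewrite tN => h1 h2.
have : (\rank (defect t (m.+1 + 1)) <= \rank (defect t m.+1) + 1 + 1)%N.
  by have [B [D [_ ->]]] := defect_block t m.+1 1; apply: rank_block_le.
by rewrite addn1 !rank_defect tN; lia.
Qed.

(** Both Schur complements of the bordered matrix compute the same index. *)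
Lemma index_rank_one m (A : 'M[C]_m) (w : 'M[C]_(m, 1)) :
  A^t* = A -> A \in unitmx -> let sg := 1%:M - w^t* *m invmx A *m w in
  (pos_index (A - w *m w^t*)).+1 = (pos_index A + pos_index sg)%N /\
  neg_index (A - w *m w^t*) = (neg_index A + neg_index sg)%N.
Proof.
move=> hA Au sg.
have h1 : (1%:M : 'M[C]_1)^t* = 1%:M by apply: adjmx1.
have [p1 n1] := @index_schur _ m 1 A w 1%:M hA h1 Au.
have [] := @index_schur _ 1 m 1%:M (w^t*) A h1 hA (unitmx1 _ _).
rewrite trmxCK invmx1 mulmx1.
set H' := block_mx 1%:M _ _ _; set H := block_mx A _ _ _ in p1 n1.
have hH : H^t* = H by apply/block_herm.
have hH' : H'^t* = H' by rewrite /H' adj_block trmxCK h1 hA.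
have E1 : H' = block_mx 0 1%:M 1%:M 0 *m H *m (block_mx 0 1%:M 1%:M 0)^t*.
  rewrite adj_block !adjmx1 !adj0 !mulmx_block !mul1mx !mul0mx !mulmx1 !mulmx0.
  by rewrite !add0r !addr0.
have E2 : H = block_mx 0 1%:M 1%:M 0 *m H' *m (block_mx 0 1%:M 1%:M 0)^t*.
  rewrite adj_block !adjmx1 !adj0 !mulmx_block !mul1mx !mul0mx !mulmx1 !mulmx0.
  by rewrite !add0r !addr0.
have -> : pos_index H' = pos_index H.
  have := pos_index_congr_le (block_mx 0 1%:M 1%:M 0) hH; rewrite -E1 => le1.
  have := pos_index_congr_le (block_mx 0 1%:M 1%:M 0) hH'; rewrite -E2 => le2.
  by apply/eqP; rewrite eqn_leq le1.
have -> : neg_index H' = neg_index H.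
  have := neg_index_congr_le (block_mx 0 1%:M 1%:M 0) hH; rewrite -E1 => le1.
  have := neg_index_congr_le (block_mx 0 1%:M 1%:M 0) hH'; rewrite -E2 => le2.
  by apply/eqP; rewrite eqn_leq le1.
rewrite p1 n1 pos_index_scalar1 neg_index_scalar1 ltr01 add1n => <-.
by rewrite ltr10 add0n => <-.
Qed.

(** For a nonsingular defect matrix the sign of the Schur complement [sigma z]
    decides which index grows when the coefficient [z] is appended. As a function
    of [z] it is a real quadratic polynomial, with leading coefficient [- x] and
    linear coefficient [- b], and it takes both signs and the value 0. *)
Section NonsingularExtension.
Variables (s : nat -> C) (m : nat).
Let n := m.+1.
Hypothesis Nu : defect s n \in unitmx.

Let N := defect s n.
Let Ni := invmx N.
Let e : 'cV[C]_n := delta_mx ord_max 0.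
(* The coefficients after the first one, with 0 in place of the free last one. *)
Let v : 'cV[C]_n := \col_(i < n) (if i == m :> nat then 0 else s i.+1).
Let y : 'rV[C]_n := e^t* *m Ni.
Let x : C := (y *m e) 0 0.
Let b : C := (y *m v) 0 0.

Let t z := upd s n z.
Let sigma z : C := 1 - `|s 0%N| ^+ 2 - (v^t* *m Ni *m v) 0 0
   - (z^* * b + z * b^*) - x * `|z| ^+ 2.

Let hN : N^t* = N. Proof. exact: defect_herm. Qed.
Let hNi : Ni^t* = Ni. Proof. by rewrite trmx_inv map_invmx hN. Qed.

Lemma upd_coef_real : x \is Num.real.
Proof.
apply/CrealP; rewrite /x /y.
have <- : (e^t* *m Ni *m e)^t* 0 0 = ((e^t* *m Ni *m e) 0 0)^* by rewrite mxE mxE.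
by rewrite -{2}(trmxCK e) congr_herm // trmxCK.
Qed.

Lemma upd_const_real : (v^t* *m Ni *m v) 0 0 \is Num.real.
Proof.
apply/CrealP.
have <- : (v^t* *m Ni *m v)^t* 0 0 = ((v^t* *m Ni *m v) 0 0)^* by rewrite mxE mxE.
by rewrite -{2}(trmxCK v) congr_herm // trmxCK.
Qed.

Let w z : 'cV[C]_(1 + n) := \col_(i < 1 + n) t z i.

Let wE z : w z = col_mx (s 0%N)%:M (v + z *: e).
Proof.
apply/colP => i; rewrite [LHS]mxE [RHS]mxE; case: splitP => j jE.
  by rewrite ord1 in jE *; rewrite jE /t upd_lt // !mxE eqxx.
rewrite !mxE jE /t /upd add1n eqSS -val_eqE /= eqxx andbT.
case: eqP => _; rewrite ?mulr1 ?add0r // mulr0 addr0 //.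
Qed.

Let sigma_quad z : ((v + z *: e)^t* *m Ni *m (v + z *: e)) 0 0 =
  (v^t* *m Ni *m v) 0 0 + (z^* * b + z * b^*) + x * `|z| ^+ 2.
Proof.
have bE : b^* = (v^t* *m Ni *m e) 0 0.
  have -> : v^t* *m Ni *m e = (y *m v)^t*.
    by rewrite /y !adjmx_mul hNi trmxCK mulmxA.
  by rewrite mxE mxE.
have adjD : (v + z *: e)^t* = v^t* + z^* *: e^t*.
  by rewrite linearD linearZ /= map_mxD map_mxZ.
have -> : (v + z *: e)^t* *m Ni *m (v + z *: e) =
    v^t* *m Ni *m v + z *: (v^t* *m Ni *m e)
    + (z^* *: (y *m v) + (z^* * z) *: (y *m e)).
  by rewrite adjD !mulmxDl !mulmxDr -!scalemxAl -!scalemxAr scalerA.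
by rewrite bE /x /b !entryD !entryZ normCK; ring.
Qed.

Lemma index_extension z :
  pos_index (defect (t z) n.+1) = (pos_index N + (0 < sigma z)%R)%N /\
  neg_index (defect (t z) n.+1) = (neg_index N + (sigma z < 0)%R)%N.
Proof.
have NE : defect (t z) n.+1 = block_mx 1%:M 0 0 N - w z *m (w z)^t*.
  by rewrite -[n.+1]/(1 + n)%N defect_displacement defect_upd.
have h1 : (1%:M : 'M[C]_1)^t* = 1%:M by apply: adjmx1.
have hA : (block_mx 1%:M 0 0 N : 'M[C]_(1 + n))^t* = block_mx 1%:M 0 0 N.
  by rewrite adj_block !adj0 h1 hN.
have Au : (block_mx 1%:M 0 0 N : 'M[C]_(1 + n)) \in unitmx.
  by rewrite unitmxE det_ublock det1 mul1r -unitmxE.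
have Ai : invmx (block_mx 1%:M 0 0 N : 'M[C]_(1 + n)) = block_mx 1%:M 0 0 Ni.
  apply: (can_inj (mulKmx Au)); rewrite mulmxV // mulmx_block !mulmx0 !mul0mx !mul1mx.
  by rewrite !addr0 !add0r mulmxV // -scalar_mx_block.
have [] := index_rank_one (w z) hA Au.
rewrite Ai pos_index_block_diag // neg_index_block_diag // -NE.
rewrite pos_index_scalar1 neg_index_scalar1 ltr01 ltr10.
have -> : 1%:M - (w z)^t* *m block_mx 1%:M 0 0 Ni *m w z = (sigma z)%:M.
  rewrite [LHS]mx11_scalar; congr (_%:M).
  rewrite wE tr_col_mx map_row_mx mul_row_block !mulmx0 addr0 add0r mulmx1 mul_row_col.
  rewrite entryD entryN entryD sigma_quad.
  have -> : (((s 0%N)%:M : 'M[C]_1)^t* *m (s 0%N)%:M) 0 0 = `|s 0%N| ^+ 2.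
    by rewrite mxE big_ord1 !mxE eqxx !mulr1n mulrC normCK.
  by rewrite mxE eqxx mulr1n /sigma; ring.
rewrite pos_index_scalar1 neg_index_scalar1.
have -> : (true + pos_index N)%N = (pos_index N).+1 by [].
by move=> E1 E2; split; [apply: succn_inj; rewrite E1|rewrite E2].
Qed.

(** At the centre of the family the shifted row [(0, y)] inverts the last column
    of the extended matrix, so its Schur complement is the inverse of [x]. *)
Lemma index_extension_centre z : b + z * x = 0 ->
  [/\ x != 0, pos_index (defect (t z) n.+1) = (pos_index N + (0 < x)%R)%N &
      neg_index (defect (t z) n.+1) = (neg_index N + (x < 0)%R)%N].
Proof.
move=> yw.
have [r [rN rx]] : exists r : 'rV[C]_(n + 1),
    r *m defect (t z) (n + 1) = \row_i (i == n :> nat)%:R /\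
    forall i : 'I_(n + 1), i = n :> nat -> r 0 i = x.
  rewrite [(n + 1)%N]addnC; exists (row_mx 0 y); split; last first.
    move=> i iE; rewrite mxE; case: splitP => j jE.
      by have := ltn_ord j; move: jE; rewrite iE; case: (nat_of_ord j) => // -[].
    have -> : j = ord_max.
      by apply/val_inj => /=; move: jE; rewrite iE /n; lia.
    rewrite /x [RHS]mxE (bigD1 ord_max) //= big1 ?addr0 => [|i' /negbTE ne].
      by rewrite [e _ _]mxE !eqxx mulr1.
    by rewrite [e _ _]mxE ne mulr0.
  rewrite defect_displacement defect_upd // mulmxBr mul_row_block !mulmx0 !mul0mx.
  rewrite !add0r mulmxA -/(w z) wE mul_row_col mul0mx add0r.
  have -> : y *m (v + z *: e) = 0.
    rewrite [LHS]mx11_scalar mulmxDr -scalemxAr entryD entryZ -/b -/x yw.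
    by apply/matrixP => i j; rewrite !mxE mul0rn.
  rewrite mul0mx subr0 /y -mulmxA mulVmx // mulmx1.
  apply/rowP => i; rewrite !mxE; case: splitP => j jE; rewrite !mxE jE.
    by rewrite ord1.
  rewrite eqxx andbT conjC_nat add1n eqSS -val_eqE //=.
have [B [D [hD NE]]] := defect_block (t z) n 1.
rewrite (defect_upd s z (leqnn n)) in NE.
move: rN; rewrite -[r]hsubmxK NE mul_row_block.
set u := lsubmx r.
have -> : rsubmx r = x%:M.
  by rewrite [LHS]mx11_scalar; congr (_%:M); rewrite mxE rx //= addn0.
have -> : \row_(i < n + 1) (i == n :> nat)%:R = row_mx 0 1%:M :> 'rV[C]_(n + 1).
  apply/rowP => i; rewrite !mxE; case: splitP => j ->; rewrite !mxE.
    by have := ltn_ord j; case: ltngtP.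
  by rewrite ord1 addn0 !eqxx.
move=> /eq_row_mx[uN uB].
have x0 : x != 0.
  apply/eqP => x0; move: uN uB; rewrite x0 !mul_scalar_mx !scale0r.
  rewrite !addr0 => uN.
  rewrite -[u](mulmxK Nu) -/N uN !mul0mx => /matrixP/(_ 0 0).
  by rewrite !mxE eqxx => /eqP; rewrite eq_sym oner_eq0.
have uE : u = - (x *: (B^t* *m Ni)).
  rewrite -[u](mulmxK Nu) -/N -/Ni; move/eqP: uN; rewrite addr_eq0 => /eqP ->.
  by rewrite mul_scalar_mx mulNmx -scalemxAl.
have SE : D - B^t* *m Ni *m B = x^-1%:M.
  apply: (scalerI x0); rewrite scalerBr scale_scalar_mx mulfV // -uB uE.
  by rewrite mulNmx -scalemxAl mul_scalar_mx addrC.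
have [] := index_schur B hN hD Nu.
rewrite -/N -/Ni SE -NE addn1 pos_index_scalar1 neg_index_scalar1.
by rewrite invr_gt0 invr_lt0.
Qed.

Let sigma_shift z u : b + z * x = 0 -> sigma (z + u) = sigma z - x * `|u| ^+ 2.
Proof.
move=> bE; have {}bE : b = - (z * x) by apply/eqP; rewrite -addr_eq0 bE.
have xx : x^* = x by apply/CrealP/upd_coef_real.
by rewrite /sigma bE !normCK !rmorphD !rmorphN !rmorphM /= xx; ring.
Qed.

(** If [x = 0] the function is affine, and it is not constant because [b = 0]
    would make 0 a centre. If [x != 0] its value at the centre has the sign of
    [x], and far away from the centre it has the opposite sign. *)
Lemma sigma_attains :
  [/\ exists2 f : nat -> C, injective f & forall u, sigma (f u) = 0,
      exists z, 0 < sigma z & exists z, sigma z < 0].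
Proof.
have xx : x^* = x by apply/CrealP/upd_coef_real.
have inat (k : nat) : ('i * k%:R : C)^* = - ('i * k%:R).
  by rewrite rmorphM /= conjCi rmorph_nat mulNr.
have [x0|x0] := eqVneq x 0.
  have b0 : b != 0.
    apply/eqP => b0; have [] := @index_extension_centre 0; rewrite ?x0 ?eqxx //.
    by rewrite b0 mul0r addr0.
  pose c := sigma 0.
  have cE z : sigma z = c - (z^* * b + z * b^*).
    by rewrite /c /sigma x0 conjC0 normr0 !mul0r !subr0 addr0 subr0.
  have cr : c^* = c.
    have nr : `|s 0%N| ^+ 2 \is Num.real by rewrite rpredX // normr_real.
    apply/CrealP; rewrite /c /sigma conjC0 !mul0r addr0 subr0 normr0 expr0n mulr0 subr0.
    by rewrite !rpredB ?rpred1 ?upd_const_real.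
  pose f (r : C) (k : nat) := ((c - r) / (2 * (b * b^*)) + 'i * k%:R) * b.
  have bb0 : b * b^* != 0 by rewrite mulf_neq0 ?conjC_eq0.
  have fE (r : C) k : r^* = r -> sigma (f r k) = r.
    move=> rr; rewrite cE /f rmorphM rmorphD /= inat.
    rewrite rmorphM rmorphB /= fmorphV /= !rmorphM /= conjCK rmorph_nat cr rr.
    by field; rewrite conjC_eq0 b0.
  split.
  - exists (f 0) => [k l /(mulIf b0)/addrI/(mulfI (neq0Ci C))/eqP|u].
      by rewrite eqr_nat => /eqP.
    by rewrite fE ?conjC0.
  - by exists (f 1 0); rewrite fE ?conjC1 ?ltr01.
  - by exists (f (-1) 0); rewrite fE ?rmorphN1 ?ltrN10.
pose z0 := - (b / x).
have z0E : b + z0 * x = 0 by rewrite /z0 mulNr divfK // subrr.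
have [_ pE nE] := index_extension_centre z0E.
have [pE' nE'] := index_extension z0.
have spos : (0 < sigma z0) = (0 < x).
  by move: pE'; rewrite pE => /addnI; case: (_ < _); case: (_ < _).
have sneg : (sigma z0 < 0) = (x < 0).
  by move: nE'; rewrite nE => /addnI; case: (_ < _); case: (_ < _).
have r0 : 0 < sigma z0 / x.
  have /orP[h|h] : (x < 0) || (0 < x) by rewrite -real_neqr_lt ?upd_coef_real ?real0.
    by rewrite nmulr_lgt0 ?sneg // invr_lt0.
  by rewrite divr_gt0 ?spos.
pose rt := sqrtC (sigma z0 / x).
have rt0 : 0 < rt by rewrite sqrtC_gt0.
have rtE : `|rt| ^+ 2 = sigma z0 / x by rewrite gtr0_norm // sqrtCK.
have shiftE c : `|c| ^+ 2 * (sigma z0 / x) = `|rt * c| ^+ 2.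
  by rewrite normrM exprMn rtE mulrC.
have value c : sigma (z0 + rt * c) = sigma z0 * (1 - `|c| ^+ 2).
  by rewrite sigma_shift // -shiftE; field.
have d0 (k : nat) : 1 - 'i * k%:R != 0 :> C.
  apply/eqP => h; have := congr1 Num.conj h; rewrite rmorphB rmorph1 /= inat conjC0.
  rewrite opprK => h'; have := congr2 +%R h h'; rewrite addr0 addrACA addNr addr0.
  by move/eqP; rewrite -mulr2n pnatr_eq0.
split.
- exists (fun k : nat => z0 + rt * ((1 + 'i * k%:R) / (1 - 'i * k%:R))).
    move=> k l /addrI/(mulfI (lt0r_neq0 rt0))/eqP.
    rewrite eqr_div // -subr_eq0.
    have -> : (1 + 'i * k%:R) * (1 - 'i * l%:R) - (1 + 'i * l%:R) * (1 - 'i * k%:R) =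
      2 * 'i * (k%:R - l%:R) :> C by ring.
    rewrite mulf_eq0 mulf_eq0 pnatr_eq0 (negPf (neq0Ci C)) /= subr_eq0 eqr_nat.
    by move/eqP.
  move=> k; rewrite value normCK rmorphM fmorphV rmorphD rmorphB rmorph1 /= inat.
  rewrite opprK mulrACA -invfM [(1 - _) * _]mulrC divff ?subrr ?mulr0 //.
  have := d0 k; rewrite -conjC_eq0 rmorphB rmorph1 /= inat opprK => d0'.
  by rewrite mulf_neq0.
- have /orP[h|h] : (x < 0) || (0 < x) by rewrite -real_neqr_lt ?upd_coef_real ?real0.
    exists (z0 + rt * 2); rewrite value normr_nat nmulr_rgt0 ?sneg //.
    by rewrite subr_lt0 -natrX ltr1n.
  by exists z0; rewrite spos.
- have /orP[h|h] : (x < 0) || (0 < x) by rewrite -real_neqr_lt ?upd_coef_real ?real0.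
    by exists z0; rewrite sneg.
  exists (z0 + rt * 2); rewrite value normr_nat pmulr_rlt0 ?spos //.
  by rewrite subr_lt0 -natrX ltr1n.
Qed.

Lemma extension_indices :
  [/\ exists2 f : nat -> C, injective f &
        forall u, defect (upd s n (f u)) n.+1 \notin unitmx,
      exists z, pos_index (defect (upd s n z) n.+1) = (pos_index N).+1 /\
                neg_index (defect (upd s n z) n.+1) = neg_index N &
      exists z, pos_index (defect (upd s n z) n.+1) = pos_index N /\
                neg_index (defect (upd s n z) n.+1) = (neg_index N).+1].
Proof.
have [[f finj f0] [zp hp] [zn hn]] := sigma_attains; split.
- exists f => // u; have [pE nE] := index_extension (f u).
  rewrite -row_free_unit /row_free rank_defect pE nE f0 ltxx !addn0 -rank_defect.
  by rewrite -/N (mxrank_unit Nu) neq_ltn ltnSn.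
- exists zp; have [pE nE] := index_extension zp.
  by rewrite pE nE hp (lt_gtF hp) addn0 addn1.
exists zn; have [pE nE] := index_extension zn.
by rewrite pE nE hn (lt_gtF hn) addn0 addn1.
Qed.

End NonsingularExtension.

Lemma unit_index_sum s n : (defect s n \in unitmx) =
  (pos_index (defect s n) + neg_index (defect s n) == n)%N.
Proof. by rewrite -row_free_unit /row_free rank_defect. Qed.

(** The two indices are raised one unit at a time, in any order. *)
Lemma extend_nonsingular s n pi nu : (0 < n)%N -> defect s n \in unitmx ->
  (pos_index (defect s n) <= pi)%N -> (neg_index (defect s n) <= nu)%N ->
  exists t, [/\ forall k, (k < n)%N -> t k = s k, (n <= pi + nu)%N,
    pos_index (defect t (pi + nu)) = pi & neg_index (defect t (pi + nu)) = nu].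
Proof.
move: {2}(pi + nu - n)%N (leqnn (pi + nu - n)) => j.
elim: j s n => [|j IH] s n le_j n0 Nu hp hn;
  have nE := Nu; rewrite unit_index_sum in nE; move/eqP: nE => nE.
  have piE : pi = pos_index (defect s n) by lia.
  have nuE : nu = neg_index (defect s n) by lia.
  by exists s; split; rewrite ?piE ?nuE // nE.
case: n le_j n0 Nu hp hn nE => // m le_j _ Nu hp hn nE.
have next z : (pos_index (defect (upd s m.+1 z) m.+2) +
      neg_index (defect (upd s m.+1 z) m.+2))%N = m.+2 ->
    (pos_index (defect (upd s m.+1 z) m.+2) <= pi)%N ->
    (neg_index (defect (upd s m.+1 z) m.+2) <= nu)%N ->
    exists t, [/\ forall k, (k < m.+1)%N -> t k = s k, (m.+1 <= pi + nu)%N,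
    pos_index (defect t (pi + nu)) = pi & neg_index (defect t (pi + nu)) = nu].
  move=> sumE h1 h2; have lj : (pi + nu - m.+2 <= j)%N by lia.
  have un : defect (upd s m.+1 z) m.+2 \in unitmx by rewrite unit_index_sum sumE.
  have [t [ts le tp tn]] := IH _ m.+2 lj isT un h1 h2.
  exists t; split=> //; last exact: ltnW.
  by move=> k km; rewrite ts ?upd_lt // ltnW.
have [_ [zp [pp pn]] [zn [np nn]]] := extension_indices Nu.
have [lt_p|ge_p] := ltnP (pos_index (defect s m.+1)) pi.
  by apply: (next zp); rewrite ?pp ?pn; lia.
have [lt_n|ge_n] := ltnP (neg_index (defect s m.+1)) nu.
  by apply: (next zn); rewrite ?np ?nn; lia.
have KE : (pi + nu)%N = m.+1 by lia.
by exists s; rewrite KE; split=> //; lia.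
Qed.

(** A singular defect matrix loses one dimension of its kernel at each jump,
    which raises both indices; after [dim_ker] jumps it is nonsingular. This is
    where the bounds [dim_ker] come from. *)
Lemma extend_indices s n pi nu : (0 < n)%N ->
  (pos_index (defect s n) + dim_ker (defect s n) <= pi)%N ->
  (neg_index (defect s n) + dim_ker (defect s n) <= nu)%N ->
  exists t, [/\ forall k, (k < n)%N -> t k = s k, (n <= pi + nu)%N,
    pos_index (defect t (pi + nu)) = pi & neg_index (defect t (pi + nu)) = nu].
Proof.
move: {2}(dim_ker (defect s n)) (leqnn (dim_ker (defect s n))) => d.
elim: d s n => [|d IH] s n le_d n0 hp hn.
  apply: extend_nonsingular => //; try lia.
  rewrite -row_free_unit /row_free eqn_leq rank_leq_row /=.
  by move: le_d; rewrite dim_kerE leqn0 subn_eq0.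
have [Nu|Ns] := boolP (defect s n \in unitmx).
  by apply: extend_nonsingular => //; lia.
have [z [zp zn]] := defect_jump n0 Ns.
have rk := rank_defect s n; have rk' := rank_defect (upd s n z) n.+1.
have rl := rank_leq_row (defect s n).
have Nr : (\rank (defect s n) < n)%N.
  by rewrite ltn_neqAle rank_leq_row andbT -[_ == _]/(row_free _) row_free_unit.
move: le_d hp hn; rewrite dim_kerE => le_d hp hn.
have [||||t [ts le tp tn]] := IH (upd s n z) n.+1; rewrite ?dim_kerE ?zp ?zn //.
- by lia.
- by lia.
- by lia.
exists t; split=> //; last exact: ltnW.
by move=> k kn; rewrite ts ?upd_lt // ltnW.
Qed.

(** One nonsingular extension of order [pi + nu] has infinitely many singular
    successors, and each of these singles out a fraction of degree [pi + nu]
    through its kernel. *)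
Lemma blaschke_family s n pi nu : (0 < n)%N ->
  (pos_index (defect s n) + dim_ker (defect s n) <= pi)%N ->
  (neg_index (defect s n) + dim_ker (defect s n) <= nu)%N ->
  exists f : nat -> nat -> C,
  [/\ (n <= pi + nu)%N, forall u k, (k < n)%N -> f u k = s k,
      injective (fun u => f u (pi + nu)%N) &
      forall u, exists c q, [/\ blaschke_data (pi + nu) c q,
        scong (f u) (pi + nu).+1 q (c *: crev (pi + nu) q),
        pos_index (bezout_mx q (c *: crev (pi + nu) q) (pi + nu)) = pi &
        neg_index (bezout_mx q (c *: crev (pi + nu) q) (pi + nu)) = nu]].
Proof.
move=> n0 hp hn; have [t [ts le tp tn]] := extend_indices n0 hp hn.
have [m KE] : exists m, (pi + nu)%N = m.+1 by exists (pi + nu)%N.-1; lia.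
rewrite KE in le tp tn *.
have Nu : defect t m.+1 \in unitmx by rewrite unit_index_sum tp tn KE.
have [[f finj f0] _ _] := extension_indices Nu.
exists (fun u => upd t m.+1 (f u)); split=> //.
- by move=> u k kn; rewrite upd_lt ?ts // (leq_trans kn).
- by move=> u v; rewrite /upd eqxx => /finj.
move=> u; set g := upd t m.+1 (f u).
have gt : defect g m.+1 = defect t m.+1 by rewrite defect_upd.
have [||c [q [bd sc]]] := @defect_singular_step g m.+1; first by rewrite gt.
  exact: f0.
have [_ q0 _ _] := bd.
have [h1 h2] := bezout_index q0 (scong_trunc (leqnSn _) sc).
exists c, q; split; [exact: bd|exact: sc|by rewrite h1 gt|by rewrite h2 gt].
Qed.

End Series.

(** * Complex differentiability by epsilons *)

Section Bridge.

Lemma near_dnbhsP (K : numFieldType) (a : K^o) (P : K^o -> Prop) :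
  (\forall z \near a^', P z) <->
  exists2 d : K, 0 < d & forall z, z != a -> `|z - a| < d -> P z.
Proof.
rewrite near_withinE; split.
  move=> /nbhs_ballP[d /= d0 H]; exists d => // z za zd.
  by apply: H => //=; rewrite /ball /= distrC.
move=> [d d0 H]; apply/nbhs_ballP; exists d => //= z.
by rewrite /ball /= distrC => zd za; apply: H.
Qed.

Lemma near_nbhsP (K : numFieldType) (a : K^o) (P : K^o -> Prop) :
  (\forall z \near a, P z) <->
  exists2 d : K, 0 < d & forall z, `|z - a| < d -> P z.
Proof.
split.
  move=> /nbhs_ballP[d /= d0 H]; exists d => // z zd.
  by apply: H => //=; rewrite /ball /= distrC.
move=> [d d0 H]; apply/nbhs_ballP; exists d => //= z.
by rewrite /ball /= distrC => zd; apply: H.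
Qed.

Lemma derivable_epsP (K : numFieldType) (f : K^o -> K^o) (a l : K^o) :
  ((fun h => h^-1 *: (f (h *: (1 : K^o) + a) - f a)) @ (0 : K^o)^' --> l) <->
  forall e : K, 0 < e -> exists2 d : K, 0 < d &
    forall z, `|z - a| < d -> `|f z - f a - l * (z - a)| <= e * `|z - a|.
Proof.
split=> [/cvgrPdist_le H e e0|H].
  have /near_dnbhsP[d d0 Hd] := H e e0; exists d => // z zd.
  have [->|za] := eqVneq z a; first by rewrite !subrr mulr0 subrr !normr0 mulr0.
  have h0 : z - a != 0 by rewrite subr_eq0.
  have := Hd (z - a) h0; rewrite subr0 => /(_ zd).
  rewrite /GRing.scale /= mulr1 subrK => Hz.
  have -> : f z - f a - l * (z - a) = - ((l - (z - a)^-1 * (f z - f a)) * (z - a)).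
    by field.
  by rewrite normrN normrM ler_wpM2r.
apply/cvgrPdist_le => e e0; have [d d0 Hd] := H e e0.
apply/near_dnbhsP; exists d => // h h0; rewrite subr0 => hd.
have := Hd (h + a); rewrite addrK => /(_ hd) Hh.
have -> : l - h^-1 *: (f (h *: 1 + a) - f a) =
   - (h^-1 * (f (h + a) - f a - l * h)).
  by rewrite /GRing.scale /= mulr1; field.
by rewrite normrN normrM normfV ler_pdivrMl ?normr_gt0 // [`|h| * e]mulrC.
Qed.

End Bridge.

Section ComplexAnalysis.
Variable R : realType.
Local Notation C := (R[i]).
Local Notation Co := (R[i]^o).
Implicit Types (f g F : C -> C) (z w a b l c : C) (t u e d : R).

Local Notation normc := (@ComplexField.Normc.normc R).

Lemma norm_normc z : `|z| = (normc z)%:C%C.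
Proof. by []. Qed.

Lemma normcD z w : normc (z + w) <= normc z + normc w.
Proof. exact: le_normcD. Qed.

Lemma normcN z : normc (- z) = normc z.
Proof. exact: normcN. Qed.

Lemma normcM z w : normc (z * w) = normc z * normc w.
Proof. exact: ComplexField.Normc.normcM. Qed.

Lemma normcV z : normc z^-1 = (normc z)^-1.
Proof. exact: ComplexField.Normc.normcV. Qed.

Lemma normc0 : normc 0 = 0.
Proof. exact: ComplexField.Normc.normc0. Qed.

Lemma normc1 : normc 1 = 1.
Proof. exact: ComplexField.Normc.normc1. Qed.

Lemma normc_ge0 z : 0 <= normc z.
Proof. by case: z => x y; rewrite sqrtr_ge0. Qed.

Lemma normc_eq0 z : (normc z == 0) = (z == 0).
Proof. by apply/eqP/eqP => [/ComplexField.Normc.eq0_normc|->]; rewrite ?normc0. Qed.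

Lemma normc_gt0 z : (0 < normc z) = (z != 0).
Proof. by rewrite lt_def normc_ge0 andbT normc_eq0. Qed.

Lemma normcB z w : normc (z - w) = normc (w - z).
Proof. by rewrite -normcN opprB. Qed.

Lemma normc_real t : normc (t%:C%C) = `|t|.
Proof. by rewrite /= expr0n /= addr0 sqrtr_sqr. Qed.

Lemma normc_Re z : `|complex.Re z| <= normc z.
Proof. by rewrite -lecR -norm_normc normc_ge_Re. Qed.

Lemma normc_Im z : `|complex.Im z| <= normc z.
Proof.
rewrite -sqrtr_sqr; case: z => x y /=.
by rewrite ler_wsqrtr // lerDr sqr_ge0.
Qed.

Lemma normc_ReIm z : normc z <= `|complex.Re z| + `|complex.Im z|.
Proof.
rewrite {1}[z]complexE; apply: le_trans (normcD _ _) _.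
by rewrite normcM !normc_real /= expr0n expr1n add0r sqrtr1 mul1r.
Qed.

Lemma normc_tri z w c : normc (z - c) <= normc (z - w) + normc (w - c).
Proof. by apply: le_trans (normcD _ _); rewrite addrA subrK. Qed.

Definition cderiv f z l := forall e, 0 < e -> exists2 d, 0 < d &
  forall w, normc (w - z) < d -> normc (f w - f z - l * (w - z)) <= e * normc (w - z).

Definition cdiff f z := exists l, cderiv f z l.

Lemma derivable_cdiffP f z : @derivable _ Co Co f z 1 <-> cdiff f z.
Proof.
have eqv l : ((fun h => h^-1 *: (f (h *: (1 : Co) + z) - f z)) @ (0 : Co)^' --> (l : Co))
    <-> cderiv f z l.
  apply: iff_trans (derivable_epsP (f : Co -> Co) z l) _; split.
    move=> H e e0; have [] := H e%:C%C; first by rewrite ltcR.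
    move=> d d0 Hd; have dE : d = (complex.Re d)%:C%C by rewrite RRe_real // gtr0_real.
    rewrite dE ltcR in d0; exists (complex.Re d) => // w wd.
    by have := Hd w; rewrite !norm_normc -rmorphM dE ltcR lecR; apply.
  move=> H e e0; have eE : e = (complex.Re e)%:C%C by rewrite RRe_real // gtr0_real.
  rewrite eE ltcR in e0; have [d d0 Hd] := H _ e0.
  exists d%:C%C; first by rewrite ltcR.
  by move=> w; rewrite !norm_normc eE -rmorphM ltcR lecR; apply: Hd.
split=> [H|[l /eqv H]]; last by apply/cvg_ex; exists l.
by have /cvg_ex[l /= Hl] := H; exists l; apply/eqv.
Qed.

Lemma nearC z (P : C -> Prop) : (\forall w \near (z : Co), P w) <->
  exists2 d, 0 < d & forall w, normc (w - z) < d -> P w.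
Proof.
apply: iff_trans (near_nbhsP (z : Co) P) _; split=> -[d d0 H].
  have dE : d = (complex.Re d)%:C%C by rewrite RRe_real // gtr0_real.
  rewrite dE ltcR in d0; exists (complex.Re d) => // w wd.
  by apply: H; rewrite norm_normc dE ltcR.
exists d%:C%C; first by rewrite ltcR.
by move=> w; rewrite norm_normc ltcR; apply: H.
Qed.

Lemma nearC' z (P : C -> Prop) : (\forall w \near (z : Co)^', P w) <->
  exists2 d, 0 < d & forall w, w != z -> normc (w - z) < d -> P w.
Proof.
apply: iff_trans (near_dnbhsP (z : Co) P) _; split=> -[d d0 H].
  have dE : d = (complex.Re d)%:C%C by rewrite RRe_real // gtr0_real.
  rewrite dE ltcR in d0; exists (complex.Re d) => // w wz wd.
  by apply: H; rewrite // norm_normc dE ltcR.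
exists d%:C%C; first by rewrite ltcR.
by move=> w wz; rewrite norm_normc ltcR; apply: H.
Qed.

(** ** Rules of differentiation *)

Lemma cderiv_cst c z : cderiv (fun _ => c) z 0.
Proof. by move=> e e0; exists 1 => // w _; rewrite subrr mul0r subrr normc0 mulr_ge0 ?normc_ge0 // ltW. Qed.

Lemma cderiv_id z : cderiv id z 1.
Proof. by move=> e e0; exists 1 => // w _; rewrite mul1r subrr normc0 mulr_ge0 ?normc_ge0 // ltW. Qed.

Lemma cderivD f g z l1 l2 : cderiv f z l1 -> cderiv g z l2 ->
  cderiv (fun w => f w + g w) z (l1 + l2).
Proof.
move=> Hf Hg e e0; have e2 : 0 < e / 2 by lra.
have [d1 d10 H1] := Hf _ e2; have [d2 d20 H2] := Hg _ e2.
exists (Num.min d1 d2); first by rewrite lt_min d10.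
move=> w; rewrite lt_min => /andP[/H1 h1 /H2 h2].
have -> : f w + g w - (f z + g z) - (l1 + l2) * (w - z) =
  (f w - f z - l1 * (w - z)) + (g w - g z - l2 * (w - z)) by ring.
by apply: le_trans (normcD _ _) _; lra.
Qed.

(** Differentiability as a continuous slope, which makes the product, inverse
    and chain rules algebraic. *)
Definition ccont f z := forall e, 0 < e -> exists2 d, 0 < d &
  forall w, normc (w - z) < d -> normc (f w - f z) < e.

Lemma cderiv_slope f z l : cderiv f z l <->
  exists2 q : C -> C, ccont q z /\ q z = l & forall w, f w = f z + q w * (w - z).
Proof.
split.
  move=> H; pose q w := if w == z then l else (f w - f z) / (w - z).
  exists q; last first.
    move=> w; rewrite /q; case: eqVneq => [->|wz]; first by rewrite subrr mulr0 addr0.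
    by rewrite divfK ?subr_eq0 // addrC subrK.
  split; last by rewrite /q eqxx.
  move=> e e0; have e2 : 0 < e / 2 by lra.
  have [d d0 Hd] := H _ e2; exists d => // w wd; rewrite {2}/q eqxx /q.
  case: eqVneq => [_|wz]; first by rewrite subrr normc0.
  have wz0 : w - z != 0 by rewrite subr_eq0.
  have -> : (f w - f z) / (w - z) - l = (f w - f z - l * (w - z)) / (w - z) by field.
  rewrite normcM normcV ltr_pdivrMr ?normc_gt0 //.
  apply: le_lt_trans (Hd _ wd) _; rewrite ltr_pM2r ?normc_gt0 //; lra.
move=> [q [qc <-] qE] e e0; have [d d0 Hd] := qc _ e0; exists d => // w wd.
have -> : f w - f z - q z * (w - z) = (q w - q z) * (w - z) by rewrite qE; ring.
by rewrite normcM ler_wpM2r ?normc_ge0 // ltW // Hd.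
Qed.

Lemma ccontD f g z : ccont f z -> ccont g z -> ccont (fun w => f w + g w) z.
Proof.
move=> Hf Hg e e0; have e2 : 0 < e / 2 by lra.
have [d1 d10 H1] := Hf _ e2; have [d2 d20 H2] := Hg _ e2.
exists (Num.min d1 d2); first by rewrite lt_min d10.
move=> w; rewrite lt_min => /andP[/H1 h1 /H2 h2].
have -> : f w + g w - (f z + g z) = (f w - f z) + (g w - g z) by ring.
by apply: le_lt_trans (normcD _ _) _; lra.
Qed.

Lemma ccont_cst c z : ccont (fun _ => c) z.
Proof. by move=> e e0; exists 1 => // w _; rewrite subrr normc0. Qed.

Lemma ccont_id z : ccont id z.
Proof. by move=> e e0; exists e. Qed.

Lemma ccontM f g z : ccont f z -> ccont g z -> ccont (fun w => f w * g w) z.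
Proof.
move=> Hf Hg e e0.
pose A := normc (f z) + normc (g z) + 1.
have A0 : 0 < A by have := normc_ge0 (f z); have := normc_ge0 (g z); rewrite /A; lra.
pose k := Num.min (e / (2 * A)) 1.
have k0 : 0 < k by rewrite lt_min ltr01 andbT divr_gt0 ?mulr_gt0.
have [d1 d10 H1] := Hf _ k0; have [d2 d20 H2] := Hg _ k0.
exists (Num.min d1 d2); first by rewrite lt_min d10.
move=> w; rewrite lt_min => /andP[/H1 h1 /H2 h2].
have -> : f w * g w - f z * g z = (f w - f z) * (g w - g z) +
   (f z * (g w - g z) + (f w - f z) * g z) by ring.
have k1 : k <= 1 by rewrite ge_min lexx orbT.
have kA : k * A <= e / 2.
  have : k <= e / (2 * A) by rewrite ge_min lexx.
  by rewrite invfM mulrA ler_pdivlMr.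
have n1 := normc_ge0 (f w - f z); have n2 := normc_ge0 (g w - g z).
have n3 := normc_ge0 (f z); have n4 := normc_ge0 (g z).
apply: le_lt_trans (normcD _ _) _; apply: le_lt_trans (lerD (lexx _) (normcD _ _)) _.
rewrite !normcM; rewrite /A in kA.
move: (normc (f w - f z)) (normc (g w - g z)) (normc (f z)) (normc (g z)) h1 h2 n1 n2 n3 n4 kA.
move=> x y p q h1 h2 n1 n2 n3 n4 kA.
have i1 : x * y <= k by apply: le_trans (_ : x * 1 <= _); [apply: ler_wpM2l; lra|lra].
have i2 : p * y <= p * k by apply: ler_wpM2l; lra.
have i3 : x * q <= k * q by apply: ler_wpM2r; lra.
by nra.
Qed.

Lemma ccont_comp f g z : ccont f z -> ccont g (f z) -> ccont (fun w => g (f w)) z.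
Proof.
move=> Hf Hg e e0; have [d1 d10 H1] := Hg _ e0; have [d2 d20 H2] := Hf _ d10.
by exists d2 => // w /H2/H1.
Qed.

Lemma ccontV z : z != 0 -> ccont (fun w => w^-1) z.
Proof.
move=> z0 e e0; have nz : 0 < normc z by rewrite normc_gt0.
pose k := Num.min (normc z / 2) (e * (normc z ^+ 2 / 4)).
have z2 : 0 < normc z ^+ 2 by rewrite exprn_gt0.
have k0 : 0 < k by rewrite lt_min; apply/andP; split; [lra|rewrite mulr_gt0 ?divr_gt0].
exists k => // w; rewrite lt_min => /andP[h1 h2].
have nw : normc z / 2 < normc w.
  have := normcD w (z - w); rewrite addrC subrK normcB => h; lra.
have w0 : w != 0 by rewrite -normc_gt0; lra.
have -> : w^-1 - z^-1 = (z - w) / (w * z) by field; rewrite z0 w0.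
rewrite normcM normcV normcM normcB ltr_pdivrMr; last by rewrite mulr_gt0 //; lra.
apply: lt_le_trans h2 _; apply: ler_wpM2l; first exact: ltW.
by rewrite expr2; nra.
Qed.

Lemma cderiv_cont f z l : cderiv f z l -> ccont f z.
Proof.
move=> /cderiv_slope[q [qc _] qE].
have : ccont (fun w => f z + q w * (w - z)) z.
  apply: ccontD; first exact: ccont_cst.
  by apply: ccontM => //; apply: ccontD; [apply: ccont_id|apply: ccont_cst].
move=> H e e0; have [d d0 Hd] := H e e0; exists d => // w wd.
by have := Hd _ wd; rewrite -qE subrr mulr0 addr0.
Qed.

Lemma cdiff_cont f z : cdiff f z -> ccont f z.
Proof. by case=> l /cderiv_cont. Qed.

Lemma cderivM f g z l1 l2 : cderiv f z l1 -> cderiv g z l2 ->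
  cderiv (fun w => f w * g w) z (l1 * g z + f z * l2).
Proof.
move=> Hf Hg; have gc := cderiv_cont Hg.
move/cderiv_slope: Hf => [q1 [c1 <-] E1]; move/cderiv_slope: Hg => [q2 [c2 <-] E2].
apply/cderiv_slope; exists (fun w => q1 w * g w + f z * q2 w); last first.
  by move=> w; rewrite (E1 w) mulrDl {1}(E2 w); ring.
split=> //; apply: ccontD; first exact: ccontM.
by apply: ccontM => //; apply: ccont_cst.
Qed.

Lemma cderiv_comp f g z l1 l2 : cderiv f z l1 -> cderiv g (f z) l2 ->
  cderiv (fun w => g (f w)) z (l2 * l1).
Proof.
move=> Hf Hg; have fc := cderiv_cont Hf.
move/cderiv_slope: Hf => [q1 [c1 <-] E1]; move/cderiv_slope: Hg => [q2 [c2 <-] E2].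
apply/cderiv_slope; exists (fun w => q2 (f w) * q1 w); last first.
  by move=> w; rewrite {1}(E2 (f w)) {2}(E1 w); ring.
by split=> //; apply: ccontM => //; apply: ccont_comp.
Qed.

Lemma ccont_near f g z r : 0 < r -> (forall w, normc (w - z) < r -> f w = g w) ->
  ccont g z -> ccont f z.
Proof.
move=> r0 fg gc e e0; have [d d0 Hd] := gc e e0.
exists (Num.min d r); first by rewrite lt_min d0.
move=> w; rewrite lt_min => /andP[wd wr]; rewrite !fg ?subrr ?normc0 //; exact: Hd.
Qed.

Lemma cderiv_near f g z r l : 0 < r -> (forall w, normc (w - z) < r -> f w = g w) ->
  cderiv g z l -> cderiv f z l.
Proof.
move=> r0 fg gc e e0; have [d d0 Hd] := gc e e0.
exists (Num.min d r); first by rewrite lt_min d0.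
move=> w; rewrite lt_min => /andP[wd wr]; rewrite !fg ?subrr ?normc0 //; exact: Hd.
Qed.

Lemma neq0_near w z : normc (w - z) < normc z -> w != 0.
Proof. by apply: contraTneq => ->; rewrite sub0r normcN ltxx. Qed.

Lemma cderivV z : z != 0 -> cderiv (fun w => w^-1) z (- z ^- 2).
Proof.
move=> z0; apply/cderiv_slope; pose q w := if w == 0 then z^-1 ^+ 2 else - (w^-1 * z^-1).
exists q; last first.
  move=> w; rewrite /q; case: eqVneq => [->|w0]; last by field; rewrite z0 w0.
  by rewrite invr0; field.
split; last by rewrite /q (negPf z0) -invfM -expr2.
apply: (@ccont_near _ (fun w => (-1) * (w^-1 * z^-1)) _ (normc z)).
- by rewrite normc_gt0.
- by move=> w /neq0_near w0; rewrite /q (negPf w0) mulN1r.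
apply: ccontM; first exact: ccont_cst.
by apply: ccontM; [apply: ccontV|apply: ccont_cst].
Qed.

Lemma cdiff_cst c z : cdiff (fun _ => c) z.
Proof. by exists 0; apply: cderiv_cst. Qed.

Lemma cdiff_id z : cdiff id z.
Proof. by exists 1; apply: cderiv_id. Qed.

Lemma cdiffD f g z : cdiff f z -> cdiff g z -> cdiff (fun w => f w + g w) z.
Proof. by move=> [l1 h1] [l2 h2]; exists (l1 + l2); apply: cderivD. Qed.

Lemma cdiffM f g z : cdiff f z -> cdiff g z -> cdiff (fun w => f w * g w) z.
Proof. by move=> [l1 h1] [l2 h2]; exists (l1 * g z + f z * l2); apply: cderivM. Qed.

Lemma cdiff_comp f g z : cdiff f z -> cdiff g (f z) -> cdiff (fun w => g (f w)) z.
Proof. by move=> [l1 h1] [l2 h2]; exists (l2 * l1); apply: cderiv_comp. Qed.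

Lemma cdiffV f z : f z != 0 -> cdiff f z -> cdiff (fun w => (f w)^-1) z.
Proof.
move=> fz h; apply: (cdiff_comp (g := fun w => w^-1)) => //.
by exists (- f z ^- 2); apply: cderivV.
Qed.

Lemma cdiff_near f g z r : 0 < r -> (forall w, normc (w - z) < r -> f w = g w) ->
  cdiff g z -> cdiff f z.
Proof. by move=> r0 fg [l h]; exists l; apply: cderiv_near fg h. Qed.

Lemma cdiff_horner (p : {poly C}) z : cdiff (fun w => p.[w]) z.
Proof.
elim/poly_ind: p => [|p c IH].
  have -> : (fun w => (0 : {poly C}).[w]) = fun _ => 0 by apply/funext => w; rewrite horner0.
  exact: cdiff_cst.
have -> : (fun w => (p * 'X + c%:P).[w]) = fun w => p.[w] * w + c.
  by apply/funext => w; rewrite hornerD hornerM hornerX hornerC.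
apply: cdiffD; last exact: cdiff_cst.
by apply: cdiffM => //; apply: cdiff_id.
Qed.

Lemma cdiffX k c z : cdiff (fun w => (w - c) ^+ k) z.
Proof.
have -> : (fun w => (w - c) ^+ k) = fun w => (('X - c%:P) ^+ k).[w].
  by apply/funext => w; rewrite horner_exp hornerXsubC.
exact: cdiff_horner.
Qed.

(** ** Integrals along segments *)

(** [rderiv P t l]: the derivative at [t] of [P], seen as a function on the unit
    interval only. *)
Definition unit_itv t := 0 <= t <= 1.

Definition rderiv (P : R -> C) t l := forall e, 0 < e -> exists2 d, 0 < d &
  forall u, unit_itv u -> `|u - t| < d ->
    normc (P u - P t - l * (u - t)%:C%C) <= e * `|u - t|.

(** The integral of [f] over the unit interval, as the increment of an
    antiderivative; it is unique by the mean value inequality below. *)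
Definition is_cint (p : R -> C) c := exists2 P, (forall t, unit_itv t -> rderiv P t (p t)) &
  c = P 1 - P 0.

Lemma geometric_limit (x : nat -> R) D : (forall n, `|x n.+1 - x n| <= D / 2 ^+ n) ->
  exists p, forall n, `|x n - p| <= 2 * D / 2 ^+ n.
Proof.
move=> H.
have D0 : 0 <= D by have := H 0%N; rewrite expr0 divr1; apply: le_trans; apply: normr_ge0.
have pow n : 0 < 2 ^- n :> R by rewrite invr_gt0 exprn_gt0.
have powS n : 2 ^- n.+1 * 2 = 2 ^- n :> R by rewrite exprS invfM mulrC mulrA divff ?mul1r.
pose y n := x n + 2 * D / 2 ^+ n; pose z n := x n - 2 * D / 2 ^+ n.
have yS n : y n.+1 <= y n.
  have := H n; rewrite ler_norml => /andP[_].
  have -> : y n.+1 = x n.+1 + D * 2 ^- n.+1 * 2 by rewrite /y; ring.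
  rewrite -mulrA powS /y => h; lra.
have zS n : z n <= z n.+1.
  have := H n; rewrite ler_norml => /andP[h _].
  have -> : z n.+1 = x n.+1 - D * 2 ^- n.+1 * 2 by rewrite /z; ring.
  rewrite -mulrA powS /z; lra.
have yle n m : (n <= m)%N -> y m <= y n.
  by elim: m => [|m IH]; [rewrite leqn0 => /eqP ->|rewrite leq_eqVlt => /predU1P[->//|/IH]; apply: le_trans].
have zle n m : (n <= m)%N -> z n <= z m.
  elim: m => [|m IH]; first by rewrite leqn0 => /eqP ->.
  by rewrite leq_eqVlt => /predU1P[->//|/IH h]; apply: le_trans h _.
have zy n : z n <= y n.
  by rewrite /z /y; have : 0 <= 2 * D / 2 ^+ n; [rewrite !mulr_ge0 // ltW|lra].
have zyall n m : z n <= y m.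
  have [nm|/ltnW mn] := leqP n m.
    exact: le_trans (zle _ _ nm) (zy m).
  exact: le_trans (zy n) (yle _ _ mn).
pose E := [set r | exists n, r = z n].
have supE : has_sup E.
  by split; [exists (z 0%N), 0%N|exists (y 0%N) => _ [n ->]; apply: zyall].
exists (sup E) => n; rewrite ler_norml; apply/andP; split.
  have : sup E <= y n by apply: ge_sup; [exact: supE.1|move=> _ [m ->]; apply: zyall].
  by rewrite /y; lra.
have : z n <= sup E by apply: ub_le_sup; [exact: supE.2|exists n].
by rewrite /z; lra.
Qed.

Lemma small_pow2 D d : 0 < d -> exists n, D / 2 ^+ n < d.
Proof.
move=> d0; have [h|h] := ltP (D / d) 0.
  exists 0%N; rewrite expr0 divr1; move: h.
  by rewrite pmulr_llt0 ?invr_gt0 // => h; apply: lt_trans d0.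
exists (Num.bound (D / d)); rewrite ltr_pdivrMr ?exprn_gt0 // mulrC -ltr_pdivrMr //.
apply: lt_le_trans (archi_boundP h) _.
by rewrite -natrX ler_nat ltnW // ltn_expl.
Qed.

Lemma geometric_limitC (x : nat -> C) D :
  (forall n, normc (x n.+1 - x n) <= D / 2 ^+ n) ->
  exists p, forall n, normc (x n - p) <= 4 * D / 2 ^+ n.
Proof.
move=> H.
have [p Hp] : exists p, forall n, `|complex.Re (x n) - p| <= 2 * D / 2 ^+ n.
  apply: geometric_limit => n; apply: le_trans (H n).
  by rewrite -raddfB; apply: normc_Re.
have [q Hq] : exists p, forall n, `|complex.Im (x n) - p| <= 2 * D / 2 ^+ n.
  apply: geometric_limit => n; apply: le_trans (H n).
  by rewrite -raddfB; apply: normc_Im.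
exists (Complex p q) => n; apply: le_trans (normc_ReIm _) _.
have -> : complex.Re (x n - Complex p q) = complex.Re (x n) - p by case: (x n).
have -> : complex.Im (x n - Complex p q) = complex.Im (x n) - q by case: (x n).
have -> : 4 * D / 2 ^+ n = 2 * D / 2 ^+ n + 2 * D / 2 ^+ n by ring.
by apply: lerD.
Qed.

(** Bisection: if the increment were too large on the unit interval, it would
    stay too large on nested halves, and differentiability at their common
    point forbids this. *)
Lemma mean_value_ineq (P p : R -> C) M : (forall t, unit_itv t -> rderiv P t (p t)) ->
  (forall t, unit_itv t -> normc (p t) <= M) -> normc (P 1 - P 0) <= M.
Proof.
move=> HP Hp; rewrite leNgt; apply/negP => bad0.
pose e := (normc (P 1 - P 0) - M) / 2.
have e0 : 0 < e by rewrite /e; lra.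
pose K := M + e.
have K0 : K < normc (P 1 - P 0) by rewrite /K /e; lra.
pose bad (s : R * R) := K * (s.2 - s.1) < normc (P s.2 - P s.1).
pose mid (s : R * R) := (s.1 + s.2) / 2.
pose step (s : R * R) := if bad (s.1, mid s) then (s.1, mid s) else (mid s, s.2).
pose s n := iter n step (0, 1).
have sS n : s n.+1 = step (s n) by [].
have len n : (s n).2 - (s n).1 = 2 ^- n.
  elim: n => [|n IH]; first by rewrite /= subr0 expr0 invr1.
  rewrite sS /step exprS invfM -IH; case: ifP => _ /=; rewrite /mid; lra.
have sbad n : bad (s n).
  elim: n => [|n IH]; first by rewrite /bad /= subr0 mulr1.
  rewrite sS /step; case: ifP => // /negbT; rewrite /bad /= -leNgt => h.
  rewrite ltNge; apply/negP => h2; move: IH; rewrite /bad ltNge => /negP; apply.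
  apply: le_trans (normc_tri _ (P (mid (s n))) _) _.
  have -> : K * ((s n).2 - (s n).1) = K * ((s n).2 - mid (s n)) + K * (mid (s n) - (s n).1).
    by ring.
  exact: lerD.
have pow n : 0 < 2 ^- n :> R by rewrite invr_gt0 exprn_gt0.
have s1 n : 0 <= (s n).1 /\ (s n).2 <= 1.
  elim: n => [|n [h1 h2]] //; rewrite sS /step; have := len n; have := pow n => h3 h4.
  by case: ifP => _ /=; rewrite /mid; split; lra.
have [q Hq] : exists q, forall n, `|(s n).1 - q| <= 2 * 1 / 2 ^+ n.
  apply: geometric_limit => n; rewrite sS /step; have := len n; have := pow n.
  move=> h3 h4; case: ifP => _ /=; rewrite /mid ?subrr ?normr0 ?mul1r ?ltW //.
  by rewrite ger0_norm; lra.
have q01 : unit_itv q.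
  apply/andP; split; rewrite leNgt; apply/negP => h.
    have [n hn] := @small_pow2 (2 * 1) (- q) ltac:(lra).
    have [h1 _] := s1 n; have := Hq n; rewrite ler_norml => /andP[_ h2]; lra.
  have [n hn] := @small_pow2 (2 * 1) (q - 1) ltac:(lra).
  have [h1 h1'] := s1 n; have := Hq n; rewrite ler_norml => /andP[h2 _].
  have := len n; have := pow n; lra.
have [d d0 Hd] := HP q q01 (e / 5) ltac:(lra).
have [n hn] := small_pow2 (2 * 4) d0.
have [h1 h2] := s1 n; have := Hq n; rewrite ler_norml => /andP[h3 h4].
have hl := len n; have hp := pow n; have hb := sbad n; move: hb; rewrite /bad hl /K.
set a := (s n).1 in h1 h3 h4 hl *; set b := (s n).2 in h2 hl *.
have aq : `|a - q| <= 3 * 2 ^- n by rewrite ler_norml; lra.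
have bq : `|b - q| <= 3 * 2 ^- n by rewrite ler_norml; lra.
have ua : unit_itv a by apply/andP; split; lra.
have ub : unit_itv b by apply/andP; split; lra.
have Ha := Hd a ua ltac:(lra); have Hb := Hd b ub ltac:(lra).
have -> : P b - P a = (P b - P q - p q * (b - q)%:C%C) - (P a - P q - p q * (a - q)%:C%C)
   + p q * (b - a)%:C%C.
  by rewrite !rmorphB /=; ring.
apply/negP; rewrite -leNgt; apply: le_trans (normcD _ _) _.
apply: le_trans (lerD (normcD _ _) (lexx _)) _.
rewrite normcN normcM normc_real hl (gtr0_norm hp).
have i1 : normc (p q) * 2 ^- n <= M * 2 ^- n by rewrite ler_pM2r // Hp.
have i2 : e / 5 * `|b - q| <= e / 5 * (3 * 2 ^- n) by apply: ler_wpM2l => //; lra.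
have i3 : e / 5 * `|a - q| <= e / 5 * (2 * 2 ^- n).
  by apply: ler_wpM2l; [lra|rewrite ler_norml; lra].
have i4 : e / 5 * (3 * 2 ^- n) + e / 5 * (2 * 2 ^- n) = e * 2 ^- n by field.
rewrite mulrDl; lra.
Qed.

Lemma rderivB P Q t l k : rderiv P t l -> rderiv Q t k ->
  rderiv (fun u => P u - Q u) t (l - k).
Proof.
move=> H1 H2 e e0; have e2 : 0 < e / 2 by lra.
have [d1 d10 h1] := H1 _ e2; have [d2 d20 h2] := H2 _ e2.
exists (Num.min d1 d2); first by rewrite lt_min d10.
move=> u u01; rewrite lt_min => /andP[/(h1 _ u01) i1 /(h2 _ u01) i2].
have -> : P u - Q u - (P t - Q t) - (l - k) * (u - t)%:C%C =
  (P u - P t - l * (u - t)%:C%C) - (Q u - Q t - k * (u - t)%:C%C) by ring.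
by apply: le_trans (normcD _ _) _; rewrite normcN; lra.
Qed.

Lemma rderivZ P t l c : rderiv P t l -> rderiv (fun u => c * P u) t (c * l).
Proof.
move=> H e e0; have c0 := normc_ge0 c.
have [d d0 h] := H (e / (normc c + 1)) ltac:(by rewrite divr_gt0 //; lra).
exists d => // u u01 ud; rewrite -!(mulrA, mulrBr) normcM.
apply: le_trans (ler_wpM2l c0 (h u u01 ud)) _.
rewrite mulrA; apply: ler_wpM2r => //.
by rewrite mulrA ler_pdivrMr; nra.
Qed.

Lemma rderiv_affine P l (r s t : R) : (forall u, unit_itv u -> unit_itv (r * u + s)) ->
  unit_itv t -> rderiv P (r * t + s) l ->
  rderiv (fun u => P (r * u + s)) t (r%:C%C * l).
Proof.
move=> Hrs t01 H e e0; have r0 := normr_ge0 r.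
have [d d0 h] := H (e / (`|r| + 1)) ltac:(by rewrite divr_gt0 //; lra).
exists (d / (`|r| + 1)); first by rewrite divr_gt0 //; lra.
move=> u u01; rewrite ltr_pdivlMr; last lra.
move=> ud; have E : r * u + s - (r * t + s) = r * (u - t) by ring.
have := h (r * u + s) (Hrs _ u01); rewrite E normrM => hu.
have n0 := normr_ge0 (u - t).
have {}hu := hu ltac:(nra).
have -> : r%:C%C * l * (u - t)%:C%C = l * (r * (u - t))%:C%C by rewrite rmorphM /=; ring.
apply: le_trans hu _; rewrite mulrA; apply: ler_wpM2r => //.
by rewrite mulrAC ler_pdivrMr; nra.
Qed.

Lemma rderiv_cderiv F a v t l : cderiv F (a + t%:C%C * v) l ->
  rderiv (fun u => F (a + u%:C%C * v)) t (l * v).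
Proof.
move=> H e e0; have v0 := normc_ge0 v.
have [d d0 h] := H (e / (normc v + 1)) ltac:(by rewrite divr_gt0 //; lra).
exists (d / (normc v + 1)); first by rewrite divr_gt0 //; lra.
move=> u _; rewrite ltr_pdivlMr; last lra.
move=> ud; have E : a + u%:C%C * v - (a + t%:C%C * v) = (u - t)%:C%C * v.
  by rewrite rmorphB /=; ring.
have := h (a + u%:C%C * v); rewrite E normcM normc_real => hu.
have n0 := normr_ge0 (u - t).
have {}hu := hu ltac:(nra).
have -> : l * v * (u - t)%:C%C = l * ((u - t)%:C%C * v) by ring.
apply: le_trans hu _; rewrite [_ * normc v]mulrC mulrA; apply: ler_wpM2r => //.
by rewrite mulrAC ler_pdivrMr; nra.
Qed.

Lemma unit_itv0 : unit_itv 0. Proof. by rewrite /unit_itv lexx ler01. Qed.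
Lemma is_cint_le p c M : is_cint p c -> (forall t, unit_itv t -> normc (p t) <= M) ->
  normc c <= M.
Proof. by move=> [P HP ->] HM; apply: mean_value_ineq HP HM. Qed.

Lemma is_cintB p q c1 c2 : is_cint p c1 -> is_cint q c2 ->
  is_cint (fun t => p t - q t) (c1 - c2).
Proof.
move=> [P HP ->] [Q HQ ->]; exists (fun t => P t - Q t); last by ring.
by move=> t t01; apply: rderivB; [apply: HP|apply: HQ].
Qed.

Lemma is_cint_ext p q c : (forall t, unit_itv t -> p t = q t) -> is_cint p c -> is_cint q c.
Proof. by move=> pq [P HP ->]; exists P => // t t01; rewrite -pq //; apply: HP. Qed.

Lemma is_cint_unique p c1 c2 : is_cint p c1 -> is_cint p c2 -> c1 = c2.
Proof.
move=> h1 h2; apply/eqP; rewrite -subr_eq0 -normc_eq0 eq_le normc_ge0 andbT.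
by apply: is_cint_le (is_cintB h1 h2) _ => t _; rewrite subrr normc0.
Qed.

Lemma is_cintZ p c1 c : is_cint p c1 -> is_cint (fun t => c * p t) (c * c1).
Proof.
move=> [P HP ->]; exists (fun t => c * P t); last by ring.
by move=> t t01; apply: rderivZ; apply: HP.
Qed.

Definition cint p := xget 0 (is_cint p).

Lemma cint_eq p c : is_cint p c -> cint p = c.
Proof.
move=> h; have h' := xgetPex 0 (ex_intro (is_cint p) c h).
exact: is_cint_unique h' h.
Qed.

Definition rcont (p : R -> C) t := forall e, 0 < e -> exists2 d, 0 < d &
  forall u, unit_itv u -> `|u - t| < d -> normc (p u - p t) < e.

(** Real continuous functions have antiderivatives, by the fundamental theorem
    for the Lebesgue integral; complex valued ones inherit this by components. *)
Lemma antiderivative_real (h : R -> R) : continuous h ->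
  exists H : R -> R, forall x, unit_itv x -> forall e, 0 < e -> exists2 d, 0 < d &
   forall y, `|y - x| < d -> `|H y - H x - h x * (y - x)| <= e * `|y - x|.
Proof.
move=> hc; pose H x := (\int[@lebesgue_measure R]_(t in `[(-1)%R, x]) (h t))%R.
exists H => x /andP[x0 x1].
have hi : (@lebesgue_measure R).-integrable `[(-1)%R, 2%R] (EFin \o h).
  apply: continuous_compact_integrable; first exact: segment_compact.
  exact: continuous_subspaceT.
have x2 : x < 2 by lra.
have [|dH HE] := @continuous_FTC1_closed R h (-1) x 2 x2 hi _ (hc x); first by lra.
rewrite derive1E in HE.
have lim : (fun k : R^o => k^-1 *: ((H : R^o -> R^o) (k *: (1 : R^o) + x) - H x)) @ (0 : R^o)^' --> (h x : R^o).
  by rewrite -HE; exact: dH.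
by move=> e e0; have [d d0 Hd] := (derivable_epsP (H : R^o -> R^o) x (h x)).1 lim e e0; exists d.
Qed.

(** Retraction of the line to the unit interval, which extends an integrand to a
    continuous function on the whole line. *)
Definition clamp t : R := Num.max 0 (Num.min t 1).

Lemma clamp_itv t : unit_itv (clamp t).
Proof. by rewrite /clamp /unit_itv le_max lexx /= ge_max ler01 ge_min lexx orbT. Qed.

Lemma clamp_id t : unit_itv t -> clamp t = t.
Proof. by move=> /andP[t0 t1]; rewrite /clamp (min_idPl t1) (max_idPr t0). Qed.

Lemma clamp_lip t u : `|clamp t - clamp u| <= `|t - u|.
Proof.
rewrite /clamp !maxEle !minEle; have := ler_norm (t - u); have := ler_norm (u - t).
rewrite [`|u - t|]distrC => ? ?; rewrite ler_norml.
case: (leP t 1) => ?; case: (leP u 1) => ?; rewrite ?ler01;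
  try case: (leP 0 t) => ?; try case: (leP 0 u) => ?; lra.
Qed.

Lemma antiderivative_unit (h : R -> R) :
  (forall t, unit_itv t -> forall e, 0 < e -> exists2 d, 0 < d &
     forall u, unit_itv u -> `|u - t| < d -> `|h u - h t| < e) ->
  exists H : R -> R, forall x, unit_itv x -> forall e, 0 < e -> exists2 d, 0 < d &
   forall y, `|y - x| < d -> `|H y - H x - h x * (y - x)| <= e * `|y - x|.
Proof.
move=> hc; have [|H HH] := @antiderivative_real (fun t => h (clamp t)).
  move=> x; apply/(@cvgrPdist_lt R R^o) => e e0; apply/(near_nbhsP (x : R^o)).
  have [d d0 Hd] := hc _ (clamp_itv x) e e0; exists d => // z zd.
  by rewrite distrC; apply: Hd; [apply: clamp_itv|apply: le_lt_trans (clamp_lip _ _) zd].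
by exists H => x x01; have := HH x x01; rewrite clamp_id.
Qed.

Lemma is_cint_ex p : (forall t, unit_itv t -> rcont p t) -> is_cint p (cint p).
Proof.
move=> pc; suff [c hc] : exists c, is_cint p c by rewrite (cint_eq hc).
have [|F HF] := @antiderivative_unit (fun t => complex.Re (p t)).
  move=> t t01 e e0; have [d d0 Hd] := pc t t01 e e0; exists d => // u u01 ud.
  by rewrite -raddfB; apply: le_lt_trans (normc_Re _) (Hd u u01 ud).
have [|G HG] := @antiderivative_unit (fun t => complex.Im (p t)).
  move=> t t01 e e0; have [d d0 Hd] := pc t t01 e e0; exists d => // u u01 ud.
  by rewrite -raddfB; apply: le_lt_trans (normc_Im _) (Hd u u01 ud).
pose P t := Complex (F t) (G t); exists (P 1 - P 0), P => // t t01 e e0.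
have [d1 d10 h1] := HF t t01 (e / 2) ltac:(lra).
have [d2 d20 h2] := HG t t01 (e / 2) ltac:(lra).
exists (Num.min d1 d2); first by rewrite lt_min d10.
move=> u _; rewrite lt_min => /andP[/h1 i1 /h2 i2].
apply: le_trans (normc_ReIm _) _.
have -> : complex.Re (P u - P t - p t * (u - t)%:C%C) =
    F u - F t - complex.Re (p t) * (u - t).
  by case: (p t) => x y /=; rewrite mulr0 subr0.
have -> : complex.Im (P u - P t - p t * (u - t)%:C%C) =
    G u - G t - complex.Im (p t) * (u - t).
  by case: (p t) => x y /=; rewrite mulr0 add0r.
lra.
Qed.

Lemma is_cint_rev p c : is_cint p c -> is_cint (fun t => p (1 - t)) c.
Proof.
move=> [P HP ->]; exists (fun t => (-1) * P ((-1) * t + 1)).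
  move=> t /andP[t0 t1].
  have E : p (1 - t) = (-1) * ((-1)%:C%C * p (1 - t)) by rewrite rmorphN1 !mulN1r opprK.
  rewrite E; apply: rderivZ; apply: rderiv_affine.
  - by move=> u /andP[u0 u1]; apply/andP; split; lra.
  - by apply/andP.
  have -> : -1 * t + 1 = 1 - t by lra.
  by apply: HP; apply/andP; split; lra.
by rewrite mulr1 addNr mulr0 add0r !mulN1r opprK addrC.
Qed.

Lemma is_cint_half p c : is_cint p c -> exists c1 c2,
  [/\ is_cint (fun t => p (2^-1 * t + 0)) c1, is_cint (fun t => p (2^-1 * t + 2^-1)) c2 &
      2 * c = c1 + c2].
Proof.
move=> [P HP ->].
have part (s : R) : 0 <= s <= 2^-1 ->
    is_cint (fun t => p (2^-1 * t + s)) (2 * P (2^-1 + s) - 2 * P s).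
  move=> /andP[s0 s1]; exists (fun t => 2 * P (2^-1 * t + s)); last first.
    by rewrite mulr1 mulr0 add0r.
  move=> t t01; have E : p (2^-1 * t + s) = 2 * (2^-1%:C%C * p (2^-1 * t + s)).
    by rewrite fmorphV rmorph_nat mulrA divff ?mul1r // pnatr_eq0.
  have maps u : unit_itv u -> unit_itv (2^-1 * u + s).
    by move=> /andP[u0 u1]; apply/andP; split; lra.
  by rewrite E; apply: rderivZ; apply: rderiv_affine => //; apply/HP/maps.
exists (2 * P (2^-1 + 0) - 2 * P 0), (2 * P (2^-1 + 2^-1) - 2 * P 2^-1).
split; [by apply: part; lra|by apply: part; lra|].
have -> : 2^-1 + 2^-1 = 1 :> R by lra.
by rewrite addr0; ring.
Qed.

Definition seg a b t : C := a + t%:C%C * (b - a).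

Definition lint f a b : C := (b - a) * cint (fun t => f (seg a b t)).

(** Continuity along a segment, the standing hypothesis on integrands. *)
Definition seg_cont f a b := forall t, unit_itv t -> ccont f (seg a b t).

Lemma seg_dist a b t u : normc (seg a b u - seg a b t) = `|u - t| * normc (b - a).
Proof.
have -> : seg a b u - seg a b t = (u - t)%:C%C * (b - a).
  by rewrite /seg rmorphB /=; ring.
by rewrite normcM normc_real.
Qed.

Lemma lint_is f a b : seg_cont f a b ->
  is_cint (fun t => f (seg a b t)) (cint (fun t => f (seg a b t))).
Proof.
move=> fc; apply: is_cint_ex => t t01 e e0.
have [d d0 Hd] := fc t t01 e e0; have n0 := normc_ge0 (b - a).
exists (d / (normc (b - a) + 1)); first by rewrite divr_gt0 //; lra.
move=> u _; rewrite ltr_pdivlMr; last lra.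
move=> ud; apply: Hd; rewrite seg_dist.
by have := normr_ge0 (u - t); nra.
Qed.

Lemma lintB f g a b : seg_cont f a b -> seg_cont g a b ->
  lint (fun w => f w - g w) a b = lint f a b - lint g a b.
Proof.
move=> fc gc; rewrite /lint -mulrBr; congr (_ * _); apply: cint_eq.
by apply: is_cintB; apply: lint_is.
Qed.

Lemma lintZ f c a b : seg_cont f a b -> lint (fun w => c * f w) a b = c * lint f a b.
Proof.
move=> fc; rewrite /lint mulrCA; congr (_ * _); apply: cint_eq.
by apply: is_cintZ; apply: lint_is.
Qed.

Lemma lint_ext f g a b : (forall t, unit_itv t -> f (seg a b t) = g (seg a b t)) ->
  seg_cont g a b -> lint f a b = lint g a b.
Proof.
move=> fg gc; congr (_ * _); apply: cint_eq.
by apply: is_cint_ext (lint_is gc) => t t01; rewrite fg.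
Qed.

Lemma lint_le f a b M : seg_cont f a b ->
  (forall t, unit_itv t -> normc (f (seg a b t)) <= M) ->
  normc (lint f a b) <= M * normc (b - a).
Proof.
move=> fc HM; rewrite normcM mulrC; apply: ler_wpM2r; first exact: normc_ge0.
exact: is_cint_le (lint_is fc) HM.
Qed.

Lemma lint_rev f a b : seg_cont f a b -> lint f b a = - lint f a b.
Proof.
move=> fc; rewrite /lint -mulNr opprB; congr (_ * _); apply: cint_eq.
apply: is_cint_ext (is_cint_rev (lint_is fc)) => t _; congr (f _).
by rewrite /seg rmorphB /=; ring.
Qed.

Definition midpt a b : C := 2^-1 * (a + b).

Lemma lint_half f a b : seg_cont f a b ->
  lint f a b = lint f a (midpt a b) + lint f (midpt a b) b.
Proof.
move=> fc; have [c1 [c2 [h1 h2 E]]] := is_cint_half (lint_is fc).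
have n2 : (2 : C) != 0 by rewrite pnatr_eq0.
have e1 : cint (fun t => f (seg a (midpt a b) t)) = c1.
  apply: cint_eq; apply: is_cint_ext h1 => t _; congr (f _).
  by rewrite /seg /midpt addr0 rmorphM fmorphV rmorph_nat /=; field.
have e2 : cint (fun t => f (seg (midpt a b) b t)) = c2.
  apply: cint_eq; apply: is_cint_ext h2 => t _; congr (f _).
  by rewrite /seg /midpt rmorphD rmorphM fmorphV rmorph_nat /=; field.
by rewrite /lint e1 e2; apply: (mulfI n2); rewrite mulrCA E /midpt; field.
Qed.

Lemma lint_FTC f F a b : (forall t, unit_itv t -> cderiv F (seg a b t) (f (seg a b t))) ->
  lint f a b = F b - F a.
Proof.
move=> H; have [->|ab] := eqVneq a b; first by rewrite /lint !subrr mul0r.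
have ab0 : b - a != 0 by rewrite subr_eq0 eq_sym.
have : is_cint (fun t => (b - a)^-1 * (f (seg a b t) * (b - a))) ((b - a)^-1 * (F b - F a)).
  apply: is_cintZ; exists (fun t => F (seg a b t)); last first.
    by rewrite /seg rmorph1 mul1r rmorph0 mul0r addr0 [a + _]addrC subrK.
  by move=> t t01; apply: rderiv_cderiv; apply: H.
move=> h; rewrite /lint (@cint_eq _ ((b - a)^-1 * (F b - F a))) ?mulVKf //.
by apply: is_cint_ext h => t _; rewrite mulrCA mulVf ?mulr1.
Qed.

Lemma lint_affine f al be a b :
  lint f (al * a + be) (al * b + be) = al * lint (fun w => f (al * w + be)) a b.
Proof.
rewrite /lint mulrA; congr (_ * _); first by ring.
congr cint; apply/funext => t; congr (f _); rewrite /seg; ring.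
Qed.

(** ** Goursat's theorem on triangles *)

Definition closed_convex (K : C -> Prop) :=
  (forall a b t, K a -> K b -> unit_itv t -> K (seg a b t)) /\
  (forall z, (forall e, 0 < e -> exists2 w, K w & normc (w - z) < e) -> K z).

Definition tint f a b c : C := lint f a b + lint f b c + lint f c a.

Lemma seg_half a b : seg a b 2^-1 = midpt a b.
Proof. by rewrite /seg /midpt fmorphV rmorph_nat; field. Qed.

Section Goursat.
Variables (K : C -> Prop) (f : C -> C).
Hypotheses (HK : closed_convex K) (Hf : forall z, K z -> cdiff f z).

Lemma convex_seg_cont a b : K a -> K b -> seg_cont f a b.
Proof. by move=> Ka Kb t t01; apply/cdiff_cont/Hf; apply: HK.1. Qed.

Lemma convex_mid a b : K a -> K b -> K (midpt a b).
Proof.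
by move=> Ka Kb; rewrite -seg_half; apply: HK.1 => //; apply/andP; split; lra.
Qed.

Lemma tint_split a b c : K a -> K b -> K c ->
  tint f a b c = tint f a (midpt a b) (midpt c a) + tint f (midpt a b) b (midpt b c) +
    (tint f (midpt c a) (midpt b c) c + tint f (midpt a b) (midpt b c) (midpt c a)).
Proof.
move=> Ka Kb Kc; have Kab := convex_mid Ka Kb; have Kbc := convex_mid Kb Kc.
have Kca := convex_mid Kc Ka.
rewrite /tint (lint_half (convex_seg_cont Ka Kb)) (lint_half (convex_seg_cont Kb Kc)).
rewrite (lint_half (convex_seg_cont Kc Ka)).
rewrite (lint_rev (convex_seg_cont Kab Kca)) (lint_rev (convex_seg_cont Kbc Kab)).
by rewrite (lint_rev (convex_seg_cont Kca Kbc)); ring.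
Qed.

Let tri := (C * C * C)%type.
Let val (s : tri) : C := tint f s.1.1 s.1.2 s.2.
Let inK (s : tri) := [/\ K s.1.1, K s.1.2 & K s.2].
Let small D (s : tri) :=
  [/\ normc (s.1.2 - s.1.1) <= D, normc (s.2 - s.1.1) <= D & normc (s.2 - s.1.2) <= D].

(* One of the four halves of a triangle carries a quarter of the integral. *)
Let step (s : tri) : tri :=
  let: (a, b, c) := s in
  if normc (val s) <= 4 * normc (val (a, midpt a b, midpt c a)) then (a, midpt a b, midpt c a)
  else if normc (val s) <= 4 * normc (val (midpt a b, b, midpt b c)) then (midpt a b, b, midpt b c)
  else if normc (val s) <= 4 * normc (val (midpt c a, midpt b c, c)) then (midpt c a, midpt b c, c)
  else (midpt a b, midpt b c, midpt c a).

Let step_val s : inK s -> normc (val s) <= 4 * normc (val (step s)).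
Proof.
case: s => [[a b] c] [Ka Kb Kc] /=; case: ifP => // /negbT; rewrite -ltNge => h1.
case: ifP => // /negbT; rewrite -ltNge => h2.
case: ifP => // /negbT; rewrite -ltNge => h3.
move: h1 h2 h3; rewrite /val /= (tint_split Ka Kb Kc).
set t1 := tint f a (midpt a b) (midpt c a); set t2 := tint f (midpt a b) b (midpt b c).
set t3 := tint f (midpt c a) (midpt b c) c.
set t4 := tint f (midpt a b) (midpt b c) (midpt c a).
have := normcD (t1 + t2) (t3 + t4); have := normcD t1 t2; have := normcD t3 t4; lra.
Qed.

Let step_inK s : inK s -> inK (step s).
Proof.
case: s => [[a b] c] [Ka Kb Kc] /=; have Kab := convex_mid Ka Kb.
have Kbc := convex_mid Kb Kc; have Kca := convex_mid Kc Ka.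
by case: ifP => _; [|case: ifP => _; [|case: ifP => _]].
Qed.

Let half_le a b c D : a = 2^-1 * b \/ a = - (2^-1 * b) -> normc b <= D -> normc a <= D / 2.
Proof.
have n2 : normc (2^-1 : C) = 2^-1.
  by rewrite normcV -(rmorph_nat (real_complex R) 2) normc_real normr_nat.
by case=> ->; rewrite ?normcN normcM n2; lra.
Qed.

Let step_small D s : small D s -> small (D / 2) (step s) /\
  normc ((step s).1.1 - s.1.1) <= D / 2.
Proof.
have D2 c : 0 <= normc c <= D -> 0 <= D / 2 by move=> /andP[h1 h2]; lra.
case: s => [[a b] c] [/= h1 h2 h3].
have D0 : 0 <= D / 2 by apply: (D2 (b - a)); rewrite normc_ge0.
have hab := fun x H => half_le (a := x) (b := b - a) 0 H h1.
have hac := fun x H => half_le (a := x) (b := c - a) 0 H h2.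
have hbc := fun x H => half_le (a := x) (b := c - b) 0 H h3.
rewrite /step; case: ifP => _; [|case: ifP => _; [|case: ifP => _]];
  rewrite /small /midpt /=; (split; first split);
  rewrite ?subrr ?normc0 //;
  first [by apply: hab; left; field | by apply: hac; left; field | by apply: hbc; left; field
        | by apply: hab; right; field].
Qed.

(** The nested triangles chosen by [step] shrink to a point of [K]; there the
    integrand is affine up to a small error, and the integral of an affine
    function along a triangle vanishes. *)
Theorem goursat a b c : K a -> K b -> K c -> tint f a b c = 0.
Proof.
move=> Ka Kb Kc; apply/eqP; rewrite -normc_eq0 eq_le normc_ge0 andbT leNgt; apply/negP => T0.
set T := normc _ in T0.
pose D := normc (b - a) + normc (c - a) + normc (c - b).
have D0 : 0 <= D by rewrite /D; have := normc_ge0 (b - a); have := normc_ge0 (c - a);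
  have := normc_ge0 (c - b); lra.
pose s n := iter n step (a, b, c).
have sK n : inK (s n) by elim: n => [|n IH] //; apply: step_inK.
have sD n : small (D / 2 ^+ n) (s n).
  elim: n => [|n IH].
    rewrite expr0 divr1 /small /= /D; have := normc_ge0 (b - a); have := normc_ge0 (c - a).
    by have := normc_ge0 (c - b); split; lra.
  have -> : D / 2 ^+ n.+1 = D / 2 ^+ n / 2 by rewrite exprSr invfM mulrA.
  by have [] := step_small IH.
have sT n : T / 4 ^+ n <= normc (val (s n)).
  elim: n => [|n IH]; first by rewrite expr0 divr1.
  have := step_val (sK n); rewrite -/(s n.+1) exprSr invfM mulrA; lra.
have pow n : 0 < 2 ^- n :> R by rewrite invr_gt0 exprn_gt0.
have [p Hp] : exists p, forall n, normc ((s n).1.1 - p) <= 4 * D / 2 ^+ n.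
  apply: geometric_limitC => n; have [_ h] := step_small (sD n); apply: le_trans h _.
  by have := pow n; nra.
have Kp : K p.
  apply: HK.2 => e e0; have [n hn] := small_pow2 (4 * D) e0.
  by exists (s n).1.1; [case: (sK n)|apply: le_lt_trans (Hp n) hn].
have [l Hl] := Hf Kp.
pose e := T / (18 * D ^+ 2 + 1) / 2.
have DD : 0 <= D ^+ 2 by rewrite exprn_ge0.
have e0 : 0 < e by rewrite /e divr_gt0 ?divr_gt0 //; lra.
have [d d0 Hd] := Hl e e0.
have [n hn] := small_pow2 (6 * D) d0.
pose aff w := f p + l * (w - p).
pose prim w := f p * w + l * 2^-1 * ((w - p) * (w - p)).
have affd w : cderiv prim w (aff w).
  have h : cderiv (fun w => w - p) w 1.
    have := cderivD (cderiv_id w) (cderiv_cst (- p) w); rewrite addr0; exact.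
  have := cderivD (cderivM (cderiv_cst (f p) w) (cderiv_id w))
                  (cderivM (cderiv_cst (l * 2^-1) w) (cderivM h h)).
  by rewrite !mul0r !add0r mulr1; have -> : l / 2 * (1 * (w - p) + (w - p) * 1) = l * (w - p) by field.
have aff0 x y : lint aff x y = prim y - prim x by apply: lint_FTC => t _; apply: affd.
have affc x y : seg_cont aff x y.
  move=> t _; apply: ccontD; first exact: ccont_cst.
  by apply: ccontM; [apply: ccont_cst|apply: ccontD; [apply: ccont_id|apply: ccont_cst]].
have [h1 h2 h3] := sD n; have [k1 k2 k3] := sK n; have hp := Hp n; have hT := sT n.
set x := (s n).1.1 in h1 h2 h3 k1 k2 k3 hp hT *; set y := (s n).1.2 in h1 h3 k2 hT *.
set z := (s n).2 in h2 h3 k3 hT *; set E := D / 2 ^+ n in h1 h2 h3.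
have hp' : normc (x - p) <= 4 * E by rewrite /E mulrA.
have hn' : 6 * E < d by rewrite /E mulrA.
have E0 : 0 <= E by rewrite /E mulr_ge0 // ltW.
have edge (u v : C) : K u -> K v -> normc (u - x) <= E -> normc (v - u) <= E ->
    normc (lint f u v - lint aff u v) <= e * (6 * E) * E.
  move=> Ku Kv ux vu; have uc := convex_seg_cont Ku Kv.
  rewrite -lintB //.
  have b1 t : unit_itv t -> normc (f (seg u v t) - aff (seg u v t)) <= e * (6 * E).
    move=> /andP[t0 t1].
    have wp : normc (seg u v t - p) <= 6 * E.
      apply: le_trans (normc_tri _ u _) _.
      have -> : seg u v t - u = t%:C%C * (v - u) by rewrite /seg; ring.
      have := normc_tri u x p; rewrite normcM normc_real ger0_norm //.
      have := normc_ge0 (v - u); nra.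
    have := Hd (seg u v t) ltac:(lra); rewrite /aff opprD addrA => h.
    by apply: le_trans h _; apply: ler_wpM2l => //; apply: ltW.
  apply: le_trans (lint_le _ b1) _.
    move=> t t01; apply: ccontD; first exact: uc.
    have -> : (fun w => - aff w) = fun w => (-1) * aff w by apply/funext => w; rewrite mulN1r.
    by apply: ccontM; [apply: ccont_cst|apply: affc].
  by apply: ler_wpM2l => //; apply: mulr_ge0; [apply: ltW|lra].
have yx : normc (y - x) <= E by [].
have g1 := edge x y k1 k2 ltac:(by rewrite subrr normc0) h1.
have g2 := edge y z k2 k3 h1 h3.
have g3 := edge z x k3 k1 h2 ltac:(by rewrite normcB).
have : normc (val (s n)) <= 18 * e * E ^+ 2.
  have -> : val (s n) = (lint f x y - lint aff x y) + (lint f y z - lint aff y z) +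
     (lint f z x - lint aff z x) by rewrite !aff0 /val /tint -/x -/y -/z; ring.
  apply: le_trans (normcD _ _) _; apply: le_trans (lerD (normcD _ _) (lexx _)) _.
  rewrite expr2; lra.
move=> /(le_trans hT); apply/negP; rewrite -ltNge /E expr_div_n -exprM mulnC exprM.
have -> : 2 ^+ 2 = 4 :> R by lra.
rewrite mulrA ltr_pM2r; last by rewrite invr_gt0 exprn_gt0.
rewrite /e; have -> : 18 * (T / (18 * D ^+ 2 + 1) / 2) * D ^+ 2 =
  T * (18 * D ^+ 2 / (18 * D ^+ 2 + 1) / 2) by field; lra.
rewrite gtr_pMr // ltr_pdivrMr // ltr_pdivrMr; lra.
Qed.

End Goursat.

(** ** Cauchy's formula on a square and Taylor expansions *)

Lemma closed_convex_slab rho eta (u z : C) : normc u = 1 ->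
  closed_convex (fun w => normc w <= rho /\ eta <= complex.Re (u * (w - z))).
Proof.
move=> u1; split.
  move=> a b t [a1 a2] [b1 b2] /andP[t0 t1]; split.
    have -> : seg a b t = (1 - t)%:C%C * a + t%:C%C * b.
      by rewrite /seg rmorphB rmorph1; ring.
    apply: le_trans (normcD _ _) _; rewrite !normcM !normc_real !ger0_norm //; last lra.
    nra.
  have -> : u * (seg a b t - z) = (1 - t)%:C%C * (u * (a - z)) + t%:C%C * (u * (b - z)).
    by rewrite /seg rmorphB rmorph1; ring.
  have ReM (x : R) (y : C) : complex.Re (x%:C%C * y) = x * complex.Re y.
    by case: y => y1 y2 /=; rewrite mul0r subr0.
  rewrite raddfD /= !ReM; nra.
move=> p H; split; rewrite leNgt; apply/negP => h.
  have [w [h1 _] h2] := H (normc p - rho) ltac:(lra).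
  by have := normcD w (p - w); rewrite addrC subrK normcB; lra.
have [w [_ h1] h2] := H (eta - complex.Re (u * (p - z))) ltac:(lra).
have : complex.Re (u * (w - z)) = complex.Re (u * (p - z)) + complex.Re (u * (w - p)).
  by rewrite -raddfD /=; congr complex.Re; ring.
have := normc_Re (u * (w - p)); rewrite normcM u1 mul1r ler_norml => /andP[_ h3]; lra.
Qed.

Lemma cderiv_invX n z : z != 0 ->
  cderiv (fun w => w^-1 ^+ n.+1) z (- n.+1%:R * z^-1 ^+ n.+2).
Proof.
move=> z0; elim: n => [|n IH].
  have := cderivV z0; have -> : - z ^- 2 = - 1%:R * z^-1 ^+ 2 by rewrite mulN1r exprVn.
  exact.
have -> : (fun w : C => w^-1 ^+ n.+2) = fun w => w^-1 * w^-1 ^+ n.+1.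
  by apply/funext => w; rewrite exprS.
have := cderivM (cderivV z0) IH.
have -> : - z ^- 2 * z^-1 ^+ n.+1 + z^-1 * (- n.+1%:R * z^-1 ^+ n.+2) =
  - n.+2%:R * z^-1 ^+ n.+3 by rewrite -exprVn !exprS -natr1; ring.
exact.
Qed.

End ComplexAnalysis.

Section CauchyTaylor.
Variable R : realType.
Local Notation C := (R[i]).
Local Notation Co := (R[i]^o).
Implicit Types (f g F : C -> C) (z w a b l c : C) (t u e d : R).

Local Notation normc := (@ComplexField.Normc.normc R).

Let realM2 t : (2 * t)%:C%C = 2 * t%:C%C :> C.
Proof. by rewrite rmorphM /= rmorph_nat. Qed.

Let inv_edge (s y : R) : 0 < s -> Complex 1 y != 0 ->
  (s%:C%C * Complex 1 y)^-1 - (3 / 4 * s^-1)%:C%C =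
  (4 * s)^-1%:C%C * (Complex 1 (- 3 * y) / Complex 1 y).
Proof.
move=> s0 y0; have sc0 : (s%:C%C : C) != 0 by rewrite -normc_gt0 normc_real gtr0_norm.
have -> : Complex 1 (- 3 * y) = 4%:R - 3%:R * Complex 1 y.
  by apply/eqP; rewrite eq_complex /=; apply/andP; split; apply/eqP; ring.
rewrite !rmorphM /= !fmorphV /= rmorphM /= !rmorph_nat.
by field; rewrite sc0 y0.
Qed.

Section Cauchy.
Variables (r : R) (f : C -> C).
Hypotheses (r0 : 0 < r) (Hf : forall w, normc w < r -> cdiff f w).

Let s := r / 2.
Let j : C := Complex 0 1.

Let jj : j * j = -1.
Proof. by apply/eqP; rewrite eq_complex /=; apply/andP; split; apply/eqP; ring. Qed.

Let j0 : j != 0.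
Proof. by rewrite eq_complex /= negb_and oner_eq0 orbT. Qed.

Let normj : normc j = 1.
Proof. by rewrite /= expr0n expr1n add0r sqrtr1. Qed.

Let normjX k : normc (j ^+ k) = 1.
Proof. by elim: k => [|k IH]; rewrite ?normc1 // exprS normcM normj IH mulr1. Qed.

Definition vertex k : C := s%:C%C * (j ^+ k * (1 - j)).

Let vertexS k : vertex k.+1 = j * vertex k.
Proof. by rewrite /vertex exprS; ring. Qed.

Let vertex4 k : vertex (4 + k) = vertex k.
Proof.
rewrite /vertex exprD; have -> : j ^+ 4 = 1 by rewrite !exprS expr0 mulr1 !(jj, mulrA) mulN1r mulNr jj opprK.
by rewrite mul1r.
Qed.

Let vertex_norm k : normc (vertex k) <= 3 / 4 * r.
Proof.
have rp := r0; rewrite !normcM normc_real normjX mul1r ger0_norm; last by rewrite /s; lra.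
have : normc (1 - j) <= 3 / 2.
  rewrite /= subr0 expr1n sub0r sqrrN expr1n -[3 / 2]ger0_norm; last lra.
  by rewrite -sqrtr_sqr ler_wsqrtr //; lra.
by rewrite /s; have := r0; nra.
Qed.

(* The signed distance to the line through [0] parallel to edge [k]. *)
Let height k (w : C) : R := complex.Re ((j ^+ k)^-1 * w).

Let heightB k w z : height k (w - z) = height k w - height k z.
Proof. by rewrite /height mulrBr raddfB. Qed.

Let height_le k w : `|height k w| <= normc w.
Proof. by apply: le_trans (normc_Re _) _; rewrite normcM normcV normjX invr1 mul1r. Qed.

Let jk0 k : j ^+ k != 0. Proof. by rewrite expf_neq0. Qed.

Let height_vertex k : height k (vertex k) = s /\ height k (vertex k.+1) = s.
Proof.
rewrite vertexS /height /vertex.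
have -> : (j ^+ k)^-1 * (s%:C%C * (j ^+ k * (1 - j))) = s%:C%C * (1 - j) by field.
have -> : (j ^+ k)^-1 * (j * (s%:C%C * (j ^+ k * (1 - j)))) = s%:C%C * (j - j * j).
  by field.
by rewrite jj opprK /=; split; ring.
Qed.

Definition on_square (w : C) := exists k t, unit_itv t /\ w = seg (vertex k) (vertex k.+1) t.

Let slab k (eta : R) z w := normc w <= 3 / 4 * r /\ eta <= height k (w - z).

Let slab_cc k eta z : closed_convex (slab k eta z).
Proof. by apply: closed_convex_slab; rewrite normcV normjX invr1. Qed.

Let on_square_bounds w : on_square w -> [/\ normc w <= 3 / 4 * r, s <= normc w &
  forall z, s - normc z <= normc (w - z)].
Proof.
move=> [k [t [t01 ->]]].
have [h1 h2] := height_vertex k.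
have [b1 b2] : slab k s 0 (seg (vertex k) (vertex k.+1) t).
  by apply: (slab_cc k s 0).1 => //; split; rewrite ?vertex_norm // subr0 ?h1 ?h2.
split=> // [|z].
  by apply: le_trans b2 _; rewrite subr0; apply: le_trans (ler_norm _) (height_le _ _).
apply: le_trans (height_le k _); apply: le_trans (ler_norm _).
have := height_le k z; rewrite heightB ler_norml => /andP[_ h].
by rewrite subr0 in b2; lra.
Qed.

Lemma on_square_neq0 w : on_square w -> w != 0.
Proof.
have rp := r0; case/on_square_bounds => _ h _; rewrite -normc_gt0.
by apply: lt_le_trans h; rewrite /s; lra.
Qed.

Lemma on_square_neq w z : normc z < s -> on_square w -> w - z != 0.
Proof.
by move=> zs /on_square_bounds[_ _ /(_ z) h]; rewrite -normc_gt0; apply: lt_le_trans h; lra.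
Qed.

Lemma on_square_cdiff w : on_square w -> cdiff f w.
Proof. by have rp := r0; case/on_square_bounds => h _ _; apply: Hf; lra. Qed.

Definition square_int (g : C -> C) : C := \sum_(k < 4) lint g (vertex k) (vertex k.+1).

Let square_cont (g : C -> C) := forall w, on_square w -> ccont g w.

Let square_seg g k : square_cont g -> seg_cont g (vertex k) (vertex k.+1).
Proof. by move=> gc t t01; apply: gc; exists k, t. Qed.

Let square_intB g h : square_cont g -> square_cont h ->
  square_int (fun w => g w - h w) = square_int g - square_int h.
Proof.
by move=> gc hc; rewrite /square_int -sumrB; apply: eq_bigr => k _; rewrite lintB //; apply: square_seg.
Qed.

Let square_intZ g c : square_cont g -> square_int (fun w => c * g w) = c * square_int g.
Proof.
by move=> gc; rewrite /square_int mulr_sumr; apply: eq_bigr => k _; rewrite lintZ //; apply: square_seg.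
Qed.

Let square_int_ext g h : (forall w, on_square w -> g w = h w) -> square_cont h ->
  square_int g = square_int h.
Proof.
move=> gh hc; apply: eq_bigr => k _; apply: lint_ext; last exact: square_seg.
by move=> t t01; apply: gh; exists k, t.
Qed.

Let square_int_le g M : 0 <= M -> square_cont g -> (forall w, on_square w -> normc (g w) <= M) ->
  normc (square_int g) <= 6 * M * r.
Proof.
move=> M0 gc gM; have edge k : normc (lint g (vertex k) (vertex k.+1)) <= M * (3 / 2 * r).
  apply: le_trans (lint_le (square_seg _ gc) (M := M) _) _.
    by move=> t t01; apply: gM; exists k, t.
  apply: ler_wpM2l => //; apply: le_trans (normcD _ _) _; rewrite normcN.
  have := vertex_norm k; have := vertex_norm k.+1; lra.
rewrite /square_int !big_ord_recl big_ord0 /= addr0.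
apply: le_trans (normcD _ _) _; apply: le_trans (lerD (lexx _) (normcD _ _)) _.
apply: le_trans (lerD (lexx _) (lerD (lexx _) (normcD _ _))) _.
have := edge 0%N; have := edge 1%N; have := edge 2%N; have := edge 3%N.
rewrite /bump /= !add1n; lra.
Qed.

(** Shrinking the square towards [z] does not change the integral of
    [f w / (w - z)]: each quadrilateral between corresponding edges is the union
    of two triangles inside a half plane that avoids [z]. *)
Let square_shrink z e : normc z < s -> 0 < e <= 1 ->
  square_int (fun w => f w / (w - z)) =
  square_int (fun w => f (z + e%:C%C * (w - z)) / (w - z)).
Proof.
have rp := r0; move=> zs /andP[e0 e1]; pose g w := f w / (w - z); pose v' k := z + e%:C%C * (vertex k - z).
pose ray k := lint g (v' k) (vertex k).
have zn := normc_ge0 z.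
have hgt k w : height k w = s -> s - normc z <= height k (w - z).
  by move=> h; have := height_le k z; rewrite heightB ler_norml => /andP[_ h']; lra.
have edge k : lint g (vertex k) (vertex k.+1) =
    lint g (v' k) (v' k.+1) + (ray k.+1 - ray k).
  pose K := slab k (e * (s - normc z)) z.
  have HK : closed_convex K := slab_cc k _ z.
  have Hg w : K w -> cdiff g w.
    move=> [h1 h2]; have wz : w - z != 0.
      apply: contraTneq h2 => ->; rewrite /height mulr0 raddf0 -ltNge mulr_gt0 //; lra.
    apply: cdiffM; first by apply: Hf; lra.
    by apply: cdiffV => //; apply: cdiffD; [apply: cdiff_id|apply: cdiff_cst].
  have Kv w : normc w <= 3 / 4 * r -> height k w = s -> K w.
    move=> h1 h2; split=> //; have := hgt k w h2; have := zs; nra.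
  have Kv' w : normc w <= 3 / 4 * r -> height k w = s -> K (z + e%:C%C * (w - z)).
    move=> h1 h2; split.
      have -> : z + e%:C%C * (w - z) = (1 - e)%:C%C * z + e%:C%C * w.
        by rewrite rmorphB rmorph1; ring.
      apply: le_trans (normcD _ _) _; rewrite !normcM !normc_real !ger0_norm //; [|lra|lra].
      have : normc z <= 3 / 4 * r by rewrite /s in zs; lra.
      by move=> h3; nra.
    have -> : height k (z + e%:C%C * (w - z) - z) = e * height k (w - z).
      have -> : z + e%:C%C * (w - z) - z = e%:C%C * (w - z) by ring.
      by rewrite /height mulrCA; case: (_ * (w - z)) => x y /=; rewrite mul0r subr0.
    by have := hgt k w h2; nra.
  have [h1 h2] := height_vertex k.
  have Ka := Kv _ (vertex_norm k) h1; have Kb := Kv _ (vertex_norm k.+1) h2.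
  have Ka' := Kv' _ (vertex_norm k) h1; have Kb' := Kv' _ (vertex_norm k.+1) h2.
  have cont := @convex_seg_cont R K g HK Hg.
  have := goursat HK Hg Ka' Ka Kb; have := goursat HK Hg Ka' Kb Kb'.
  rewrite /tint -/(v' k) -/(v' k.+1) (lint_rev (cont _ _ Ka' Kb)).
  rewrite (lint_rev (cont _ _ Kb' Kb)) (lint_rev (cont _ _ Ka' Kb')).
  rewrite /ray => E1 E2; have := congr2 +%R E1 E2; rewrite addr0 => E3.
  by apply/eqP; rewrite -subr_eq0 -E3; apply/eqP; ring.
have scale k : lint g (v' k) (v' k.+1) =
    lint (fun w => f (z + e%:C%C * (w - z)) / (w - z)) (vertex k) (vertex k.+1).
  have vE i : v' i = e%:C%C * vertex i + (z - e%:C%C * z) by rewrite /v'; ring.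
  have e0' : e%:C%C != 0 :> C by rewrite -normc_gt0 normc_real gtr0_norm.
  have zs0 : 0 < s - normc z by lra.
  have fc : seg_cont (fun w => f (z + e%:C%C * (w - z)) / (w - z)) (vertex k) (vertex k.+1).
    move=> t t01; apply: ccontM.
      apply: (@ccont_comp R (fun w => z + e%:C%C * (w - z)) f).
        apply: ccontD; first exact: ccont_cst.
        apply: ccontM; first exact: ccont_cst.
        by apply: ccontD; [apply: ccont_id|apply: ccont_cst].
      apply/cdiff_cont/Hf; have [h _ _] := on_square_bounds (ex_intro _ k (ex_intro _ t (conj t01 erefl))).
      set w := seg _ _ _ in h *.
      have -> : z + e%:C%C * (w - z) = (1 - e)%:C%C * z + e%:C%C * w.
        by rewrite rmorphB rmorph1; ring.
      apply: le_lt_trans (normcD _ _) _; rewrite !normcM !normc_real !ger0_norm //; [|lra|lra].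
      have : normc z <= 3 / 4 * r by rewrite /s in zs; lra.
      by move=> h3; nra.
    apply: (@ccont_comp R (fun w => w - z) (fun w => w^-1)).
      by apply: ccontD; [apply: ccont_id|apply: ccont_cst].
    by apply/ccontV/on_square_neq => //; exists k, t.
  rewrite !vE lint_affine -lintZ; last first.
    have -> : (fun w => g (e%:C%C * w + (z - e%:C%C * z))) =
        fun w => e%:C%C^-1 * (f (z + e%:C%C * (w - z)) / (w - z)).
      apply/funext => w; rewrite /g.
      have -> : e%:C%C * w + (z - e%:C%C * z) = z + e%:C%C * (w - z) by ring.
      by rewrite addrAC subrr add0r invfM mulrCA.
    by move=> t t01; apply: ccontM; [apply: ccont_cst|apply: fc].
  apply: lint_ext => // t t01; rewrite /g.
  set w := seg _ _ _.
  have -> : e%:C%C * w + (z - e%:C%C * z) = z + e%:C%C * (w - z) by ring.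
  have -> : z + e%:C%C * (w - z) - z = e%:C%C * (w - z) by ring.
  by rewrite invfM mulrCA mulVKf.
rewrite /square_int; under eq_bigr do rewrite edge scale.
rewrite big_split /= -(big_mkord xpredT (fun k => ray k.+1 - ray k)) telescope_sumr //.
have -> : ray 4%N = ray 0%N by rewrite /ray /v' -[4%N]addn0 vertex4.
by rewrite subrr addr0.
Qed.

Let square_contV z : normc z < s -> square_cont (fun w => (w - z)^-1).
Proof.
move=> zs w ow; apply: (@ccont_comp R (fun w => w - z) (fun w => w^-1)).
  by apply: ccontD; [apply: ccont_id|apply: ccont_cst].
exact/ccontV/on_square_neq.
Qed.

Let square_contX k : square_cont (fun w => w^-1 ^+ k).
Proof.
move=> w ow; have w0 := on_square_neq0 ow; case: k => [|k].
  have -> : (fun w : C => w^-1 ^+ 0) = fun _ => 1 by apply/funext => w'; rewrite expr0.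
  exact: ccont_cst.
exact: cderiv_cont (cderiv_invX k w0).
Qed.

Let square_contM g h : square_cont g -> square_cont h -> square_cont (fun w => g w * h w).
Proof. by move=> gc hc w ow; apply: ccontM; [apply: gc|apply: hc]. Qed.

Let square_contC c : square_cont (fun _ => c).
Proof. by move=> w _; apply: ccont_cst. Qed.

(* Letting the square shrink to the point [z]. *)
Lemma cauchy_formula z : normc z < s ->
  square_int (fun w => f w * (w - z)^-1) = f z * square_int (fun w => (w - z)^-1).
Proof.
have rp := r0; move=> zs; have zn := normc_ge0 z.
have zs0 : 0 < s - normc z by lra.
have fz : ccont f z by apply/cdiff_cont/Hf; rewrite /s in zs; lra.
apply/eqP; rewrite -subr_eq0 -normc_eq0 eq_le normc_ge0 andbT leNgt; apply/negP => h.
set N := normc _ in h.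
pose eta := N * (s - normc z) / (12 * r).
have eta0 : 0 < eta by rewrite /eta divr_gt0 ?mulr_gt0 //; lra.
have [d d0 Hd] := fz eta eta0.
pose e := Num.min 1 (d / (2 * r)).
have e0 : 0 < e by rewrite lt_min ltr01 divr_gt0 // mulr_gt0.
have e1 : e <= 1 by rewrite ge_min lexx.
have e2 : e * (2 * r) <= d by rewrite -ler_pdivlMr ?mulr_gt0 // ge_min lexx orbT.
have := square_shrink zs (e := e); rewrite e0 e1 => /(_ isT) E.
pose g w := f (z + e%:C%C * (w - z)).
have gd w : on_square w -> normc (g w - f z) < eta.
  move=> ow; apply: Hd; have [h1 _ _] := on_square_bounds ow.
  have -> : z + e%:C%C * (w - z) - z = e%:C%C * (w - z) by ring.
  rewrite normcM normc_real gtr0_norm //; apply: lt_le_trans e2.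
  rewrite ltr_pM2l //; apply: le_lt_trans (normcD _ _) _; rewrite normcN.
  by rewrite /s in zs; lra.
have gc : square_cont g.
  move=> w ow; apply: (@ccont_comp R (fun w => z + e%:C%C * (w - z)) f).
    apply: ccontD; first exact: ccont_cst.
    apply: ccontM; first exact: ccont_cst.
    by apply: ccontD; [apply: ccont_id|apply: ccont_cst].
  apply/cdiff_cont/Hf; have [h1 _ _] := on_square_bounds ow.
  have -> : z + e%:C%C * (w - z) = (1 - e)%:C%C * z + e%:C%C * w.
    by rewrite rmorphB rmorph1; ring.
  apply: le_lt_trans (normcD _ _) _; rewrite !normcM !normc_real !ger0_norm //; [|lra|lra].
  have : normc z <= 3 / 4 * r by rewrite /s in zs; lra.
  by move=> h3; nra.
have c1 := square_contM gc (square_contV zs).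
have c2 := square_contM (square_contC (f z)) (square_contV zs).
have : N <= 6 * (eta / (s - normc z)) * r.
  rewrite /N E -square_intZ; last exact: square_contV.
  rewrite -square_intB //; apply: square_int_le.
  - by rewrite divr_ge0 ?ltW.
  - have -> : (fun w => f (z + e%:C%C * (w - z)) / (w - z) - f z * (w - z)^-1) =
       fun w => g w * (w - z)^-1 + (-1) * (f z * (w - z)^-1).
      by apply/funext => w; rewrite mulN1r.
    by move=> w ow; apply: ccontD; [apply: c1|apply: ccontM; [apply: ccont_cst|apply: c2]].
  move=> w ow; rewrite -mulrBl normcM normcV.
  have [_ _ /(_ z) h3] := on_square_bounds ow.
  apply: ler_pM; [exact: normc_ge0|by rewrite invr_ge0 normc_ge0|exact/ltW/gd|].
  by rewrite lef_pV2 ?posrE //; lra.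
have -> : 6 * (eta / (s - normc z)) * r = N / 2 by rewrite /eta; field; lra.
lra.
Qed.

(** The finite geometric series for [1 / (w - z)] in powers of [z / w]. *)
Lemma square_int_kernel (g : C -> C) K z : normc z < s -> square_cont g ->
  square_int (fun w => g w * (w - z)^-1) =
    \sum_(k < K) z ^+ k * square_int (fun w => g w * w^-1 ^+ k.+1) +
    square_int (fun w => z ^+ K * (g w * w^-1 ^+ K * (w - z)^-1)).
Proof.
move=> zs gc; have cV := square_contV zs; elim: K => [|K IH].
  rewrite big_ord0 add0r; apply: square_int_ext.
    by move=> w _; rewrite !expr0 mul1r mulr1.
  apply: square_contM; first exact: square_contC.
  by apply: square_contM => //; apply: square_contM => //; apply: square_contX.
rewrite IH big_ord_recr /= -addrA; congr (_ + _).
have gX k : square_cont (fun w => g w * w^-1 ^+ k) by apply: square_contM => //; apply: square_contX.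
have c1 := square_contM (gX K) cV; have c2 := square_contM (gX K.+1) cV.
rewrite !square_intZ //; rewrite exprS -mulrA mulrCA -mulrDr; congr (_ * _).
rewrite -square_intZ //.
apply/eqP; rewrite -subr_eq -square_intB //; last first.
  by apply: square_contM => //; apply: square_contC.
apply/eqP/square_int_ext => // w ow; have w0 := on_square_neq0 ow.
have wz := on_square_neq zs ow.
by rewrite exprS; field; rewrite w0 wz.
Qed.

Let square_bounded (g : C -> C) : square_cont g ->
  exists2 M, 0 <= M & forall w, on_square w -> normc (g w) <= M.
Proof.
move=> gc.
have edge k : exists2 M, 0 <= M & forall t, unit_itv t -> normc (g (seg (vertex k) (vertex k.+1) t)) <= M.
  pose h t := normc (g (seg (vertex k) (vertex k.+1) (clamp t))).
  have hc : continuous h.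
    move=> x; apply/(@cvgrPdist_lt R R^o) => e e0; apply/(near_nbhsP (x : R^o)).
    have [d d0 Hd] := square_seg k gc (clamp_itv x) e0.
    have n0 := normc_ge0 (vertex k.+1 - vertex k).
    exists (d / (normc (vertex k.+1 - vertex k) + 1)); first by rewrite divr_gt0 //; lra.
    move=> t; rewrite ltr_pdivlMr; last lra.
    move=> td; have := Hd (seg (vertex k) (vertex k.+1) (clamp t)); rewrite seg_dist => {}Hd.
    have := clamp_lip t x => lip; have {}Hd := Hd ltac:(have := normr_ge0 (clamp t - clamp x); nra).
    rewrite distrC; apply: le_lt_trans Hd; rewrite /h ler_norml.
    set a := g (seg _ _ (clamp t)); set b := g (seg _ _ (clamp x)).
    have := normcD (a - b) b; have := normcD (b - a) a; rewrite !subrK normcB; lra.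
  have [|c _ Hc] := @EVT_max R h 0 1 ler01; first exact: continuous_subspaceT.
  exists (h c); first exact: normc_ge0.
  move=> t t01; have := Hc t; rewrite in_itv /= => /(_ t01).
  by rewrite /h (clamp_id t01).
have [M0 M00 H0] := edge 0%N; have [M1 M10 H1] := edge 1%N.
have [M2 M20 H2] := edge 2%N; have [M3 M30 H3] := edge 3%N.
exists (M0 + M1 + M2 + M3); first lra.
move=> _ [k [t [t01 ->]]]; elim/ltn_ind: k => k IH.
case: k IH => [|[|[|[|k]]]] IH; last by rewrite -[k.+4]/(4 + k)%N -[(4 + k).+1]/(4 + k.+1)%N !vertex4; apply: IH; lia.
- by have := H0 t t01; lra.
- by have := H1 t t01; lra.
- by have := H2 t t01; lra.
- by have := H3 t t01; lra.
Qed.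

Let remainder_le (g : C -> C) M K z : 0 <= M -> normc z <= s / 2 -> square_cont g ->
  (forall w, on_square w -> normc (g w) <= M) ->
  normc (square_int (fun w => z ^+ K * (g w * w^-1 ^+ K * (w - z)^-1))) <=
    24 * M * (normc z / s) ^+ K.
Proof.
have rp := r0; have s0 : 0 < s by rewrite /s; lra.
move=> M0 zs gc gM; have zn := normc_ge0 z; have zs' : normc z < s by lra.
pose B := M * (normc z / s) ^+ K * (2 / s).
have zs1 : 0 <= normc z / s by apply: divr_ge0 => //; apply: ltW.
have B0 : 0 <= B.
  apply: mulr_ge0; first by apply: mulr_ge0 => //; apply: exprn_ge0.
  by apply: divr_ge0 => //; apply: ltW.
have -> : 24 * M * (normc z / s) ^+ K = 6 * B * r.
  have rE : r = 2 * s by rewrite /s; lra.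
  by rewrite /B [in RHS]rE; field; lra.
apply: square_int_le => //.
  apply: square_contM; first exact: square_contC.
  apply: square_contM; last exact: square_contV.
  by apply: square_contM => //; apply: square_contX.
move=> w ow; have [h1 h2 /(_ z) h3] := on_square_bounds ow.
have nX (x : C) k : normc (x ^+ k) = normc x ^+ k.
  by elim: k => [|k IH]; rewrite ?normc1 // !exprS normcM IH.
rewrite !normcM !nX !normcV.
have -> : B = M * normc z ^+ K * s^-1 ^+ K * (2 / s) by rewrite /B expr_div_n exprVn !mulrA.
have i1 : (normc w)^-1 ^+ K <= s^-1 ^+ K.
  by apply: lerXn2r; rewrite ?nnegrE ?invr_ge0 ?normc_ge0 //; [lra|rewrite lef_pV2 ?posrE //; lra].
have i2 : (normc (w - z))^-1 <= 2 / s.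
  have -> : 2 / s = (s / 2)^-1 by rewrite [RHS]invf_div.
  by rewrite lef_pV2 ?posrE //; lra.
rewrite [_ ^+ K * _]mulrA [_ ^+ K * _]mulrA [normc z ^+ K * _]mulrC.
have iw : 0 <= (normc w)^-1 by rewrite invr_ge0 normc_ge0.
have iwz : 0 <= (normc (w - z))^-1 by rewrite invr_ge0 normc_ge0.
apply: ler_pM => //; first by rewrite !mulr_ge0 ?exprn_ge0 ?normc_ge0.
apply: ler_pM => //; first by rewrite mulr_ge0 ?exprn_ge0 ?normc_ge0.
  by rewrite exprn_ge0.
by apply: ler_wpM2r; [rewrite exprn_ge0|apply: gM].
Qed.

Let kernel_int : C := square_int (fun w => w^-1).

Let kernel_cont : square_cont (fun w => w^-1).
Proof. by move=> w ow; apply/ccontV/on_square_neq0. Qed.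

Let kernel_int_edge : kernel_int = 4%:R * lint (fun w => w^-1) (vertex 0) (vertex 1).
Proof.
have rot k : lint (fun w => w^-1) (vertex k.+1) (vertex k.+2) =
    lint (fun w => w^-1) (vertex k) (vertex k.+1).
  transitivity (lint (fun w => w^-1) (j * vertex k + 0) (j * vertex k.+1 + 0)).
    by rewrite !addr0 -!vertexS.
  rewrite lint_affine -lintZ; last first.
    have -> : (fun w => (j * w + 0)^-1) = fun w => j^-1 * w^-1.
      by apply/funext => w; rewrite addr0 invfM.
    by apply: square_seg => w ow; apply: ccontM; [apply: ccont_cst|apply: kernel_cont].
  apply: lint_ext; last exact: square_seg.
  by move=> t _; rewrite addr0 invfM mulVKf.
rewrite /kernel_int /square_int !big_ord_recl big_ord0 /= /bump /= !add1n addr0.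
by rewrite !rot; ring.
Qed.

(* On the edge from [s (1 - i)] to [s (1 + i)] the function [1 / w] differs by
   at most [5 / (8 s)] from the constant [3 / (4 s)]. *)
Let kernel_int_neq0 : kernel_int != 0.
Proof.
have rp := r0; have s0 : 0 < s by rewrite /s; lra.
rewrite kernel_int_edge mulf_neq0 ?pnatr_eq0 //.
pose c : C := (3 / 4 * s^-1)%:C%C.
have v1 : vertex 1 - vertex 0 = (2 * s)%:C%C * j.
  rewrite vertexS /vertex expr0 mul1r.
  have -> : j * (s%:C%C * (1 - j)) - s%:C%C * (1 - j) = s%:C%C * (2%:R * j - j * j - 1) by ring.
  by rewrite jj opprK addrK realM2; ring.
have cc : square_cont (fun w => w^-1 - c).
  by move=> w ow; apply: ccontD; [apply: kernel_cont|apply: ccont_cst].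
have lc : lint (fun _ => c) (vertex 0) (vertex 1) = (3 / 2)%:C%C * j.
  rewrite (@lint_FTC _ _ (fun w => c * w)).
    rewrite -mulrBr v1 mulrA -rmorphM /=; congr (_%:C%C * _); field; lra.
  move=> t _; have := cderivM (cderiv_cst c (seg (vertex 0) (vertex 1) t)) (cderiv_id _).
  by rewrite mul0r add0r mulr1.
have : normc (lint (fun w => w^-1) (vertex 0) (vertex 1) - (3 / 2)%:C%C * j) <= 5 / 4.
  rewrite -lc -lintB; [|exact: square_seg|by move=> t _; apply: ccont_cst].
  have -> : 5 / 4 = 5 / (8 * s) * (2 * s) by field; lra.
  have -> : 2 * s = normc (vertex 1 - vertex 0).
    by rewrite v1 normcM normj mulr1 normc_real ger0_norm //; lra.
  apply: lint_le; first exact: square_seg.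
  move=> t /andP[t0 t1]; pose y := 2 * t - 1; set w := seg _ _ _.
  have wE : w = s%:C%C * (Complex 1 y).
    rewrite /w /seg v1 /vertex expr0 mul1r /y.
    by apply/eqP; rewrite eq_complex /=; apply/andP; split; apply/eqP; ring.
  have w0 : w != 0 by apply: on_square_neq0; exists 0%N, t; split=> //; rewrite /unit_itv t0.
  have y0 : Complex 1 y != 0 by move: w0; rewrite wE mulf_eq0 negb_or => /andP[].
  rewrite wE inv_edge //.
  rewrite normcM normc_real ger0_norm ?invr_ge0; last lra.
  have -> : 5 / (8 * s) = (4 * s)^-1 * (5 / 2) by field; lra.
  apply: ler_wpM2l; first by rewrite invr_ge0; lra.
  rewrite normcM normcV ler_pdivrMr ?normc_gt0 //= -[5 / 2]ger0_norm; last lra.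
  rewrite -sqrtr_sqr -sqrtrM ?sqr_ge0 //; apply: ler_wsqrtr.
  have y1 : y ^+ 2 <= 1 by rewrite /y; nra.
  rewrite exprMn sqrrN; nra.
apply: contraTneq => ->; rewrite sub0r normcN normcM normj mulr1 normc_real.
by rewrite -ltNge ger0_norm; lra.
Qed.

Let power_int k : square_int (fun w => w^-1 ^+ k.+2) = 0.
Proof.
have k0 : (k.+1%:R : C) != 0 by rewrite pnatr_eq0.
pose F (w : C) : C := - k.+1%:R^-1 * w^-1 ^+ k.+1.
have E i : lint (fun w => w^-1 ^+ k.+2) (vertex i) (vertex i.+1) = F (vertex i.+1) - F (vertex i).
  apply: lint_FTC => t t01.
  have w0 : seg (vertex i) (vertex i.+1) t != 0 by apply: on_square_neq0; exists i, t.
  have := cderivM (cderiv_cst (- k.+1%:R^-1) (seg (vertex i) (vertex i.+1) t)) (cderiv_invX k w0).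
  by rewrite mul0r add0r mulrA mulrNN mulVf // mul1r.
rewrite /square_int; under eq_bigr do rewrite E.
rewrite -(big_mkord xpredT (fun i => F (vertex i.+1) - F (vertex i))) telescope_sumr //.
by rewrite -[4%N]addn0 vertex4 subrr.
Qed.

Let square_int_cauchy z : normc z <= s / 2 -> square_int (fun w => (w - z)^-1) = kernel_int.
Proof.
have rp := r0; have s0 : 0 < s by rewrite /s; lra.
move=> zs; have zn := normc_ge0 z; have zs' : normc z < s by lra.
apply/eqP; rewrite -subr_eq0 -normc_eq0 eq_le normc_ge0 andbT leNgt; apply/negP => h.
have [K HK] := small_pow2 24 h.
move: HK; apply/negP; rewrite -leNgt.
have c1 := square_contC 1.
have -> : square_int (fun w => (w - z)^-1) - kernel_int =
   square_int (fun w => z ^+ K.+1 * (1 * w^-1 ^+ K.+1 * (w - z)^-1)).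
  have -> : square_int (fun w => (w - z)^-1) = square_int (fun w => 1 * (w - z)^-1).
    apply: square_int_ext => [w _|]; first by rewrite mul1r.
    by apply: square_contM => //; apply: square_contV.
  rewrite (square_int_kernel K.+1 zs' c1) big_ord_recl /= expr0 mul1r big1 => [|k _].
    rewrite addr0; have -> : square_int (fun w => 1 * w^-1 ^+ 1) = kernel_int.
      by apply: square_int_ext => [w _|]; rewrite ?mul1r.
    by rewrite addrAC subrr add0r.
  rewrite (_ : square_int _ = 0) ?mulr0 // -(power_int k).
  by apply: square_int_ext => [w _|]; [rewrite mul1r|apply: square_contX].
apply: le_trans (remainder_le K.+1 ler01 zs c1 _) _; first by move=> w _; rewrite normc1.
rewrite mulr1 -[24 / _]/(24 * _); apply: ler_wpM2l; first lra.
have h1 : normc z / s <= 2^-1 by rewrite ler_pdivrMr //; lra.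
have h2 : 0 <= normc z / s by apply: divr_ge0 => //; apply: ltW.
rewrite -exprVn exprS; apply: (@le_trans _ _ (1 * 2^-1 ^+ K)); last by rewrite mul1r.
apply: ler_pM => //; [exact: exprn_ge0|lra|].
by apply: lerXn2r => //; rewrite nnegrE; lra.
Qed.

(** Expanding the Cauchy kernel as a geometric series in [z / w] under the
    integral sign gives the Taylor polynomials with a geometric remainder. *)
Theorem taylor_at0 : exists (coef : nat -> C) (M : R), 0 <= M /\ forall (K : nat) z, normc z <= r / 4 ->
    normc (f z - \sum_(k < K) coef k * z ^+ k) <= M * (2 * normc z / r) ^+ K.
Proof.
have rp := r0; have s0 : 0 < s by rewrite /s; lra.
have fc : square_cont f by move=> w ow; apply/cdiff_cont/on_square_cdiff.
have [M M0 HM] := square_bounded fc.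
exists (fun k => square_int (fun w => f w * w^-1 ^+ k.+1) / kernel_int), (24 * M / normc kernel_int).
have W0 := kernel_int_neq0; have nW : 0 < normc kernel_int by rewrite normc_gt0.
split=> [|K z zr]; first by rewrite divr_ge0 ?normc_ge0 //; lra.
have zs : normc z <= s / 2 by rewrite /s; lra.
have zs' : normc z < s by have := normc_ge0 z; lra.
have := square_int_kernel K zs' fc; rewrite cauchy_formula // square_int_cauchy // => E.
have -> : f z - \sum_(k < K) square_int (fun w => f w * w^-1 ^+ k.+1) / kernel_int * z ^+ k =
   square_int (fun w => z ^+ K * (f w * w^-1 ^+ K * (w - z)^-1)) / kernel_int.
  apply: (mulIf W0); rewrite mulrBl divfK // E mulr_suml [X in X + _ - _](_ : _ =
     \sum_(k < K) square_int (fun w => f w * w^-1 ^+ k.+1) / kernel_int * z ^+ k * kernel_int).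
    by rewrite addrAC subrr add0r.
  by apply: eq_bigr => k _; rewrite mulrAC divfK // mulrC.
rewrite normcM normcV ler_pdivrMr // mulrAC divfK ?gt_eqF //.
have -> : 2 * normc z / r = normc z / s by rewrite /s; field; lra.
exact: remainder_le.
Qed.

End Cauchy.

End CauchyTaylor.

(** * Taylor expansions and poles *)

Section LocalAnalysis.
Variable R : realType.
Local Notation C := (R[i]).
Local Notation Co := (R[i]^o).
Implicit Types (f g b S : C -> C) (z w c : C) (t e d D M : R).

Local Notation normc := (@ComplexField.Normc.normc R).

Lemma normcX z (k : nat) : normc (z ^+ k) = normc z ^+ k.
Proof. by elim: k => [|k IH]; rewrite ?normc1 // !exprS normcM IH. Qed.

Lemma normc_sum (I : Type) (s : seq I) (P : pred I) (F : I -> C) :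
  normc (\sum_(i <- s | P i) F i) <= \sum_(i <- s | P i) normc (F i).
Proof.
elim/big_rec2: _ => [|i x y _ h]; first by rewrite normc0.
by apply: le_trans (normcD _ _) _; rewrite lerD2l.
Qed.

(** A quantitative form of analyticity at the origin that survives removing a
    singularity and is all that the kernel estimates use. *)
Definition taylor f r (s : nat -> C) M := [/\ 0 < r, 0 <= M &
  forall (K : nat) z, normc z <= r ->
    normc (f z - \sum_(k < K) s k * z ^+ k) <= M * (normc z / (2 * r)) ^+ K].

Lemma taylor_disc f r : 0 < r -> (forall w, normc w < r -> cdiff f w) ->
  exists s M, taylor f (r / 4) s M.
Proof.
move=> r0 Hf; have [s [M [M0 H]]] := taylor_at0 r0 Hf.
exists s, M; split=> // [|K z zr]; first lra.
have -> : normc z / (2 * (r / 4)) = 2 * normc z / r by field; lra.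
exact: H.
Qed.

(** Evaluating at small real points isolates the lowest nonzero coefficient. *)
Lemma poly_bigO n (c : nat -> C) D d : 0 < d ->
  (forall z, z != 0 -> normc z < d ->
     normc (\sum_(k < n) c k * z ^+ k) <= D * normc z ^+ n) ->
  forall k, (k < n)%N -> c k = 0.
Proof.
move=> d0 H; elim/ltn_ind => k IH kn.
pose B := `|D| + \sum_(i < n) normc (c i).
have B0 : 0 <= B by rewrite addr_ge0 // sumr_ge0 // => i _; apply: normc_ge0.
have key t : 0 < t -> t < d -> t <= 1 -> normc (c k) <= B * t.
  move=> t0 td t1; have nt : normc t%:C%C = t by rewrite normc_real gtr0_norm.
  have := H t%:C%C; rewrite -normc_gt0 nt => /(_ t0 td).
  rewrite (bigD1 (Ordinal kn)) //=; set X := \sum_(i < n | _) _ => h.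
  have tk : 0 < t ^+ k by apply: exprn_gt0.
  have hX : normc X <= (\sum_(i < n) normc (c i)) * t ^+ k.+1.
    apply: le_trans (normc_sum _ _ _) _; rewrite mulr_suml.
    rewrite [leRHS](bigID (fun i => i != Ordinal kn)) /=.
    apply: ler_wpDr; first by rewrite sumr_ge0 // => i _; rewrite mulr_ge0 ?normc_ge0 // exprn_ge0 // ltW.
    apply: ler_sum => i ik; rewrite normcM normcX nt.
    have [ltik|] := ltnP i k; first by rewrite IH ?normc0 ?mul0r // ltn_ord.
    rewrite leq_eqVlt => /orP[/eqP ki|ltki].
      by move: ik; rewrite -val_eqE /= -ki eqxx.
    apply: ler_wpM2l; first exact: normc_ge0.
    by apply: ler_wiXn2l => //; apply: ltW.
  rewrite -(ler_pM2r tk) -mulrA -exprS mulrDl.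
  have -> : normc (c k) * t ^+ k = normc (c k * t%:C%C ^+ k) by rewrite normcM normcX nt.
  have hD : D * t ^+ n <= `|D| * t ^+ k.+1.
    apply: le_trans (_ : `|D| * t ^+ n <= _).
      by apply: ler_wpM2r; [apply: exprn_ge0; apply: ltW|apply: ler_norm].
    by apply: ler_wpM2l => //; apply: ler_wiXn2l => //; apply: ltW.
  have -> : c k * t%:C%C ^+ k = c k * t%:C%C ^+ k + X - X by rewrite addrK.
  apply: le_trans (normcD _ _) _; rewrite normcN; lra.
apply/eqP; rewrite -normc_eq0 eq_le normc_ge0 andbT leNgt; apply/negP => ck.
pose t := Num.min (d / 2) (Num.min 1 (normc (c k) / (2 * (B + 1)))).
have q0 : 0 < normc (c k) / (2 * (B + 1)) by rewrite divr_gt0 // mulr_gt0 //; lra.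
have t0 : 0 < t by rewrite !lt_min ltr01 q0 divr_gt0.
have t1 : t <= d / 2 by rewrite /t ge_min lexx.
have t2 : t <= 1 by rewrite /t !ge_min lexx !orbT.
have t3 : t * (2 * (B + 1)) <= normc (c k).
  by rewrite -ler_pdivlMr ?mulr_gt0 //; [rewrite /t !ge_min lexx !orbT|lra].
have td : t < d by lra.
by have := key t t0 td t2; nra.
Qed.

Lemma taylor_eq f r s M n (a : nat -> C) D d : taylor f r s M -> 0 < d ->
  (forall z, z != 0 -> normc z < d ->
     normc (f z - \sum_(k < n) a k * z ^+ k) <= D * normc z ^+ n) ->
  forall k, (k < n)%N -> s k = a k.
Proof.
move=> [r0 M0 H] d0 Ha k kn; apply/eqP; rewrite -subr_eq0; apply/eqP.
apply: (@poly_bigO n (fun k => s k - a k) (M / (2 * r) ^+ n + D) (Num.min d r)) kn => [|z z0].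
  by rewrite lt_min d0.
rewrite lt_min => /andP[zd zr].
have -> : \sum_(k < n) (s k - a k) * z ^+ k =
   (f z - \sum_(k < n) a k * z ^+ k) - (f z - \sum_(k < n) s k * z ^+ k).
  rewrite opprB addrC addrA subrK; under eq_bigr do rewrite mulrBl.
  by rewrite sumrB.
apply: le_trans (normcD _ _) _; rewrite normcN mulrDl addrC; apply: lerD; last exact: Ha.
by apply: le_trans (H n z (ltW zr)) _; rewrite expr_div_n mulrA mulrAC.
Qed.

Lemma taylor_null f r s M : taylor f r s M -> (forall k, s k = 0) ->
  forall z, normc z <= r -> f z = 0.
Proof.
move=> [r0 M0 H] s0 z zr.
apply/eqP; rewrite -normc_eq0 eq_le normc_ge0 andbT leNgt; apply/negP => h.
have [K HK] := small_pow2 M h; move: HK; apply/negP; rewrite -leNgt.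
have := H K z zr; rewrite big1 ?subr0 => [h1|i _]; last by rewrite s0 mul0r.
apply: le_trans h1 _; apply: ler_wpM2l => //; rewrite -exprVn.
have n0 := normc_ge0 z.
apply: lerXn2r; rewrite ?nnegrE ?invr_ge0 ?divr_ge0 //; [lra|].
by rewrite ler_pdivrMr; lra.
Qed.

Lemma taylor_zero f r s M d : taylor f r s M -> 0 < d ->
  (forall z, z != 0 -> normc z < d -> f z = 0) -> forall z, normc z <= r -> f z = 0.
Proof.
move=> T d0 f0; apply: (taylor_null T) => k.
apply: (taylor_eq (n := k.+1) (a := fun _ => 0) (D := 0) T d0) (ltnSn k) => z z0 zd.
by rewrite f0 // big1 ?subrr ?normc0 ?mul0r // => i _; rewrite mul0r.
Qed.

Lemma holomorphic_atP S c : holomorphic_at S c <->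
  exists2 r, 0 < r & forall w, normc (w - c) < r -> cdiff S w.
Proof.
apply: iff_trans (nearC c _) _.
by split=> -[r r0 H]; exists r => // w wr; apply/(derivable_cdiffP S)/H.
Qed.

Lemma poleP S c : pole S c <->
  (exists2 r, 0 < r & forall w, w != c -> normc (w - c) < r -> cdiff S w) /\
  (forall M, exists2 r, 0 < r & forall w, w != c -> normc (w - c) < r -> M < normc (S w)).
Proof.
split=> -[h1 h2]; split.
- by have /nearC'[r r0 H] := h1; exists r => // w wc wr; apply/(derivable_cdiffP S)/H.
- move=> M; have /nearC'[r r0 H] := h2 M; exists r => // w wc wr.
  by have h : (M%:C%C : C) < `|S w : C| := H w wc wr; rewrite norm_normc ltcR in h.
- have [r r0 H] := h1; apply/nearC'; exists r => // w wc wr; exact/(derivable_cdiffP S)/H.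
- move=> M; have [r r0 H] := h2 M; apply/nearC'; exists r => // w wc wr.
  have h : (M%:C%C : C) < `|S w : C| by rewrite norm_normc ltcR; apply: H.
  exact: h.
Qed.

Lemma cdiff_shift f c z : cdiff f (c + z) -> cdiff (fun w => f (c + w)) z.
Proof.
move=> h; apply: (@cdiff_comp _ (fun w => c + w) f) => //.
by apply: cdiffD; [apply: cdiff_cst|apply: cdiff_id].
Qed.

(** Multiplying by [z ^ 2] makes the reciprocal differentiable at the pole; the
    Taylor expansion of the product starts at [z ^ 2], and dividing it out
    expands the reciprocal itself. *)
Lemma pole_inv S c : pole S c -> S c = 0 -> cdiff (fun z => (S z)^-1) c.
Proof.
move=> /poleP[[r1 r10 h1] h2] Sc; have [r2 r20 {}h2'] := h2 1.
pose F z := (S (c + z))^-1; pose H z := z ^+ 2 * F z.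
pose r := Num.min r1 r2; have r0 : 0 < r by rewrite lt_min r10.
have cz w : w != 0 -> c + w != c by move=> w0; rewrite -subr_eq0 [c + w]addrC addrK.
have cw w : normc (c + w - c) = normc w by rewrite [c + w]addrC addrK.
have F0 : F 0 = 0 by rewrite /F addr0 Sc invr0.
have F1 w : normc w < r -> normc (F w) <= 1.
  rewrite lt_min => /andP[_ wr]; have [->|w0] := eqVneq w 0; first by rewrite F0 normc0.
  have := h2' _ (cz w w0); rewrite cw => /(_ wr) h.
  by rewrite /F normcV invf_le1; lra.
have H2 w : normc w < r -> normc (H w) <= normc w ^+ 2.
  by move=> wr; rewrite normcM normcX ler_piMr ?exprn_ge0 ?normc_ge0 ?F1.
have Hd w : normc w < r -> cdiff H w.
  move=> wr; have [->|w0] := eqVneq w 0.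
    exists 0 => e e0; exists (Num.min r e); first by rewrite lt_min r0.
    move=> z; rewrite subr0 lt_min => /andP[zr ze].
    rewrite mul0r subr0 {2}/H F0 mulr0 subr0; apply: le_trans (H2 z zr) _.
    by rewrite expr2 ler_wpM2r ?normc_ge0 // ltW.
  move: wr; rewrite lt_min => /andP[wr1 wr2].
  apply: cdiffM; first by have := @cdiffX _ 2 0 w; under eq_fun do rewrite subr0.
  apply: (@cdiff_shift (fun z => (S z)^-1)); apply: cdiffV; last by apply: h1; rewrite ?cz ?cw.
  have := h2' _ (cz w w0); rewrite cw => /(_ wr2) h.
  by rewrite -normc_gt0; lra.
have [s [M T]] := taylor_disc r0 Hd; have [r40 M0 HT] := T.
have s01 : forall k, (k < 2)%N -> s k = 0.
  apply: (taylor_eq (a := fun _ => 0) (D := 1) T r0) => z _ zr.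
  by rewrite big1 ?subr0 ?mul1r ?H2 // => i _; rewrite mul0r.
set q := r / 4 in T r40 HT.
have FT z : z != 0 -> normc z <= q -> normc (F z - s 2%N - s 3%N * z) <= M / (2 * q) ^+ 4 * normc z ^+ 2.
  move=> z0 zq; have nz : 0 < normc z by rewrite normc_gt0.
  have := HT 4%N z zq.
  have -> : \sum_(k < 4) s k * z ^+ k = s 2%N * z ^+ 2 + s 3%N * z ^+ 3.
    by rewrite !big_ord_recl big_ord0 /bump /= (s01 0%N) // (s01 1%N) //; ring.
  have -> : H z - (s 2%N * z ^+ 2 + s 3%N * z ^+ 3) = z ^+ 2 * (F z - s 2%N - s 3%N * z).
    by rewrite /H; ring.
  rewrite normcM normcX expr_div_n => h.
  rewrite -(ler_pM2l (exprn_gt0 2 nz)); apply: le_trans h _.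
  by rewrite le_eqVlt; apply/orP; left; apply/eqP; field; lra.
set A := M / _ in FT; have A0 : 0 <= A by rewrite divr_ge0 // exprn_ge0 //; lra.
have s2 : s 2%N = 0.
  apply/eqP; rewrite -normc_eq0 eq_le normc_ge0 andbT leNgt; apply/negP => h.
  have [r3 r30 h3] := h2 (2 / normc (s 2%N)).
  pose B := A + normc (s 3%N) + 1.
  have n3 := normc_ge0 (s 3%N).
  pose t := Num.min (r3 / 2) (Num.min q (Num.min 1 (normc (s 2%N) / (4 * B)))).
  have B0 : 0 < B by rewrite /B; lra.
  have t0 : 0 < t by rewrite !lt_min ltr01 r40 !divr_gt0 // mulr_gt0.
  have t1 : t <= r3 / 2 by rewrite ge_min lexx.
  have t2 : t <= q by rewrite !ge_min lexx !orbT.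
  have t3 : t <= 1 by rewrite !ge_min lexx !orbT.
  have t4 : t * (4 * B) <= normc (s 2%N).
    by rewrite -ler_pdivlMr ?mulr_gt0 // !ge_min lexx !orbT.
  have nt : normc t%:C%C = t by rewrite normc_real gtr0_norm.
  have tz : t%:C%C != 0 :> C by rewrite -normc_gt0 nt.
  have tr3 : t < r3 by lra.
  have := h3 _ (cz _ tz); rewrite cw nt => /(_ tr3) hS.
  have hF : normc (F t%:C%C) < normc (s 2%N) / 2.
    rewrite normcV -[X in _ < X]invrK ltf_pV2 ?posrE; [by rewrite invf_div| |].
      by apply: le_lt_trans hS; rewrite divr_ge0 ?normc_ge0.
    by rewrite invr_gt0 divr_gt0.
  have := FT _ tz; rewrite nt => /(_ t2) hT.
  have : normc (s 2%N) <= normc (F t%:C%C) + normc (s 3%N) * t + A * t ^+ 2.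
    have -> : s 2%N = F t%:C%C - s 3%N * t%:C%C - (F t%:C%C - s 2%N - s 3%N * t%:C%C) by ring.
    apply: le_trans (normcD _ _) _; rewrite normcN; apply: lerD => //.
    by apply: le_trans (normcD _ _) _; rewrite normcN normcM nt.
  have : A * t ^+ 2 <= A * t by apply: ler_wpM2l => //; rewrite expr2; nra.
  by rewrite /B in t4; nra.
exists (s 3%N) => e e0; exists (Num.min q (e / (A + 1))).
  by rewrite lt_min r40 divr_gt0 //; lra.
move=> w; rewrite lt_min => /andP[wq we].
rewrite Sc invr0 subr0; have [->|wc] := eqVneq w c.
  by rewrite subrr mulr0 Sc invr0 subr0 normc0 mulr0.
have wc0 : w - c != 0 by rewrite subr_eq0.
have := FT _ wc0 (ltW wq); rewrite s2 subr0 /F [c + _]addrC subrK => h.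
apply: le_trans h _; rewrite expr2 mulrA; apply: ler_wpM2r; first exact: normc_ge0.
move: we; rewrite ltr_pdivlMr; last lra.
have := normc_ge0 (w - c); nra.
Qed.

(** Near every point of the disk a meromorphic function is a quotient of two
    differentiable ones, [S / 1] or [1 / S^-1]. *)
Lemma local_quotient S c : holomorphic_at S c \/ (pole S c /\ S c = 0) ->
  exists r b g, [/\ 0 < r, forall w, normc (w - c) < r -> cdiff b w /\ cdiff g w &
    forall w, w != c -> normc (w - c) < r -> b w != 0 /\ g w = b w * S w].
Proof.
case=> [/holomorphic_atP[r r0 H]|[hp Sc]].
  exists r, (fun _ => 1), S; split=> // w wr; last by rewrite oner_eq0 mul1r.
  by split; [apply: cdiff_cst|apply: H].
have /poleP[[r1 r10 h1] /(_ 0)[r2 r20 h2]] := hp.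
exists (Num.min r1 r2), (fun z => (S z)^-1), (fun _ => 1); split=> [|w|w wc].
- by rewrite lt_min r10.
- rewrite lt_min => /andP[wr1 wr2]; split; last exact: cdiff_cst.
  have [->|wc] := eqVneq w c; first exact: pole_inv.
  by apply: cdiffV; [rewrite -normc_gt0; apply: h2|apply: h1].
- rewrite lt_min => /andP[wr1 wr2]; have Sw : S w != 0 by rewrite -normc_gt0; apply: h2.
  by rewrite invr_eq0 mulVf.
Qed.

End LocalAnalysis.

(** * Schur kernels and matrices of Taylor coefficients *)

Section PairKernels.
Variable R : realType.
Local Notation C := (R[i]).
Local Notation Co := (R[i]^o).
Implicit Types (f g b S : C -> C) (z w c : C) (e d D M : R) (s t : nat -> C).

Local Notation normc := (@ComplexField.Normc.normc R).

Lemma normc_conj z : normc z^* = normc z.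
Proof. by have := norm_conjC z; rewrite !norm_normc => /complexI. Qed.

Lemma neg_semicont n (A : 'M[C]_n) : A^t* = A ->
  exists2 e : R, 0 < e & forall G : 'M[C]_n, G^t* = G ->
    (forall i j, normc (G i j - A i j) <= e) -> (neg_index A <= neg_index G)%N.
Proof.
move=> hA; have [e e0 He] := neg_index_semicont hA.
have eE : e = (complex.Re e)%:C%C by rewrite RRe_real // gtr0_real.
exists (complex.Re e); first by rewrite -ltcR -eE.
move=> G hG HG; apply: He hG _ => i j.
by rewrite norm_normc eE lecR; apply: HG.
Qed.

(** The Schur kernel of [g / b], cleared of denominators. *)
Definition pair_kernel b g w z : C := (b z * (b w)^* - g z * (g w)^*) / (1 - z * w^*).

Definition pair_defect (s t : nat -> C) m : 'M[C]_m :=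
  toep s m *m (toep s m)^t* - toep t m *m (toep t m)^t*.

Lemma pair_defect_one (s : nat -> C) m : pair_defect (fun k => (k == 0%N)%:R) s m = defect s m.
Proof.
congr (_ - _); have -> : toep (fun k => (k == 0%N)%:R) m = 1%:M :> 'M[C]_m.
  apply/matrixP => i j; rewrite !mxE subn_eq0 -val_eqE /=.
  by case: ltngtP.
by rewrite adjmx1 mul1mx.
Qed.

Lemma pair_defect_herm (s t : nat -> C) m : (pair_defect s t m)^t* = pair_defect s t m.
Proof. by rewrite adjmxB !adjmx_mul !trmxCK. Qed.

Lemma pair_defectN (s t : nat -> C) m : pair_defect t s m = - pair_defect s t m.
Proof. by rewrite opprB. Qed.

Lemma conj_1B z w : (1 - z * w^*)^* = 1 - w * z^*.
Proof. by rewrite rmorphB rmorph1 rmorphM /= conjCK mulrC. Qed.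

Lemma pair_kernel_conj b g w z : (pair_kernel b g w z)^* = pair_kernel b g z w.
Proof.
rewrite /pair_kernel rmorphM fmorphV /= conj_1B; congr (_ / _).
by rewrite rmorphB !rmorphM /= !conjCK; congr (_ - _); rewrite mulrC.
Qed.

Lemma pair_kernel_herm b g m (w : 'I_m -> C) :
  (kernel_mx (pair_kernel b g) w)^t* = kernel_mx (pair_kernel b g) w.
Proof. by apply/matrixP => i j; rewrite !mxE pair_kernel_conj. Qed.

Definition powers L z : 'rV[C]_L := \row_(k < L) z ^+ k.

Definition partial (s : nat -> C) n z := \sum_(k < n) s k * z ^+ k.

Lemma powers_toep s L z (j : 'I_L) :
  (powers L z *m toep s L) 0 j = z ^+ j * partial s (L - j) z.
Proof.
rewrite mxE /partial mulr_sumr; under eq_bigr => k _ do rewrite !mxE.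
rewrite -(big_mkord xpredT (fun k => z ^+ j * (s k * z ^+ k))).
rewrite -(big_mkord xpredT (fun k => z ^+ k * (if (j <= k)%N then s (k - j)%N else 0))).
rewrite (big_cat_nat (n := j)) //=; last by apply: ltnW.
rewrite big_nat_cond big1 ?add0r => [|k /andP[/andP[_ kj] _]]; last first.
  by rewrite leqNgt kj mulr0.
rewrite -{1}[nat_of_ord j]add0n big_addn; apply: eq_bigr => k _.
by rewrite leq_addl addnK exprD; ring.
Qed.

Definition trunc_kernel (s t : nat -> C) L w z : C :=
  (powers L z *m pair_defect s t L *m (powers L w)^t*) 0 0.

Lemma gram_entry L (T : 'M[C]_L) (x y : 'rV[C]_L) :
  (x *m (T *m T^t*) *m y^t*) 0 0 = \sum_(j < L) (x *m T) 0 j * ((y *m T) 0 j)^*.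
Proof.
rewrite !mulmxA -[x *m T *m _ *m _]mulmxA -adjmx_mul mxE.
by apply: eq_bigr => j _; rewrite !mxE.
Qed.

Lemma trunc_kernelE s t L w z : trunc_kernel s t L w z =
  \sum_(j < L) (z ^+ j * partial s (L - j) z * (w ^+ j * partial s (L - j) w)^* -
                z ^+ j * partial t (L - j) z * (w ^+ j * partial t (L - j) w)^*).
Proof.
rewrite /trunc_kernel /pair_defect.
set A := toep s L *m _; set B := toep t L *m _.
have -> : (powers L z *m (A - B) *m (powers L w)^t*) 0 0 =
    (powers L z *m A *m (powers L w)^t*) 0 0 - (powers L z *m B *m (powers L w)^t*) 0 0.
  by rewrite mulmxBr mulmxBl [LHS]mxE [X in _ + X]mxE.
rewrite [RHS]sumrB; congr (_ - _); rewrite gram_entry;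
  by apply: eq_bigr => j _; rewrite !powers_toep.
Qed.

Lemma taylor_bound f r s M z : taylor f r s M -> normc z <= r ->
  normc (f z) <= M /\ forall n, normc (partial s n z) <= 2 * M.
Proof.
move=> [r0 M0 H] zr; have h : normc (f z) <= M.
  by have := H 0%N z zr; rewrite big_ord0 subr0 expr0 mulr1.
split=> // n; have -> : partial s n z = f z - (f z - partial s n z) by ring.
apply: le_trans (normcD _ _) _; rewrite normcN.
have : M * (normc z / (2 * r)) ^+ n <= M.
  apply: ler_piMr => //; have n0 := normc_ge0 z; apply: exprn_ile1; first by rewrite divr_ge0 //; lra.
  by rewrite ler_pdivrMr; lra.
have := H n z zr; rewrite -/(partial s n z); lra.
Qed.

Lemma prod_conj_dist (x x' y y' : C) d A B : normc (x - x') <= d -> normc (y - y') <= d ->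
  normc y <= A -> normc x' <= B -> normc (x * y^* - x' * y'^*) <= d * (A + B).
Proof.
move=> h1 h2 h3 h4.
have -> : x * y^* - x' * y'^* = (x - x') * y^* + x' * (y - y')^* by rewrite rmorphB /=; ring.
apply: le_trans (normcD _ _) _; rewrite !normcM !normc_conj mulrDr.
apply: lerD; first by apply: ler_pM; rewrite ?normc_ge0.
by rewrite mulrC; apply: ler_pM; rewrite ?normc_ge0.
Qed.

Lemma shift_dist f r s M th L (j : 'I_L) z : taylor f r s M -> r <= 1 / 2 -> normc z <= r ->
  normc z <= 2 * r * th ->
  normc (z ^+ j * f z - z ^+ j * partial s (L - j) z) <= M * th ^+ L.
Proof.
move=> [r0 M0 H] r1 zr zth; rewrite -mulrBr normcM normcX.
have n0 := normc_ge0 z.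
have th0 : normc z / (2 * r) <= th by rewrite ler_pdivrMr; nra.
have d0 : 0 <= normc z / (2 * r) by rewrite divr_ge0 //; lra.
have z1 : normc z <= th by apply: le_trans th0; rewrite ler_pdivlMr; nra.
apply: le_trans (_ : th ^+ j * (M * th ^+ (L - j)) <= _); last first.
  by rewrite mulrCA -exprD subnKC // ltnW.
apply: ler_pM; rewrite ?exprn_ge0 ?normc_ge0 //.
  by apply: lerXn2r; rewrite ?nnegrE //; lra.
apply: le_trans (H _ z zr) _; apply: ler_wpM2l => //.
by apply: lerXn2r; rewrite ?nnegrE //; lra.
Qed.

(** Summing [z ^ j w^* ^ j] times the numerator reproduces the kernel up to
    the tail of the geometric series, and the truncated kernel replaces each
    shifted function by a Taylor polynomial of the complementary length. *)
Lemma trunc_kernel_dist b g r s t M th L z w : taylor b r s M -> taylor g r t M ->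
  r <= 1 / 2 -> 0 <= th <= 1 -> normc z <= r -> normc w <= r ->
  normc z <= 2 * r * th -> normc w <= 2 * r * th ->
  normc (pair_kernel b g w z - trunc_kernel s t L w z) <= 6 * L.+1%:R * M ^+ 2 * th ^+ L.
Proof.
move=> Tb Tg r1 /andP[th0 th1] zr wr zth wth.
have [r0 M0 _] := Tb; have nz := normc_ge0 z; have nw := normc_ge0 w.
have [bz bz'] := taylor_bound Tb zr; have [bw bw'] := taylor_bound Tb wr.
have [gz gz'] := taylor_bound Tg zr; have [gw gw'] := taylor_bound Tg wr.
pose u := z * w^*; pose h := b z * (b w)^* - g z * (g w)^*.
have nu : normc u <= 1 / 4 by rewrite normcM normc_conj; nra.
have nu1 : 1 / 2 <= normc (1 - u).
  have := normcD (1 - u) u; rewrite subrK normc1; lra.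
have u1 : 1 - u != 0 by rewrite -normc_gt0; lra.
have E : pair_kernel b g w z = \sum_(j < L) u ^+ j * h + u ^+ L * h / (1 - u).
  rewrite /pair_kernel -/u -/h -mulr_suml; apply: (mulIf u1); rewrite divfK // mulrDl divfK //.
  have := subrX1 u L => EX; rewrite mulrAC -[_ * (1 - u)]mulrC -[1 - u]opprB mulNr -EX.
  by ring.
have small j : (j < L)%N -> th ^+ L <= 1 by move=> _; apply: exprn_ile1.
rewrite E trunc_kernelE addrAC -sumrB.
apply: le_trans (normcD _ _) _.
have tail : normc (u ^+ L * h / (1 - u)) <= 4 * M ^+ 2 * th ^+ L.
  rewrite !normcM normcV normcX.
  have hM : normc h <= 2 * M ^+ 2.
    apply: le_trans (normcD _ _) _; rewrite normcN !normcM !normc_conj.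
    have : normc (b z) * normc (b w) <= M * M by apply: ler_pM; rewrite ?normc_ge0.
    have : normc (g z) * normc (g w) <= M * M by apply: ler_pM; rewrite ?normc_ge0.
    lra.
  have uth : normc u <= th by rewrite normcM normc_conj; nra.
  have iu : (normc (1 - u))^-1 <= 2.
    by rewrite -[2]invrK lef_pV2 ?posrE //; lra.
  have -> : 4 * M ^+ 2 * th ^+ L = th ^+ L * (2 * M ^+ 2) * 2 by ring.
  apply: ler_pM => //; rewrite ?invr_ge0 ?normc_ge0 //.
    by rewrite mulr_ge0 ?exprn_ge0 ?normc_ge0.
  apply: ler_pM => //; rewrite ?exprn_ge0 ?normc_ge0 //.
  by apply: lerXn2r; rewrite ?nnegrE ?normc_ge0.
have main : normc (\sum_(j < L) (u ^+ j * h -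
    (z ^+ j * partial s (L - j) z * (w ^+ j * partial s (L - j) w)^* -
     z ^+ j * partial t (L - j) z * (w ^+ j * partial t (L - j) w)^*)))
    <= \sum_(j < L) 6 * M ^+ 2 * th ^+ L.
  apply: le_trans (normc_sum _ _ _) _; apply: ler_sum => j _.
  have zj : normc z ^+ j <= 1 by apply: exprn_ile1 => //; lra.
  have wj : normc w ^+ j <= 1 by apply: exprn_ile1 => //; lra.
  have sh (y : C) (A : R) x : 0 <= A -> normc x <= 1 -> normc y <= A -> normc (x * y) <= A.
    by move=> A0 x1 yA; rewrite normcM -[A]mul1r; apply: ler_pM; rewrite ?normc_ge0.
  have zj' : normc (z ^+ j) <= 1 by rewrite normcX.
  have wj' : normc (w ^+ j) <= 1 by rewrite normcX.
  have -> : u ^+ j * h - (z ^+ j * partial s (L - j) z * (w ^+ j * partial s (L - j) w)^* -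
     z ^+ j * partial t (L - j) z * (w ^+ j * partial t (L - j) w)^*) =
    (z ^+ j * b z * (w ^+ j * b w)^* - z ^+ j * partial s (L - j) z * (w ^+ j * partial s (L - j) w)^*) -
    (z ^+ j * g z * (w ^+ j * g w)^* - z ^+ j * partial t (L - j) z * (w ^+ j * partial t (L - j) w)^*).
    by rewrite /u /h exprMn !rmorphM !rmorphXn /=; ring.
  apply: le_trans (normcD _ _) _; rewrite normcN.
  have -> : 6 * M ^+ 2 * th ^+ L = M * th ^+ L * (M + 2 * M) + M * th ^+ L * (M + 2 * M) by ring.
  have M2 : 0 <= 2 * M by lra.
  apply: lerD.
    apply: prod_conj_dist; [exact: (shift_dist _ Tb)|exact: (shift_dist _ Tb)|exact: sh|exact: sh].
  apply: prod_conj_dist; [exact: (shift_dist _ Tg)|exact: (shift_dist _ Tg)|exact: sh|exact: sh].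
apply: le_trans (lerD main tail) _.
rewrite sumr_const card_ord -mulr_natl -natr1.
have thL : 0 <= M ^+ 2 * th ^+ L by rewrite mulr_ge0 ?exprn_ge0.
have : 0 <= L%:R :> R by [].
nra.
Qed.

Lemma trunc_kernel_mx s t L m (w : 'I_m -> C) :
  kernel_mx (trunc_kernel s t L) w =
  (\matrix_(i < m, k < L) w i ^+ k) *m pair_defect s t L *m (\matrix_(i < m, k < L) w i ^+ k)^t*.
Proof.
apply/matrixP => i j; rewrite mxE /trunc_kernel !mxE; apply: eq_bigr => k _.
rewrite !mxE; congr (_ * _); apply: eq_bigr => l _; by rewrite !mxE.
Qed.

Lemma trunc_kernel_herm s t L m (w : 'I_m -> C) :
  (kernel_mx (trunc_kernel s t L) w)^t* = kernel_mx (trunc_kernel s t L) w.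
Proof. by rewrite trunc_kernel_mx; apply: congr_herm; apply: pair_defect_herm. Qed.

(** On a disk where the truncated kernels converge the kernel matrices are limits
    of matrices congruent to the matrices of Taylor coefficients. *)
Lemma kernel_index_le b g r s t M nu : taylor b r s M -> taylor g r t M -> r <= 1 / 2 ->
  (forall L, (neg_index (pair_defect s t L) <= nu)%N) ->
  forall m (w : 'I_m -> C), (forall i, normc (w i) <= r / 2) ->
    (neg_index (kernel_mx (pair_kernel b g) w) <= nu)%N.
Proof.
move=> Tb Tg r1 HN m w wr; have [r0 M0 _] := Tb.
have [e e0 He] := neg_semicont (pair_kernel_herm b g w).
have [L HL] := small_pow2 (6 * M ^+ 2) e0.
apply: leq_trans (HN L); apply: leq_trans (He (kernel_mx (trunc_kernel s t L) w) _ _) _.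
- exact: trunc_kernel_herm.
- move=> i j; rewrite !mxE normcB.
  apply: le_trans (trunc_kernel_dist (th := 1 / 4) L Tb Tg r1 _ _ _ _ _) _; rewrite ?wr //.
  - by apply/andP; split; lra.
  - by have := wr i; lra.
  - by have := wr j; lra.
  - by have := wr i; lra.
  - by have := wr j; lra.
  apply: le_trans (ltW HL).
  have -> : 6 * L.+1%:R * M ^+ 2 * (1 / 4) ^+ L = 6 * M ^+ 2 * (L.+1%:R * (1 / 4) ^+ L) by ring.
  apply: ler_wpM2l; first by rewrite mulr_ge0 ?sqr_ge0.
  have -> : (1 / 4 : R) = 2^-1 * 2^-1 by field.
  rewrite exprMn exprVn -[X in _ <= X]mul1r mulrA; apply: ler_wpM2r; first by rewrite invr_ge0 exprn_ge0.
  rewrite ler_pdivrMr ?exprn_gt0 // mul1r -natrX ler_nat; exact: ltn_expl.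
by rewrite trunc_kernel_mx; apply: neg_index_congr_le; apply: pair_defect_herm.
Qed.

Lemma pair_defect_lead s t m L : (m <= L)%N ->
  let J := \matrix_(k < m, l < L) (k == l :> nat)%:R : 'M[C]_(m, L) in
  J *m pair_defect s t L *m J^t* = pair_defect s t m.
Proof.
move=> mL J; have JE p (A : 'M[C]_(L, p)) i j : (J *m A) i j = A (widen_ord mL i) j.
  rewrite mxE (bigD1 (widen_ord mL i)) //= mxE eqxx mul1r big1 ?addr0 // => k ki.
  rewrite mxE; have -> : (i == k :> nat) = false; last by rewrite mul0r.
  by apply: contraNF ki => /eqP ik; apply/eqP/val_inj.
have JE' p (A : 'M[C]_(p, L)) i j : (A *m J^t*) i j = A i (widen_ord mL j).
  rewrite mxE (bigD1 (widen_ord mL j)) //= !mxE eqxx conjC1 mulr1 big1 ?addr0 // => k kj.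
  rewrite !mxE; have -> : (j == k :> nat) = false; last by rewrite conjC0 mulr0.
  by apply: contraNF kj => /eqP jk; apply/eqP/val_inj.
apply/matrixP => i j; rewrite JE' JE.
by rewrite /pair_defect mxE [X in _ + X]mxE !toep_gram [RHS]mxE [X in _ = _ + X]mxE !toep_gram.
Qed.

Lemma vandermonde_left_inverse L (x : nat -> C) :
  (forall i j : 'I_L, x i = x j -> i = j) ->
  exists U : 'M[C]_L, forall k l : 'I_L, \sum_a U k a * x a ^+ l = (k == l)%:R.
Proof.
move=> xinj; pose V := (Vandermonde L (\row_(a < L) x a))^T.
have Vu : V \in unitmx.
  rewrite unitmxE det_tr det_Vandermonde unitfE; apply/prodf_neq0 => i _.
  apply/prodf_neq0 => j ij; rewrite !mxE subr_eq0; apply: contraTneq ij => /xinj ->.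
  by rewrite ltnn.
exists (invmx V) => k l; have := congr1 (fun A : 'M[C]_L => A k l) (mulVmx Vu).
by rewrite !mxE => <-; apply: eq_bigr => a _; rewrite !mxE.
Qed.

Lemma congr_entry_le m L (Q : 'M[C]_(m, L)) (D : 'M[C]_L) d i j :
  (forall a a', normc (D a a') <= d) ->
  normc ((Q *m D *m Q^t*) i j) <= (\sum_a normc (Q i a)) * (\sum_c normc (Q j c)) * d.
Proof.
move=> HD; rewrite mxE; apply: le_trans (normc_sum _ _ _) _.
rewrite mulrAC mulr_sumr; apply: ler_sum => c _; rewrite !mxE normcM normc_conj.
apply: ler_wpM2r; first exact: normc_ge0.
apply: le_trans (normc_sum _ _ _) _; rewrite mulr_suml; apply: ler_sum => a _.
by rewrite normcM; apply: ler_wpM2l => //; apply: normc_ge0.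
Qed.

(** Interpolating at [2 m] points [eta x_a] recovers the first [m] Taylor
    coefficients of the kernel in each variable up to an error that vanishes
    with [eta], so the matrix of Taylor coefficients is a limit of matrices
    congruent to kernel matrices. *)
Lemma defect_index_le b g r s t M nu eps : taylor b r s M -> taylor g r t M -> r <= 1 / 2 ->
  0 < eps -> (forall m (w : 'I_m -> C), (forall i, w i != 0 /\ normc (w i) < eps) ->
    (neg_index (kernel_mx (pair_kernel b g) w) <= nu)%N) ->
  forall m, (neg_index (pair_defect s t m) <= nu)%N.
Proof.
move=> Tb Tg r1 eps0 HK m; have [r0 M0 _] := Tb.
have [e e0 He] := neg_semicont (pair_defect_herm s t m).
pose L := m.*2; pose x (a : nat) : R := a.+1%:R / L.+1%:R.
have L0 : 0 < L.+1%:R :> R by [].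
have x0 a : 0 < x a by rewrite divr_gt0.
have x1 (a : 'I_L) : x a <= 1.
  by rewrite ler_pdivrMr // mul1r ler_nat ltnS ltnW.
have xinj (i j : 'I_L) : (x i)%:C%C = (x j)%:C%C :> C -> i = j.
  move=> /complexI /(divIf (lt0r_neq0 L0)) /eqP; rewrite eqr_nat eqSS => /eqP.
  exact: val_inj.
have [U UE] := @vandermonde_left_inverse L (fun a => (x a)%:C%C) xinj.
have mL : (m <= L)%N by rewrite /L -addnn leq_addr.
pose B := \sum_(k < L) \sum_(a < L) normc (U k a).
pose Q := B * B * (6 * L.+1%:R * M ^+ 2 / (2 * r) ^+ L).
have BU k : \sum_(a < L) normc (U k a) <= B.
  rewrite /B [leRHS](bigD1 k) //= lerDl sumr_ge0 // => i _; rewrite sumr_ge0 // => a _.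
  exact: normc_ge0.
have B0 : 0 <= B by rewrite sumr_ge0 // => i _; rewrite sumr_ge0 // => a _; apply: normc_ge0.
have Q0 : 0 <= Q.
  apply: mulr_ge0; first exact: mulr_ge0.
  apply: divr_ge0; first by rewrite !mulr_ge0 ?sqr_ge0.
  by apply: exprn_ge0; lra.
pose eta := Num.min (Num.min 1 r) (Num.min (eps / 2) (e / (Q + 1))).
have eta0 : 0 < eta by rewrite !lt_min ltr01 r0 !divr_gt0 //; lra.
have eta1 : eta <= 1 by rewrite !ge_min lexx.
have etar : eta <= r by rewrite !ge_min lexx !orbT.
have etae : eta <= eps / 2 by rewrite !ge_min lexx !orbT.
have etaQ : eta * (Q + 1) <= e.
  by rewrite -ler_pdivlMr; [rewrite /eta !ge_min lexx !orbT|lra].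
have etaC : (eta%:C%C : C) != 0 by rewrite -normc_gt0 normc_real gtr0_norm.
pose w (a : 'I_L) : C := (eta * x a)%:C%C.
have nw a : normc (w a) <= eta.
  by rewrite normc_real gtr0_norm ?mulr_gt0 // ler_piMr // ltW.
pose P : 'M[C]_(m, L) := \matrix_(k, a) ((eta%:C%C)^-1 ^+ k * U (widen_ord mL k) a).
have PV : P *m (\matrix_(a < L, k < L) w a ^+ k) =
    \matrix_(k < m, l < L) (k == l :> nat)%:R.
  apply/matrixP => k l; rewrite !mxE.
  have -> : \sum_a P k a * (\matrix_(a < L, k < L) w a ^+ k) a l =
     (eta%:C%C)^-1 ^+ k * eta%:C%C ^+ l * \sum_a U (widen_ord mL k) a * (x a)%:C%C ^+ l.
    rewrite mulr_sumr; apply: eq_bigr => a _; rewrite !mxE /w rmorphM exprMn /=; ring.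
  rewrite UE -val_eqE /=; case: eqVneq => [->|_]; last by rewrite mulr0.
  by rewrite exprVn mulVf ?mulr1 // expf_neq0.
have E : P *m kernel_mx (trunc_kernel s t L) w *m P^t* = pair_defect s t m.
  rewrite trunc_kernel_mx !mulmxA PV -mulmxA -adjmx_mul PV.
  exact: pair_defect_lead.
apply: leq_trans (He (P *m kernel_mx (pair_kernel b g) w *m P^t*) _ _) _.
- by apply: congr_herm; apply: pair_kernel_herm.
- move=> i j; rewrite -E.
  have -> : (P *m kernel_mx (pair_kernel b g) w *m P^t*) i j -
      (P *m kernel_mx (trunc_kernel s t L) w *m P^t*) i j =
    (P *m (kernel_mx (pair_kernel b g) w - kernel_mx (trunc_kernel s t L) w) *m P^t*) i j.
    by rewrite mulmxBr mulmxBl [RHS]mxE [X in _ = _ + X]mxE.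
  apply: le_trans (congr_entry_le (d := 6 * L.+1%:R * M ^+ 2 * (eta / (2 * r)) ^+ L) _ _ _ _) _.
    move=> a c; rewrite !mxE; apply: trunc_kernel_dist Tb Tg _ _ _ _ _ _ => //.
    - apply/andP; split; first by rewrite divr_ge0 //; lra.
      by rewrite ler_pdivrMr; lra.
    - by apply: le_trans (nw a) _.
    - by apply: le_trans (nw c) _.
    - by have := nw a; have -> : 2 * r * (eta / (2 * r)) = eta by field; lra.
    - by have := nw c; have -> : 2 * r * (eta / (2 * r)) = eta by field; lra.
  have PB k : \sum_a normc (P k a) <= eta^-1 ^+ k * B.
    apply: le_trans (_ : eta^-1 ^+ k * \sum_a normc (U (widen_ord mL k) a) <= _).
      rewrite mulr_sumr; apply: ler_sum => a _.
      by rewrite mxE normcM normcX normcV normc_real gtr0_norm.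
    by apply: ler_wpM2l => //; rewrite exprn_ge0 // invr_ge0 ltW.
  have ij : (i + j < L)%N by rewrite /L -addnn -addSn leq_add // ltnW.
  have etaX : eta^-1 ^+ i * eta^-1 ^+ j * eta ^+ L <= eta.
    rewrite -[X in eta ^+ X](subnKC (ltnW ij)) (exprD eta) mulrA -exprD exprVn.
    rewrite mulVf ?expf_neq0 ?gt_eqF // mul1r.
    have -> : (L - (i + j) = (L - (i + j)).-1.+1)%N by rewrite prednK // subn_gt0.
    by rewrite exprS; apply: ler_piMr; [apply: ltW|apply: exprn_ile1 => //; apply: ltW].
  apply: le_trans (_ : eta^-1 ^+ i * B * (eta^-1 ^+ j * B) *
     (6 * L.+1%:R * M ^+ 2 * (eta / (2 * r)) ^+ L) <= _).
    apply: ler_wpM2r; first by rewrite !mulr_ge0 ?exprn_ge0 ?divr_ge0 ?sqr_ge0 //; lra.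
    by apply: ler_pM => //; rewrite sumr_ge0 // => a _; apply: normc_ge0.
  have -> : eta^-1 ^+ i * B * (eta^-1 ^+ j * B) * (6 * L.+1%:R * M ^+ 2 * (eta / (2 * r)) ^+ L) =
     Q * (eta^-1 ^+ i * eta^-1 ^+ j * eta ^+ L).
    by rewrite /Q expr_div_n; ring.
  nra.
apply: leq_trans (neg_index_congr_le _ (pair_kernel_herm _ _ _)) _.
apply: HK => a; split; last by apply: le_lt_trans (nw a) _; lra.
by rewrite -normc_gt0 normc_real gtr0_norm ?mulr_gt0.
Qed.

End PairKernels.

(** * Continuation through the disk *)

Section Continuation.
Variable R : realType.
Local Notation C := (R[i]).
Local Notation Co := (R[i]^o).
Implicit Types (f g b S : C -> C) (z w c : C) (t e d D M : R).

Local Notation normc := (@ComplexField.Normc.normc R).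

Definition punctured c e z := z != c /\ normc (z - c) < e.

(** Continuation along a segment: the set of parameters whose points have the
    property on a punctured neighbourhood is open and closed. *)
Lemma propagate (P : (C -> Prop) -> Prop) (a b : C) :
  (forall Y Y' : C -> Prop, (forall z, Y z -> Y' z) -> P Y' -> P Y) ->
  (forall t, unit_itv t -> exists2 d, 0 < d & forall c e,
     normc (c - seg a b t) < d -> 0 < e -> P (punctured c e) -> P (punctured (seg a b t) d)) ->
  (exists2 e, 0 < e & P (punctured a e)) -> exists2 e, 0 < e & P (punctured b e).
Proof.
move=> anti loc [e0 e00 Pa].
pose Q c := exists2 e, 0 < e & P (punctured c e).
have near c d : 0 < d -> P (punctured c d) -> forall c', normc (c' - c) < d -> Q c'.
  move=> d0 Pc c' cd; have n0 := normc_ge0 (c' - c).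
  exists (if c' == c then d else Num.min (d - normc (c' - c)) (normc (c' - c))).
    case: eqVneq => // cc; rewrite lt_min subr_gt0 cd normc_gt0 subr_eq0 //.
  apply: anti Pc => z [zc]; case: eqVneq => [<- //|cc].
  rewrite lt_min => /andP[h1 h2]; split.
    by apply: contraTneq h2 => ->; rewrite normcB ltxx.
  by apply: le_lt_trans (normc_tri _ c' _) _; lra.
pose E : set R := [set t | unit_itv t /\ Q (seg a b t)].
have s0 : seg a b 0 = a by rewrite /seg rmorph0 mul0r addr0.
have s1 : seg a b 1 = b by rewrite /seg rmorph1 mul1r addrC subrK.
have E0 : E 0 by split; [apply: unit_itv0|rewrite s0; exists e0].
have Es : has_sup E by split; [exists 0|exists 1 => t [/andP[]]].
set s := sup E; have s01 : unit_itv s.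
  rewrite /unit_itv ub_le_sup //=; last by case: Es.
  by apply: ge_sup => //; [exists 0|move=> t [/andP[]]].
have [d d0 Hd] := loc s s01.
have n0 := normc_ge0 (b - a).
pose h := d / (normc (b - a) + 1).
have h0 : 0 < h by rewrite divr_gt0 //; lra.
have hd : h * (normc (b - a) + 1) = d by rewrite /h divfK //; lra.
have close t : `|t - s| < h -> normc (seg a b t - seg a b s) < d.
  by move=> th; rewrite seg_dist -hd; nra.
have [t [t01 [et et0 Pt]] ts] := sup_adherent h0 Es.
have supE u : E u -> u <= s by move=> Eu; apply: ub_le_sup => //; case: Es.
have tles : t <= s by apply: supE; split=> //; exists et.
have Ps : P (punctured (seg a b s) d).
  by rewrite -/s in ts; apply: Hd et0 Pt; apply: close; rewrite ler0_norm; lra.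
have sn : s <= 1 by case/andP: s01.
pose t' := Num.min 1 (s + h / 2).
have t'1 : t' <= 1 by rewrite ge_min lexx.
have t's : s <= t' by rewrite le_min sn; lra.
have t'h : t' <= s + h / 2 by rewrite ge_min lexx orbT.
have Qt' : Q (seg a b t') by apply: near Ps _ _ => //; apply: close; rewrite ger0_norm; lra.
have t'E : E t' by split=> //; apply/andP; split=> //; case/andP: s01 => *; lra.
have := supE t' t'E.
move=> t'les; have t'1' : t' = 1.
  by apply/eqP; rewrite eq_le t'1 /= leNgt; apply/negP; move: t'les; rewrite /t' /Num.min; case: ifP => //; lra.
by move: Qt'; rewrite t'1' s1.
Qed.

Definition kernel_le nu S (Y : C -> Prop) := forall m (w : 'I_m -> C), (forall i, Y (w i)) ->
  (neg_index (kernel_mx (schur_kernel S) w) <= nu)%N.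

Lemma schur_kernel_pair S : pair_kernel (fun _ => 1) S = schur_kernel S.
Proof. by apply/funext => w; apply/funext => z; rewrite /pair_kernel conjC1 mulr1. Qed.

Lemma schur_kernel_herm S m (w : 'I_m -> C) :
  (kernel_mx (schur_kernel S) w)^t* = kernel_mx (schur_kernel S) w.
Proof. by rewrite -schur_kernel_pair pair_kernel_herm. Qed.

Lemma kernel_scale (K K' : C -> C -> C) m (w w' d : 'I_m -> C) :
  (kernel_mx K' w')^t* = kernel_mx K' w' ->
  (forall i j, K (w j) (w i) = d i * K' (w' j) (w' i) * (d j)^*) ->
  (neg_index (kernel_mx K w) <= neg_index (kernel_mx K' w'))%N.
Proof.
move=> hK HK; pose D := diag_mx (\row_i d i).
have -> : kernel_mx K w = D *m kernel_mx K' w' *m D^t*; last exact: neg_index_congr_le.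
apply/matrixP => i j; rewrite mxE HK mxE (bigD1 j) //= big1 ?addr0 => [|k kj].
  rewrite mul_diag_mx !mxE eqxx mulr1n; congr (_ * _).
by rewrite mul_diag_mx !mxE; move: kj; rewrite eq_sym => /negPf ->; rewrite mulr0n conjC0 mulr0.
Qed.

Definition moebius p z := (z + p) / (1 + p^* * z).

Lemma moebiusK p z : 1 - p^* * z != 0 -> 1 - p * p^* != 0 -> moebius p (moebius (- p) z) = z.
Proof.
move=> h1 h2; rewrite /moebius rmorphN /= mulNr.
by field; rewrite h1; apply: contraNneq h2 => h; apply/eqP; rewrite -h; ring.
Qed.

Lemma moebius_dist p z : 1 + p^* * z != 0 -> moebius p z - p = z * (1 - p * p^*) / (1 + p^* * z).
Proof. by move=> h; rewrite /moebius; field. Qed.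

(** Moving [p] to the origin preserves the kernel up to a congruence, because
    [1 - u v^*] is multiplied by [(1 - |p| ^ 2)] and by factors depending on one
    variable. *)
Lemma moebius_kernel b g S p k z w : k * k^* = 1 - p * p^* ->
  g (moebius p z) = b (moebius p z) * S (moebius p z) ->
  g (moebius p w) = b (moebius p w) * S (moebius p w) ->
  1 + p^* * z != 0 -> 1 + p^* * w != 0 -> 1 - z * w^* != 0 -> 1 - p * p^* != 0 ->
  pair_kernel (fun u => (1 + p^* * u) * b (moebius p u)) (fun u => (1 + p^* * u) * g (moebius p u)) w z =
  (k * b (moebius p z)) * schur_kernel S (moebius p w) (moebius p z) * (k * b (moebius p w))^*.
Proof.
move=> kk gz gw h1 h2 h3 h4; rewrite /pair_kernel /schur_kernel gz gw.
have h2' : 1 + p * w^* != 0.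
  by rewrite -conjC_eq0 rmorphD rmorph1 rmorphM /= conjCK.
set bz := b _; set bw := b (moebius p w); set Sz := S _; set Sw := S (moebius p w).
have -> : 1 - moebius p z * (moebius p w)^* =
    (1 - p * p^*) * (1 - z * w^*) / ((1 + p^* * z) * (1 + p * w^*)).
  rewrite /moebius rmorphM fmorphV !rmorphD rmorph1 !rmorphM /= conjCK.
  by field; rewrite h1 h2'.
rewrite !rmorphM !rmorphD rmorph1 !rmorphM /= !conjCK.
have -> : k * bz * ((1 - Sz * Sw^*) / ((1 - p * p^*) * (1 - z * w^*) / ((1 + p^* * z) * (1 + p * w^*)))) * (k^* * bw^*) =
  k * k^* * (bz * (1 - Sz * Sw^*) * bw^*) / ((1 - p * p^*) * (1 - z * w^*) / ((1 + p^* * z) * (1 + p * w^*))) by ring.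
by rewrite kk; field; rewrite h1 h2' h3 h4.
Qed.

Lemma taylor_mono f r s M M' : M <= M' -> taylor f r s M -> taylor f r s M'.
Proof.
move=> MM [r0 M0 H]; split=> //; first exact: le_trans MM.
move=> K z zr; apply: le_trans (H K z zr) _; apply: ler_wpM2r => //.
by rewrite exprn_ge0 // divr_ge0 ?normc_ge0 //; lra.
Qed.

Lemma one_add_neq0 p z : normc p < 1 -> normc z <= 1 -> 1 + p^* * z != 0.
Proof.
move=> p1 z1; rewrite -normc_gt0; have := normcD (1 + p^* * z) (- (p^* * z)).
rewrite addrK normc1 normcN normcM normc_conj; have := normc_ge0 p; have := normc_ge0 z; nra.
Qed.

Lemma one_add_ge p z : normc p <= 1 -> 1 - normc z <= normc (1 + p^* * z).
Proof.
move=> p1; have := normcD (1 + p^* * z) (- (p^* * z)).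
rewrite addrK normc1 normcN normcM normc_conj; have := normc_ge0 p; have := normc_ge0 z; nra.
Qed.

Lemma one_sub_mul_neq0 z w : normc z < 1 -> normc w <= 1 -> 1 - z * w^* != 0.
Proof.
move=> z1 w1; have := @one_add_neq0 z (- w) z1; rewrite normcN => /(_ w1).
by rewrite -conjC_eq0 rmorphD rmorph1 rmorphM /= conjCK rmorphN /= mulrN.
Qed.

(** Around [c], write [S] as the quotient [g / b] and move a nearby point [p] to
    the origin. A bound near [p], however small the neighbourhood, bounds the
    matrices of Taylor coefficients at [p], and these bound the kernel on a disk
    around [p] whose radius does not depend on [p] and which contains a
    neighbourhood of [c]. *)
Lemma local_uniform S c nu : normc c < 1 -> holomorphic_at S c \/ (pole S c /\ S c = 0) ->
  exists2 d, 0 < d & forall p e, normc (p - c) < d -> 0 < e ->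
    kernel_le nu S (punctured p e) -> kernel_le nu S (punctured c d).
Proof.
move=> c1 /local_quotient[r1 [b [g [r10 Hd Hq]]]].
pose q := 1 - normc c; have q0 : 0 < q by rewrite /q; lra.
have nc := normc_ge0 c; have q1 : q <= 1 by rewrite /q; lra.
pose r := Num.min r1 (q / 2).
have r0 : 0 < r by rewrite lt_min r10; lra.
have rr1 : r <= r1 by rewrite ge_min lexx.
have rq : r <= q / 2 by rewrite ge_min lexx orbT.
exists (r * q / 96); first by rewrite divr_gt0 // mulr_gt0.
set d := r * q / 96; have dr : d <= r / 96 by rewrite /d; nra.
have dq : d <= q / 96 by rewrite /d; nra.
have d0 : 0 < d by rewrite /d divr_gt0 // mulr_gt0.
move=> p e pc e0 HK; have np : normc p <= normc c + d.
  by have := normc_tri p c 0; rewrite !subr0; lra.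
have p1 : normc p < 1 by rewrite /q in q0 dq; lra.
have pp : 1 - p * p^* != 0 by apply: one_sub_mul_neq0 => //; apply: ltW.
have ppE : 1 - p * p^* = (1 - normc p ^+ 2)%:C%C.
  by rewrite -normCK norm_normc -rmorphXn /= rmorphB rmorph1.
pose k := sqrtC (1 - p * p^*).
have kk : k * k^* = 1 - p * p^*.
  have h : 0 <= 1 - p * p^*.
    by rewrite ppE -(rmorph0 (real_complex R)) lecR; have := normc_ge0 p; nra.
  have k0 : 0 <= k by rewrite sqrtC_ge0.
  by rewrite (geC0_conj k0) -expr2 sqrtCK.
have k0 : k != 0 by apply: contraNneq pp => E; rewrite -kk E mul0r.
have npp : normc (1 - p * p^*) <= 1.
  have := normc_ge0 p => np0; rewrite ppE normc_real ger0_norm; nra.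
have mdist z : normc z <= 1 / 2 -> normc (moebius p z - p) <= 2 * normc z.
  move=> z12; have z1 : normc z <= 1 by lra.
  rewrite moebius_dist ?one_add_neq0 // !normcM normcV.
  have := @one_add_ge p z (ltW p1) => h.
  rewrite ler_pdivrMr; last lra.
  have := normc_ge0 z; nra.
have mc z : normc z < r / 4 -> normc (moebius p z - c) < r1.
  move=> zr; have z12 : normc z <= 1 / 2 by lra.
  by apply: le_lt_trans (normc_tri _ p _) _; have := mdist z z12; lra.
have md f : (forall w, normc (w - c) < r1 -> cdiff f w) ->
    forall z, normc z < r / 4 -> cdiff (fun u => (1 + p^* * u) * f (moebius p u)) z.
  move=> Hf z zr; have z1 : normc z <= 1 by lra.
  have lin : cdiff (fun u => 1 + p^* * u) z.
    apply: cdiffD; first exact: cdiff_cst.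
    by apply: cdiffM; [apply: cdiff_cst|apply: cdiff_id].
  apply: cdiffM => //; apply: (cdiff_comp (f := moebius p) (g := f)); last exact/Hf/mc.
  apply: cdiffM; first by apply: cdiffD; [apply: cdiff_id|apply: cdiff_cst].
  by apply: cdiffV => //; apply: one_add_neq0.
have r4 : 0 < r / 4 by lra.
have [s [M1 Tb]] := taylor_disc r4 (md b (fun w h => (Hd w h).1)).
have [t [M2 Tg]] := taylor_disc r4 (md g (fun w h => (Hd w h).2)).
have mm1 : M1 <= Num.max M1 M2 by rewrite le_max lexx.
have mm2 : M2 <= Num.max M1 M2 by rewrite le_max lexx orbT.
have {}Tb := taylor_mono mm1 Tb; have {}Tg := taylor_mono mm2 Tg.
have r12 : r / 4 / 4 <= 1 / 2 by lra.
pose eps := Num.min (r / 8) (if p == c then e / 2 else Num.min (e / 2) (normc (p - c) / 2)).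
have eps0 : 0 < eps.
  rewrite lt_min; apply/andP; split; first lra.
  by case: eqVneq => [_|pc']; rewrite ?lt_min !divr_gt0 // normc_gt0 subr_eq0.
have Hdef : forall m, (neg_index (pair_defect s t m) <= nu)%N.
  apply: defect_index_le Tb Tg r12 eps0 _ => m w Hw.
  have wr i : normc (w i) < r / 8 by have [_] := Hw i; rewrite lt_min => /andP[].
  have w12 i : normc (w i) <= 1 / 2 by have := wr i; lra.
  have w1 i : normc (w i) <= 1 by have := wr i; lra.
  have w1' i : normc (w i) < 1 by have := wr i; lra.
  have wp i : moebius p (w i) != p.
    have [w0 _] := Hw i; rewrite -subr_eq0 moebius_dist ?one_add_neq0 //.
    by rewrite !mulf_neq0 // invr_eq0 one_add_neq0.
  have we i : normc (moebius p (w i) - p) < e.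
    have [_] := Hw i; rewrite lt_min => /andP[_ h]; apply: le_lt_trans (mdist _ (w12 i)) _.
    by move: h; case: eqVneq => [_ h|_]; [lra|rewrite lt_min => /andP[h _]; lra].
  have wc i : moebius p (w i) != c.
    have [pc'|pc'] := eqVneq p c; first by rewrite -pc'.
    have [_] := Hw i; rewrite lt_min (negPf pc') lt_min => /andP[_ /andP[_ h]].
    apply/eqP => E; have := mdist _ (w12 i); rewrite E normcB; lra.
  have wq i : g (moebius p (w i)) = b (moebius p (w i)) * S (moebius p (w i)).
    by apply: (Hq _ (wc i) _).2; apply: mc; have := wr i; lra.
  apply: leq_trans (HK m (fun i => moebius p (w i)) _); last by move=> i; split.
  apply: (@kernel_scale _ _ _ _ _ (fun i => k * b (moebius p (w i)))); first exact: schur_kernel_herm.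
  move=> i j; apply: moebius_kernel => //; rewrite ?one_add_neq0 //.
  exact: one_sub_mul_neq0.
move=> m z Hz; pose w i := moebius (- p) (z i).
have nz i : normc (z i) <= normc c + d.
  by have [_] := Hz i; have := normc_tri (z i) c 0; rewrite !subr0; lra.
have z1 i : normc (z i) < 1 by have := nz i; rewrite /q in dq; lra.
have pz i : 1 - p^* * z i != 0.
  have := @one_add_neq0 p (- z i) p1; rewrite normcN mulrN; apply; exact/ltW/z1.
have mw i : moebius p (w i) = z i by rewrite moebiusK.
have nw i : normc (w i) <= r / 4 / 4 / 2.
  rewrite /w /moebius normcM normcV rmorphN /= mulNr ler_pdivrMr ?normc_gt0 //.
  have h1 : normc (z i - p) < d + d.
    by have [_ h] := Hz i; apply: le_lt_trans (normc_tri _ c _) _; rewrite [normc (c - p)]normcB; lra.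
  have := @one_add_ge p (- z i) (ltW p1); rewrite normcN mulrN => h2.
  have := nz i; have qE : q = 1 - normc c by []; have dE : d * 96 = r * q by rewrite /d divfK.
  nra.
have w1 i : normc (w i) <= 1 by have := nw i; lra.
have w1' i : normc (w i) < 1 by have := nw i; lra.
have zc i : normc (z i - c) < r1 by have [_ h] := Hz i; lra.
have bz i : b (z i) != 0 by have [zc' _] := Hz i; have [] := Hq _ zc' (zc i).
have gz i : g (z i) = b (z i) * S (z i) by have [zc' _] := Hz i; have [] := Hq _ zc' (zc i).
have := kernel_index_le Tb Tg r12 Hdef nw; apply: leq_trans.
apply: (@kernel_scale _ _ _ _ _ (fun i => (k * b (z i))^-1)); first exact: pair_kernel_herm.
move=> i j; rewrite (@moebius_kernel b g S p k) ?mw ?one_add_neq0 //; last exact: one_sub_mul_neq0.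
have kb l : k * b (z l) != 0 by rewrite mulf_neq0.
by rewrite fmorphV /= -[_ * _ * _^*]mulrA mulKf // mulfK // conjC_eq0.
Qed.

Lemma kernel_le_anti nu S (Y Y' : C -> Prop) : (forall z, Y z -> Y' z) ->
  kernel_le nu S Y' -> kernel_le nu S Y.
Proof. by move=> YY H m w Hw; apply: H => i; apply/YY/Hw. Qed.

Lemma unit_diskP z : unit_disk z <-> normc z < 1.
Proof.
have E : (`|z| < 1) = (normc z < 1).
  by rewrite norm_normc -(rmorph1 (real_complex R)) ltcR.
by rewrite -E.
Qed.

Lemma seg_disk (a b : C) t : normc a < 1 -> normc b < 1 -> unit_itv t -> normc (seg a b t) < 1.
Proof.
move=> a1 b1 /andP[t0 t1]; have -> : seg a b t = (1 - t)%:C%C * a + t%:C%C * b.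
  by rewrite /seg rmorphB rmorph1 /=; ring.
apply: le_lt_trans (normcD _ _) _; rewrite !normcM !normc_real !ger0_norm //; last lra.
pose m := Num.max (normc a) (normc b).
have m1 : m < 1 by rewrite gt_max a1.
have am : normc a <= m by rewrite le_max lexx.
have bm : normc b <= m by rewrite le_max lexx orbT.
by apply: le_lt_trans m1; nra.
Qed.

Lemma kernel_propagate S nu (a b : C) : meromorphic_disk S -> normc a < 1 -> normc b < 1 ->
  (exists2 e, 0 < e & kernel_le nu S (punctured a e)) ->
  exists2 e, 0 < e & kernel_le nu S (punctured b e).
Proof.
move=> [mS _] a1 b1; apply: propagate; first exact: kernel_le_anti.
move=> t t01; have c1 := seg_disk a1 b1 t01.
have /mS := (unit_diskP (seg a b t)).2 c1; move=> /(local_uniform nu c1)[d d0 H].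
by exists d => // p e; apply: H.
Qed.

(** The identity theorem for a meromorphic function and a rational one. *)
Lemma rational_propagate S (p q : {poly C}) (a b : C) : meromorphic_disk S ->
  normc a < 1 -> normc b < 1 ->
  (exists2 e, 0 < e & forall z, punctured a e z -> S z * q.[z] = p.[z]) ->
  exists2 e, 0 < e & forall z, punctured b e z -> S z * q.[z] = p.[z].
Proof.
move=> [mS _] a1 b1.
apply: (@propagate (fun Y => forall z, Y z -> S z * q.[z] = p.[z])) => [Y Y' YY H z /YY /H //|].
move=> t t01; have c1 := seg_disk a1 b1 t01; set c := seg a b t in c1 *.
have /mS := (unit_diskP c).2 c1; move=> /local_quotient[r [u [v [r0 Hd Hq]]]].
exists (r / 16); first by lra.
move=> c' e cc e0 H.
pose F z := v z * q.[z] + (-1) * (u z * p.[z]).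
have FE z : z != c -> normc (z - c) < r -> F z = u z * (S z * q.[z] - p.[z]).
  by move=> zc zr; rewrite /F (Hq z zc zr).2; ring.
have r2 : 0 < r / 2 by lra.
have Fd z : normc z < r / 2 -> cdiff (fun w => F (c' + w)) z.
  move=> zr; apply: cdiff_shift.
  have h : normc (c' + z - c) < r.
    by rewrite addrAC; apply: le_lt_trans (normcD _ _) _; lra.
  have [h1 h2] := Hd _ h; apply: cdiffD; first by apply: cdiffM => //; apply: cdiff_horner.
  apply: cdiffM; first exact: cdiff_cst.
  by apply: cdiffM => //; apply: cdiff_horner.
have [s [M T]] := taylor_disc r2 Fd.
pose e' := if c' == c then Num.min (r / 2) e else Num.min (Num.min (r / 2) e) (normc (c' - c)).
have e'0 : 0 < e'.
  by rewrite /e'; case: eqVneq => [_|cc']; rewrite !lt_min e0 r2 // normc_gt0 subr_eq0.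
have e'1 : e' <= r / 2 by rewrite /e'; case: ifP => _; rewrite !ge_min lexx.
have e'2 : e' <= e by rewrite /e'; case: ifP => _; rewrite !ge_min lexx ?orbT.
have F0 z : z != 0 -> normc z < e' -> F (c' + z) = 0.
  move=> z0 ze; rewrite FE.
  - rewrite H ?subrr ?mulr0 //; split; first by rewrite -subr_eq0 [c' + z]addrC addrK.
    by rewrite [c' + z]addrC addrK; lra.
  - move: ze; rewrite /e'; case: eqVneq => [-> _|cc']; first by rewrite -subr_eq0 [c + z]addrC addrK.
    rewrite lt_min => /andP[_ h]; apply: contraTneq h => <-.
    by rewrite opprD addrA subrr sub0r normcN ltxx.
  - by rewrite addrAC; apply: le_lt_trans (normcD _ _) _; lra.
have := taylor_zero T e'0 F0 => Fz z [zc zr].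
have := Fz (z - c'); rewrite [c' + _]addrC subrK FE //; last lra.
have h : normc (z - c') <= r / 2 / 4.
  by apply: le_trans (normc_tri _ c _) _; rewrite [normc (c - c')]normcB; lra.
have [u0 _] := Hq z zc ltac:(lra).
by move=> /(_ h) /eqP; rewrite mulf_eq0 (negPf u0) /= subr_eq0 => /eqP.
Qed.

Lemma holo_limit S (p q : {poly C}) c : holomorphic_at S c ->
  (exists2 e, 0 < e & forall z, punctured c e z -> S z * q.[z] = p.[z]) ->
  S c * q.[c] = p.[c].
Proof.
move=> /holomorphic_atP[r r0 Hd] [e e0 H].
pose F z := S z * q.[z] + (-1) * p.[z].
have Fd z : normc z < r -> cdiff (fun w => F (c + w)) z.
  move=> zr; apply: cdiff_shift; apply: cdiffD.
    apply: cdiffM; last exact: cdiff_horner.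
    by apply: Hd; rewrite [c + z]addrC addrK.
  by apply: cdiffM; [apply: cdiff_cst|apply: cdiff_horner].
have [s [M T]] := taylor_disc r0 Fd.
have F0 z : z != 0 -> normc z < e -> F (c + z) = 0.
  move=> z0 ze; rewrite /F H ?mulN1r ?subrr //; split.
    by rewrite -subr_eq0 [c + z]addrC addrK.
  by rewrite [c + z]addrC addrK.
have := taylor_zero T e0 F0 (z := 0); rewrite normc0 addr0 /F mulN1r => h.
by apply/eqP; rewrite -subr_eq0; apply/eqP/h; lra.
Qed.

End Continuation.

(** * Fractions as meromorphic functions *)

Section RationalFunctions.
Variable R : realType.
Local Notation C := (R[i]).
Local Notation Co := (R[i]^o).
Implicit Types (f g S : C -> C) (z w c : C) (e d D M : R) (p q : {poly C}).

Local Notation normc := (@ComplexField.Normc.normc R).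

(** The value of [p / q] at a zero of [q] is 0, since the inverse of 0 is 0: this
    is the encoding of a pole. *)
Definition rat_fun p q z : C := if normc z < 1 then p.[z] / q.[z] else 0.

Lemma disk_near z : normc z < 1 -> exists2 d, 0 < d & forall w, normc (w - z) < d -> normc w < 1.
Proof.
move=> z1; exists (1 - normc z) => [|w h]; first lra.
by have := normc_tri w z 0; rewrite !subr0; lra.
Qed.

Lemma rat_fun_cdiff p q z : normc z < 1 -> q.[z] != 0 -> cdiff (rat_fun p q) z.
Proof.
move=> z1 qz; have [d d0 Hd] := disk_near z1.
apply: (cdiff_near d0 (g := fun w => p.[w] / q.[w])).
  by move=> w wd; rewrite /rat_fun Hd.
by apply: cdiffM; [apply: cdiff_horner|apply: cdiffV => //; apply: cdiff_horner].
Qed.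

Lemma horner_near q z e : 0 < e -> exists2 d, 0 < d &
  forall w, normc (w - z) < d -> normc (q.[w] - q.[z]) < e.
Proof. by move=> e0; apply: (cdiff_cont (cdiff_horner q z)). Qed.

Lemma horner_neq0_near q z : q.[z] != 0 -> exists2 d, 0 < d &
  forall w, normc (w - z) < d -> q.[w] != 0.
Proof.
rewrite -normc_gt0 => qz; have [d d0 Hd] := horner_near q z qz.
by exists d => // w /Hd; apply: neq0_near.
Qed.

Lemma isolated_roots q z : q != 0 -> exists2 d, 0 < d &
  forall w, w != z -> normc (w - z) < d -> q.[w] != 0.
Proof.
move=> q0; have [m [q1 q1z ->]] := multiplicity_XsubC q z.
rewrite q0 /= in q1z; have [d d0 Hd] := horner_neq0_near q1z.
exists d => // w wz wd; rewrite hornerM horner_exp hornerXsubC.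
by rewrite mulf_neq0 ?Hd // expf_neq0 // subr_eq0.
Qed.

Lemma rat_fun_pole p q z : normc z < 1 -> q != 0 -> q.[z] = 0 -> p.[z] != 0 ->
  pole (rat_fun p q) z.
Proof.
move=> z1 q0 qz pz; have [d1 d10 H1] := disk_near z1.
have [d2 d20 H2] := isolated_roots z q0; apply/poleP; split.
  exists (Num.min d1 d2); first by rewrite lt_min d10.
  move=> w wz; rewrite lt_min => /andP[w1 w2].
  by apply: rat_fun_cdiff; [apply: H1|apply: H2].
move=> M; pose a := normc p.[z].
have a0 : 0 < a by rewrite /a normc_gt0.
have a2 : 0 < a / 2 by lra.
have [d3 d30 H3] := horner_near p z a2.
have M0 : 0 < `|M| + 1 by have := normr_ge0 M; lra.
have b0 : 0 < a / (2 * (`|M| + 1)) by rewrite divr_gt0 // mulr_gt0.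
have [d4 d40 H4] := horner_near q z b0.
exists (Num.min (Num.min d1 d2) (Num.min d3 d4)); first by rewrite !lt_min d10 d20 d30.
move=> w wz; rewrite !lt_min => /andP[/andP[w1 w2] /andP[w3 w4]].
rewrite /rat_fun H1 // normcM normcV ltr_pdivlMr; last by rewrite normc_gt0 H2.
have := H4 w w4; rewrite qz subr0 ltr_pdivlMr ?mulr_gt0 // => hq.
have hp : a / 2 < normc p.[w].
  have := H3 w w3 => h3; have := normc_tri p.[z] p.[w] 0; rewrite !subr0 normcB -/a; lra.
apply: le_lt_trans hp; have := ler_norm M; have := normc_ge0 q.[w]; nra.
Qed.

Lemma rat_meromorphic p q : coprimep p q -> q != 0 -> meromorphic_disk (rat_fun p q).
Proof.
move=> cop q0; split=> z; last first.
  by rewrite unit_diskP /rat_fun => /negP /negPf ->.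
move=> /unit_diskP z1; have [qz|qz] := eqVneq q.[z] 0.
  right; split; last by rewrite /rat_fun z1 qz invr0 mulr0.
  apply: rat_fun_pole => //; apply/negP => /eqP pz.
  have /(coprimep_root cop) : root p z by apply/rootP.
  by rewrite qz eqxx.
have [d1 d10 H1] := disk_near z1; have [d2 d20 H2] := horner_neq0_near qz.
left; apply/holomorphic_atP; exists (Num.min d1 d2); first by rewrite lt_min d10.
by move=> w; rewrite lt_min => /andP[w1 w2]; apply: rat_fun_cdiff; [apply: H1|apply: H2].
Qed.

Lemma holo_rat_den p q z : coprimep p q -> q != 0 -> normc z < 1 ->
  holomorphic_at (rat_fun p q) z -> q.[z] != 0.
Proof.
move=> cop q0 z1 /holomorphic_atP[r r0 Hd]; apply/negP => /eqP qz.
have pz : p.[z] != 0.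
  apply/negP => /eqP pz; have /(coprimep_root cop) : root p z by apply/rootP.
  by rewrite qz eqxx.
have /poleP[_ H] := rat_fun_pole z1 q0 qz pz.
have cz : cdiff (rat_fun p q) z by apply: Hd; rewrite subrr normc0.
have [d1 d10 H1] := cdiff_cont cz ltr01.
have [d2 d20 H2] := H (normc (rat_fun p q z) + 1).
pose t := Num.min d1 d2 / 2.
have m0 : 0 < Num.min d1 d2 by rewrite lt_min d10.
have t0 : 0 < t by rewrite /t; lra.
have nt : normc (z + t%:C%C - z) = t by rewrite [z + _]addrC addrK normc_real gtr0_norm.
have tm : t < Num.min d1 d2 by rewrite /t; lra.
move: (tm); rewrite lt_min => /andP[t1 t2].
have := H1 (z + t%:C%C); rewrite nt => /(_ t1) h1.
have wz : z + t%:C%C != z by rewrite -subr_eq0 -normc_gt0 nt.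
have := H2 _ wz; rewrite nt => /(_ t2) h2.
have := normc_tri (rat_fun p q (z + t%:C%C)) (rat_fun p q z) 0; rewrite !subr0; lra.
Qed.

(** The equation [S * q = p] is continued from the origin through the whole
    disk. At a zero of [q] it leaves no finite value for [S], because [p] does
    not vanish there; elsewhere it keeps [S] bounded, which excludes poles. *)
Lemma meromorphic_rational_eq S p q : meromorphic_disk S -> coprimep p q -> q != 0 ->
  (exists2 e, 0 < e & forall z, punctured 0 e z -> S z * q.[z] = p.[z]) -> S = rat_fun p q.
Proof.
move=> mS cop q0 near0; have [mS1 mS0] := mS.
have n01 : normc (0 : C) < 1 by rewrite normc0.
apply/funext => z; rewrite /rat_fun; case: ifPn => [z1|/negP z1]; last first.
  by apply: mS0; rewrite unit_diskP.
have loc := rational_propagate mS n01 z1 near0.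
have cz : q.[z] = 0 -> p.[z] = 0 -> False.
  move=> qz pz; have /(coprimep_root cop) : root p z by apply/rootP.
  by rewrite qz eqxx.
case: (mS1 z); first exact/unit_diskP.
  move=> /holo_limit /(_ loc) E; have qz : q.[z] != 0.
    by apply/negP => /eqP qz; apply: cz => //; rewrite -E qz mulr0.
  by rewrite -E mulfK.
move=> [hp Sz]; rewrite Sz; have [->|qz] := eqVneq q.[z] 0; first by rewrite invr0 mulr0.
have /poleP[_ H] := hp; have [e e0 He] := loc.
have [d1 d10 H1] := horner_near p z ltr01.
have q2 : 0 < normc q.[z] / 2 by rewrite divr_gt0 // normc_gt0.
have [d2 d20 H2] := horner_near q z q2.
have [d3 d30 H3] := H ((normc p.[z] + 1) / (normc q.[z] / 2)).
pose m := Num.min (Num.min d1 d2) (Num.min d3 e); pose t := m / 2.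
have m0 : 0 < m by rewrite !lt_min d10 d20 d30.
have t0 : 0 < t by rewrite /t; lra.
pose w := z + t%:C%C.
have nt : normc (w - z) = t by rewrite /w [z + _]addrC addrK normc_real gtr0_norm.
have wz : w != z by rewrite -subr_eq0 -normc_gt0 nt.
have : normc (w - z) < m by rewrite nt /t; lra.
rewrite /m !lt_min => /andP[/andP[w1 w2] /andP[w3 w4]].
have := H3 w wz w3; rewrite ltr_pdivrMr // => h3.
have := He w (conj wz w4) => E.
have h1 := H1 w w1; have h2 := H2 w w2.
have hp' : normc p.[w] < normc p.[z] + 1.
  by have := normc_tri p.[w] p.[z] 0; rewrite !subr0; lra.
have hq' : normc q.[z] / 2 <= normc q.[w].
  by have := normc_tri q.[z] q.[w] 0; rewrite !subr0 normcB; lra.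
have : normc (S w) * normc q.[w] = normc p.[w] by rewrite -normcM E.
have Sw := normc_ge0 (S w) => SE.
suff : (0 : R) < 0 by rewrite ltxx.
nra.
Qed.

(** ** The kernel of a fraction *)

Section BlaschkeKernel.
Variables (k : nat) (c : C) (q : {poly C}).
Hypothesis H : blaschke_data k c q.
Let p : {poly C} := c *: crev k q.

(** The Bezout coefficients are the coefficients of the quotient of
    [q(z) q(w)^* - p(z) p(w)^*] by [1 - z w^*]. *)
Lemma bezout_kernel z w : q.[z] * (q.[w])^* - p.[z] * (p.[w])^* =
  (1 - z * w^*) * \sum_(i < k) \sum_(j < k) z ^+ i * bezout_coef q p i j * (w ^+ j)^*.
Proof.
have [sq _ _ _] := H; have sp : (size p <= k.+1)%N by rewrite blaschke_size_num.
pose h (i j : nat) : C := q`_i * (q`_j)^* - p`_i * (p`_j)^*.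
pose term (B : nat -> nat -> C) (i j : nat) := z ^+ i * B i j * (w ^+ j)^*.
have high i j : (k <= i)%N || (k <= j)%N -> bezout_coef q p i j = 0.
  case/orP => [ki|kj]; first exact: (bezout_coef_high H).
  by rewrite -bezout_coefC (bezout_coef_high H) // conjC0.
have H0 : q.[z] * (q.[w])^* - p.[z] * (p.[w])^* = \sum_(i < k.+1) \sum_(j < k.+1) term h i j.
  rewrite !(horner_coef_wide _ sq) !(horner_coef_wide _ sp) !rmorph_sum /=.
  rewrite !mulr_suml -sumrB; apply: eq_bigr => i _.
  rewrite !mulr_sumr -sumrB; apply: eq_bigr => j _.
  by rewrite /term /h !rmorphM; ring.
have H1 : \sum_(i < k.+1) \sum_(j < k.+1) term (bezout_coef q p) i j =
    \sum_(i < k) \sum_(j < k) term (bezout_coef q p) i j.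
  rewrite big_ord_recr /= [X in _ + X]big1 ?addr0 => [|j _]; last first.
    by rewrite /term high ?leqnn // mulr0 mul0r.
  apply: eq_bigr => i _; rewrite big_ord_recr /= {2}/term high ?leqnn ?orbT //.
  by rewrite mulr0 mul0r addr0.
have H2 : \sum_(i < k.+1) \sum_(j < k.+1) term (bezout_coef q p) i j =
    \sum_(i < k.+1) \sum_(j < k.+1) term h i j +
    z * w^* * \sum_(i < k) \sum_(j < k) term (bezout_coef q p) i j.
  pose D i j := bezout_coef q p i j - h i j.
  have -> : \sum_(i < k.+1) \sum_(j < k.+1) term (bezout_coef q p) i j =
     \sum_(i < k.+1) \sum_(j < k.+1) term h i j + \sum_(i < k.+1) \sum_(j < k.+1) term D i j.
    rewrite -big_split; apply: eq_bigr => i _ /=; rewrite -big_split; apply: eq_bigr => j _ /=.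
    by rewrite /term /D; ring.
  congr (_ + _); have D0 j : D 0%N j = 0.
    by rewrite /D /bezout_coef min0n big_ord_recl big_ord0 !subn0 addr0 subrr.
  have D1 i : D i 0%N = 0.
    by rewrite /D /bezout_coef minn0 big_ord_recl big_ord0 !subn0 addr0 subrr.
  rewrite big_ord_recl big1 ?add0r => [|j _]; last by rewrite /term D0 mulr0 mul0r.
  rewrite mulr_sumr; apply: eq_bigr => i _.
  rewrite big_ord_recl {1}/term D1 mulr0 mul0r add0r mulr_sumr; apply: eq_bigr => j _.
  rewrite /term /D /bump /= ?add1n bezout_coefS /h !exprS rmorphM.
  by ring.
have -> : \sum_(i < k) \sum_(j < k) z ^+ i * bezout_coef q p i j * (w ^+ j)^* =
    \sum_(i < k) \sum_(j < k) term (bezout_coef q p) i j by [].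
by rewrite H0 mulrBl mul1r -{1}H1 H2 addrK.
Qed.

Lemma bezout_kernel_mx m (w : 'I_m -> C) (V := \matrix_(i < m, l < k) w i ^+ l) :
  (forall i, normc (w i) < 1) ->
  kernel_mx (pair_kernel (horner q) (horner p)) w = V *m bezout_mx q p k *m V^t*.
Proof.
move=> w1; apply/matrixP => i j; rewrite mxE /pair_kernel bezout_kernel.
rewrite mulrAC mulfV ?mul1r; last by apply: one_sub_mul_neq0 => //; apply: ltW.
rewrite exchange_big /= mxE; apply: eq_bigr => l _; rewrite !mxE mulr_suml.
by apply: eq_bigr => l' _; rewrite !mxE.
Qed.

Lemma kernel_scale_mx (K K' : C -> C -> C) m (w d : 'I_m -> C) :
  (forall i j, K (w j) (w i) = d i * K' (w j) (w i) * (d j)^*) ->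
  kernel_mx K w = diag_mx (\row_i d i) *m kernel_mx K' w *m (diag_mx (\row_i d i))^t*.
Proof.
move=> HK; apply/matrixP => i j; rewrite mxE HK mxE (bigD1 j) //= big1 ?addr0 => [|l lj].
  by rewrite mul_diag_mx !mxE eqxx mulr1n.
by rewrite mul_diag_mx !mxE; move: lj; rewrite eq_sym => /negPf ->; rewrite mulr0n conjC0 mulr0.
Qed.

(** The kernel factors through the [k] by [k] Bezout matrix by the powers of
    the points; [k] distinct points make this factor an invertible Vandermonde
    matrix. *)
Lemma rational_squares S (X : set C) : (forall z, X z -> normc z < 1 /\ S z * q.[z] = p.[z]) ->
  (exists2 w : nat -> C, injective w & forall i, X (w i)) ->
  negative_squares X (schur_kernel S) (neg_index (bezout_mx q p k)) /\
  positive_squares X (schur_kernel S) (pos_index (bezout_mx q p k)).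
Proof.
move=> HX [w0 w0inj w0X]; have [_ _ _ cop] := H.
have qX z : X z -> q.[z] != 0.
  move=> /HX[_ E]; apply/negP => /eqP qz.
  have /(coprimep_root cop) : root (c *: crev k q) z by apply/rootP; rewrite -/p -E qz mulr0.
  by rewrite qz eqxx.
have SX z : X z -> p.[z] = q.[z] * S z by move=> /HX[_ <-]; rewrite mulrC.
have hB := bezout_herm q p k.
have up m (w : 'I_m -> C) : (forall i, X (w i)) -> exists P : 'M[C]_(m, k),
    kernel_mx (schur_kernel S) w = P *m bezout_mx q p k *m P^t*.
  move=> wX; have w1 i : normc (w i) < 1 by have [] := HX _ (wX i).
  rewrite (kernel_scale_mx (K' := pair_kernel (horner q) (horner p)) (d := fun i => (q.[w i])^-1)).
    rewrite bezout_kernel_mx //; eexists; rewrite !mulmxA.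
    by rewrite -[_ *m _^t* *m _^t*]mulmxA -adjmx_mul.
  move=> i j; have qi := qX _ (wX i); have qj := qX _ (wX j).
  rewrite /pair_kernel /schur_kernel !SX // !rmorphM fmorphV /=.
  have qj' : (q.[w j])^* != 0 by rewrite conjC_eq0.
  have n1 : 1 - w i * (w j)^* != 0 by apply: one_sub_mul_neq0 => //; apply: ltW.
  by field; rewrite qi qj' n1.
pose w (i : 'I_k) := w0 i; have wX i : X (w i) by apply: w0X.
have winj (i j : 'I_k) : w i = w j -> i = j by move=> /w0inj /val_inj.
have [U UE] := vandermonde_left_inverse (x := w0) winj.
pose V := \matrix_(i < k, l < k) w i ^+ l.
have UV : U *m V = 1%:M.
  by apply/matrixP => i l; rewrite !mxE -UE; apply: eq_bigr => a _; rewrite mxE.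
have low : exists P : 'M[C]_k, bezout_mx q p k = P *m kernel_mx (schur_kernel S) w *m P^t*.
  have w1 i : normc (w i) < 1 by have [] := HX _ (wX i).
  have := bezout_kernel_mx w1; rewrite (kernel_scale_mx (K' := schur_kernel S) (d := fun i => q.[w i])).
    set D := diag_mx _ => E; exists (U *m D).
    have := congr1 (fun A => U *m A *m U^t*) E; rewrite /= !mulmxA UV mul1mx.
    rewrite -[_ *m V^t* *m U^t*]mulmxA -adjmx_mul UV adjmx1 mulmx1 => <-.
    by rewrite adjmx_mul !mulmxA.
  move=> i j; have qi := qX _ (wX i); have qj := qX _ (wX j).
  rewrite /pair_kernel /schur_kernel !SX // !rmorphM /=.
  have n1 : 1 - w i * (w j)^* != 0 by apply: one_sub_mul_neq0 => //; apply: ltW.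
  by field.
have [P PE] := low; split; split.
- by move=> m v vX; have [Q ->] := up m v vX; apply: neg_index_congr_le.
- exists k, w; split; first exact: wX; apply/eqP; rewrite eqn_leq; apply/andP; split.
    by have [Q ->] := up k w wX; apply: neg_index_congr_le.
  by rewrite {1}PE; apply: neg_index_congr_le; apply: schur_kernel_herm.
- by move=> m v vX; have [Q ->] := up m v vX; apply: pos_index_congr_le.
- exists k, w; split; first exact: wX; apply/eqP; rewrite eqn_leq; apply/andP; split.
    by have [Q ->] := up k w wX; apply: pos_index_congr_le.
  by rewrite {1}PE; apply: pos_index_congr_le; apply: schur_kernel_herm.
Qed.

End BlaschkeKernel.

Lemma squares_unique (index : forall m, 'M[R[i]]_m -> nat) X (K : C -> C -> C) k l :
  has_squares index X K k -> has_squares index X K l -> k = l.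
Proof.
move=> [h1 [m1 [w1 [X1 E1]]]] [h2 [m2 [w2 [X2 E2]]]].
have l1 := h1 m2 w2 X2; have l2 := h2 m1 w1 X1.
by rewrite E2 in l1; rewrite E1 in l2; apply/eqP; rewrite eqn_leq l1 l2.
Qed.

Lemma open_points (X : set C) c e : 0 < e -> (forall z, normc (z - c) < e -> X z) ->
  exists2 w : nat -> C, injective w & forall i, X (w i).
Proof.
move=> e0 HX; have i0 i : 0 < i.+2%:R :> R by [].
exists (fun i => c + (e / i.+2%:R)%:C%C) => [i j /addrI /complexI /(mulfI (lt0r_neq0 e0))|i].
  by move=> /invr_inj /eqP; rewrite eqr_nat => /eqP[].
apply: HX; rewrite [c + _]addrC addrK normc_real gtr0_norm ?divr_gt0 //.
by rewrite ltr_pdivrMr // ltr_pMr // ltr1n.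
Qed.

End RationalFunctions.

(** * Interpolation and the Schur classes *)

Section Solutions.
Variable R : realType.
Local Notation C := (R[i]).
Local Notation Co := (R[i]^o).
Implicit Types (f g S : C -> C) (z w c : C) (e d D M : R) (p q : {poly C}) (s t : nat -> C).

Local Notation normc := (@ComplexField.Normc.normc R).

Lemma partial_horner s n z : partial s n z = (series_poly s n).[z].
Proof.
rewrite (horner_coef_wide _ (size_poly _ _)); apply: eq_bigr => k _.
by rewrite coef_poly ltn_ord.
Qed.

Lemma scong_partial s n q p : scong s n q p ->
  exists g : {poly C}, forall z, partial s n z * q.[z] - p.[z] = z ^+ n * g.[z].
Proof.
move=> /dvdpP[g E]; exists g => z.
have := congr1 (fun r : {poly C} => r.[z]) E.
by rewrite /= hornerD hornerN !hornerM partial_horner hornerXn mulrC => ->; rewrite mulrC.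
Qed.

Lemma horner_bounded q : exists2 M, 0 <= M & exists2 d, 0 < d &
  forall z, normc z < d -> normc q.[z] <= M.
Proof.
have [d d0 Hd] := horner_near q 0 ltr01.
exists (normc q.[0] + 1); first by have := normc_ge0 q.[0]; lra.
exists d => // z zd; have := Hd z; rewrite subr0 => /(_ zd).
have := normc_tri q.[z] q.[0] 0; rewrite !subr0; lra.
Qed.

Definition agrees s n S := exists M, exists2 d, 0 < d &
  forall z, normc z < d -> normc (S z - partial s n z) <= M * normc z ^+ n.

Lemma interpolatesP (a : seq C) n S :
  interpolates a n S <-> holomorphic_at S 0 /\ agrees (nth 0 a) n S.
Proof.
have cmp M z (x : C) : (`|x| <= M%:C%C * `|z| ^+ n) = (normc x <= M * normc z ^+ n).
  by rewrite !norm_normc -rmorphXn -rmorphM lecR.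
split=> -[h [M H]]; split=> //; exists M.
  have /nearC[d d0 Hd] := H; exists d => // z zd.
  by rewrite -cmp; apply: Hd; rewrite subr0.
have [d d0 Hd] := H; apply/nearC; exists d => // z; rewrite subr0 => zd.
have := Hd z zd; rewrite -cmp; exact.
Qed.

Lemma rat_fun_agrees s n q p : q`_0 != 0 -> scong s n q p -> agrees s n (rat_fun p q).
Proof.
rewrite -horner_coef0 => q0 /scong_partial[g Hg].
have [M M0 [d1 d10 H1]] := horner_bounded g.
have q2 : 0 < normc q.[0] / 2 by rewrite divr_gt0 // normc_gt0.
have [d2 d20 H2] := horner_near q 0 q2.
exists (M / (normc q.[0] / 2)); exists (Num.min 1 (Num.min d1 d2)).
  by rewrite !lt_min ltr01 d10.
move=> z; rewrite !lt_min => /andP[z1 /andP[zd1 zd2]].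
have hq : normc q.[0] / 2 <= normc q.[z].
  have := H2 z; rewrite subr0 => /(_ zd2) h.
  have := normc_tri q.[0] q.[z] 0; rewrite !subr0 normcB; lra.
have qz : q.[z] != 0 by rewrite -normc_gt0; lra.
have -> : rat_fun p q z - partial s n z = - (z ^+ n * g.[z]) / q.[z].
  by rewrite -Hg /rat_fun z1; field.
rewrite normcM normcV normcN normcM normcX ler_pdivrMr; last lra.
rewrite [_ * normc z ^+ n]mulrC -mulrA; apply: ler_wpM2l; first by rewrite exprn_ge0 ?normc_ge0.
apply: le_trans (H1 z zd1) _; rewrite mulrAC ler_pdivlMr //.
by apply: ler_wpM2l.
Qed.

Lemma holo_taylor S : holomorphic_at S 0 -> exists r s M, taylor S r s M /\ r <= 1 / 2.
Proof.
move=> /holomorphic_atP[r r0 Hd]; pose r' := Num.min r 1.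
have r'0 : 0 < r' by rewrite lt_min r0 ltr01.
have r'1 : r' <= 1 by rewrite ge_min lexx orbT.
have Hd' w : normc w < r' -> cdiff S w.
  by rewrite lt_min => /andP[wr _]; apply: Hd; rewrite subr0.
have [s [M T]] := taylor_disc r'0 Hd'.
by exists (r' / 4), s, M; split=> //; lra.
Qed.

Lemma agrees_taylor s n S r t M : agrees s n S -> taylor S r t M ->
  forall k, (k < n)%N -> t k = s k.
Proof.
move=> [D [d d0 H]] T; apply: (taylor_eq T d0 (D := D)) => z _ zd; exact: H.
Qed.

Lemma taylor_one r : 0 < r -> @taylor R (fun _ => 1) r (fun k => (k == 0%N)%:R) 1.
Proof.
move=> r0; split=> // -[|K] z zr.
  by rewrite big_ord0 subr0 expr0 mulr1 normc1.
rewrite big_ord_recl /= expr0 mulr1 big1 ?addr0 => [|i _]; last by rewrite mul0r.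
rewrite subrr normc0 mul1r exprn_ge0 // divr_ge0 ?normc_ge0 //; lra.
Qed.

Lemma kernel_le_defect S r t M nu : taylor S r t M -> r <= 1 / 2 ->
  (exists2 e, 0 < e & kernel_le nu S (punctured 0 e)) ->
  forall m, (neg_index (defect t m) <= nu)%N.
Proof.
move=> T r1 [e e0 HK] m; have [r0 _ _] := T.
have mm1 : M <= Num.max M 1 by rewrite le_max lexx.
have mm2 : 1 <= Num.max M 1 by rewrite le_max lexx orbT.
rewrite -pair_defect_one.
apply: (defect_index_le (taylor_mono mm2 (taylor_one r0)) (taylor_mono mm1 T) r1 e0).
move=> k w Hw; rewrite schur_kernel_pair; apply: HK => i.
by have [w0 we] := Hw i; split; rewrite ?subr0.
Qed.

(** Exchanging [S] and the constant 1 changes the sign of the kernel. *)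
Lemma positive_kernel_defect S r t M pi : taylor S r t M -> r <= 1 / 2 ->
  (exists2 e, 0 < e & forall m (w : 'I_m -> C), (forall i, punctured 0 e (w i)) ->
     (pos_index (kernel_mx (schur_kernel S) w) <= pi)%N) ->
  forall m, (pos_index (defect t m) <= pi)%N.
Proof.
move=> T r1 [e e0 HK] m; have [r0 _ _] := T.
have mm1 : M <= Num.max M 1 by rewrite le_max lexx.
have mm2 : 1 <= Num.max M 1 by rewrite le_max lexx orbT.
rewrite -[defect t m]opprK -neg_index_opp; last by rewrite adjmxN defect_herm.
rewrite -pair_defect_one -pair_defectN.
apply: (defect_index_le (taylor_mono mm1 T) (taylor_mono mm2 (taylor_one r0)) r1 e0).
move=> k w Hw; rewrite neg_index_opp; last exact: pair_kernel_herm.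
have -> : - kernel_mx (pair_kernel S (fun _ => 1)) w = kernel_mx (schur_kernel S) w.
  apply/matrixP => i j; rewrite !mxE -schur_kernel_pair /pair_kernel -mulNr; congr (_ / _); ring.
apply: HK => i; by have [w0 we] := Hw i; split; rewrite ?subr0.
Qed.

Lemma holo_domain_near S : holomorphic_at S 0 -> exists2 e, 0 < e &
  forall z, punctured 0 e z -> holo_domain S z.
Proof.
move=> /holomorphic_atP[r r0 Hd]; exists (Num.min 1 (r / 2)); first by rewrite lt_min ltr01 divr_gt0.
move=> z [_]; rewrite subr0 lt_min => /andP[z1 zr]; split; first exact/unit_diskP.
apply/holomorphic_atP; exists (r / 2); first by rewrite divr_gt0.
by move=> w wz; apply: Hd; apply: le_lt_trans (normc_tri _ z _) _; rewrite subr0; lra.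
Qed.

Lemma open_ball_at (X : set Co) (z : C) : open X -> X z ->
  exists2 e, 0 < e & forall w, normc (w - z) < e -> X w.
Proof. by move=> oX Xz; apply/(nearC z X); apply: open_nbhs_nbhs. Qed.

(** The bound is assumed only on some region of the disk; it is first continued
    along a segment to the origin. *)
Lemma schur_class_defect nu S r t M : schur_class nu S -> taylor S r t M -> r <= 1 / 2 ->
  forall m, (neg_index (defect t m) <= nu)%N.
Proof.
move=> [mS [X [f [[[oX _ [x0 Xx0]] XD] _ [sq _] Sf]]]] T r1; apply: (kernel_le_defect T r1).
have [e e0 He] := open_ball_at oX Xx0.
apply: (kernel_propagate mS (a := x0)).
- exact/unit_diskP/XD.
- by rewrite normc0.
exists e => // m w Hw; have wX i : X (w i) by apply: He; have [] := Hw i.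
have -> : kernel_mx (schur_kernel S) w = kernel_mx (schur_kernel f) w.
  by apply/matrixP => i j; rewrite !mxE /schur_kernel !Sf.
exact: sq.
Qed.

Lemma schur_class2_defect nu pi S r t M : schur_class2 nu pi S -> holomorphic_at S 0 ->
  taylor S r t M -> r <= 1 / 2 ->
  forall m, (neg_index (defect t m) <= nu)%N /\ (pos_index (defect t m) <= pi)%N.
Proof.
move=> [mS [neg _] [pos _]] hS T r1 m; have [e e0 He] := holo_domain_near hS; split.
  by apply: (kernel_le_defect T r1); exists e => // k w Hw; apply: neg => i; apply: He.
by apply: (positive_kernel_defect T r1); exists e => // k w Hw; apply: pos => i; apply: He.
Qed.

(** ** Fractions as solutions *)

(** A relatively open and closed subset is continued along segments. *)
Lemma disc_region e : 0 < e -> region [set z : Co | normc z < e].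
Proof.
move=> e0; split; last by exists 0; have h : normc (0 : C) < e by rewrite normc0.
  rewrite openE => z /= ze; apply/nearC; exists (e - normc z); first lra.
  by move=> w h /=; have := normc_tri w z 0; rewrite !subr0; lra.
move=> B [b Bb] [U oU BU] [F cF BF]; apply/seteqP; split=> [z|z /= ze].
  by rewrite BU => -[].
have in_disc w : B w -> normc w < e by rewrite BU => -[].
have near_in w : B w -> exists2 d, 0 < d & forall u, normc (u - w) < d -> normc u < e -> B u.
  rewrite {1}BU => -[_ Uw]; have [d d0 Hd] := open_ball_at oU Uw.
  by exists d => // u uw ue; rewrite BU; split=> //; apply: Hd.
have near_out w : normc w < e -> ~ B w -> exists2 d, 0 < d & forall u, normc (u - w) < d -> ~ B u.
  move=> we nBw; have nF : (~` F) w by move=> Fw; apply: nBw; rewrite BF.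
  have [d d0 Hd] := open_ball_at (closed_openC cF) nF.
  by exists d => // u uw; rewrite BF => -[_ Fu]; apply: (Hd u uw).
have [] := @propagate R (fun Y => forall u, Y u -> normc u < e -> B u) b z.
- by move=> Y Y' YY H u /YY; apply: H.
- move=> x x01; set p := seg b z x.
  have pe : normc p < e.
    have /andP[x0 x1] := x01; have -> : p = (1 - x)%:C%C * b + x%:C%C * z.
      by rewrite /p /seg rmorphB rmorph1 /=; ring.
    apply: le_lt_trans (normcD _ _) _; rewrite !normcM !normc_real !ger0_norm //; last lra.
    have be := in_disc b Bb; pose m := Num.max (normc b) (normc z).
    have m1 : m < e by rewrite gt_max be.
    have bm : normc b <= m by rewrite le_max lexx.
    have zm : normc z <= m by rewrite le_max lexx orbT.
    by apply: le_lt_trans m1; nra.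
  have [Bp|nBp] := pselect (B p).
    have [d d0 Hd] := near_in p Bp.
    by exists d => // c e' _ _ _ u [_ up] ue; apply: Hd.
  have [d d0 Hd] := near_out p pe nBp.
  exists (Num.min d (e - normc p)); first by rewrite lt_min d0; lra.
  move=> c e' + e'0 H; rewrite lt_min => /andP[cd ce].
  pose m := Num.min (d - normc (c - p)) (Num.min e' (e - normc p - normc (c - p))).
  have m0 : 0 < m by rewrite !lt_min e'0; apply/andP; split; lra.
  pose u := c + (m / 2)%:C%C.
  have m2 : 0 < m / 2 by lra.
  have nu : normc (u - c) = m / 2 by rewrite /u [c + _]addrC addrK normc_real gtr0_norm.
  have : normc (u - c) < m by rewrite nu; lra.
  rewrite /m !lt_min => /andP[u1 /andP[u2 u3]].
  exfalso; apply: (Hd u); first by apply: le_lt_trans (normc_tri _ c _) _; lra.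
  apply: H; first by split=> //; rewrite -subr_eq0 -normc_gt0 nu.
  have := normc_tri u c 0; have := normc_tri c p 0; rewrite !subr0; lra.
- have [d d0 Hd] := near_in b Bb; exists d => // u [_]; exact: Hd.
- move=> d d0 H; apply: contrapT => nBz; have [d' d'0 Hd'] := near_out z ze nBz.
  pose m := Num.min (Num.min d d') (e - normc z).
  have m0 : 0 < m by rewrite !lt_min d0 d'0 subr_gt0.
  pose u := z + (m / 2)%:C%C; have m2 : 0 < m / 2 by lra.
  have nu : normc (u - z) = m / 2 by rewrite /u [z + _]addrC addrK normc_real gtr0_norm.
  have : normc (u - z) < m by rewrite nu; lra.
  rewrite /m !lt_min => /andP[/andP[u1 u2] u3].
  apply: (Hd' u) => //; apply: H; first by split=> //; rewrite -subr_eq0 -normc_gt0 nu.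
  have := normc_tri u z 0; rewrite !subr0; lra.
Qed.

Lemma blaschke_den0 k c q : blaschke_data k c q -> q != 0.
Proof. by case=> _ q0 _ _; apply: contraNneq q0 => ->; rewrite coef0. Qed.

Lemma rational_solution k c q (p := c *: crev k q) : blaschke_data k c q ->
  [/\ holomorphic_at (rat_fun p q) 0,
      schur_class (neg_index (bezout_mx q p k)) (rat_fun p q) &
      schur_class2 (neg_index (bezout_mx q p k)) (pos_index (bezout_mx q p k)) (rat_fun p q)].
Proof.
move=> H; have q0 := blaschke_den0 H; have [_ q00 _ cop] := H.
have mS := rat_meromorphic cop q0.
rewrite -horner_coef0 in q00; have [d d0 Hd] := horner_neq0_near q00.
pose e := Num.min 1 d; have e0 : 0 < e by rewrite lt_min ltr01.
have den z : normc z < e -> normc z < 1 /\ q.[z] != 0.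
  by rewrite lt_min => /andP[z1 zd]; split=> //; apply: Hd; rewrite subr0.
have hS : holomorphic_at (rat_fun p q) 0.
  apply/holomorphic_atP; exists e => // w; rewrite subr0 => /den[w1 qw].
  exact: rat_fun_cdiff.
have eqS z : normc z < 1 -> q.[z] != 0 -> rat_fun p q z * q.[z] = p.[z].
  by move=> z1 qz; rewrite /rat_fun z1 divfK.
split=> //.
  split=> //; exists [set z : Co | normc z < e], (rat_fun p q); split=> //.
  - split; first exact: disc_region.
    by move=> z /den[z1 _]; apply/unit_diskP.
  - by move=> z /den[z1 qz]; apply/(derivable_cdiffP (rat_fun p q)); apply: rat_fun_cdiff.
  - have [] // := @rational_squares R k c q H (rat_fun p q) [set z : Co | normc z < e].
      by move=> z /den[z1 qz]; split=> //; apply: eqS.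
    by apply: (open_points (c := 0) e0) => z; rewrite subr0.
have [e1 e10 He1] := holo_domain_near hS.
have [] // := @rational_squares R k c q H (rat_fun p q) (holo_domain (rat_fun p q)).
  move=> z [/unit_diskP z1 hz]; split=> //; apply: eqS => //.
  exact: holo_rat_den hz.
pose c1 : C := (e1 / 2)%:C%C; have e2 : 0 < e1 / 2 by lra.
apply: (open_points (c := c1) e2) => z zc; apply: He1.
have nc1 : normc c1 = e1 / 2 by rewrite normc_real gtr0_norm.
split; first by apply: contraTneq zc => ->; rewrite sub0r normcN nc1 ltxx.
by have := normc_tri z c1 0; rewrite !subr0; lra.
Qed.

(** The nonsingular leading block of size [k] already has the full rank, so its
    indices are those of the whole matrix. *)
Lemma blaschke_indices k c q (p := c *: crev k q) t m : blaschke_data k c q ->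
  scong t m q p -> k = \rank (defect t m) -> (k <= m)%N -> defect t k \in unitmx ->
  pos_index (bezout_mx q p k) = pos_index (defect t m) /\
  neg_index (bezout_mx q p k) = neg_index (defect t m).
Proof.
move=> H sc kE km ku; have [_ q0 _ _] := H.
have [-> ->] := bezout_index q0 (scong_trunc km sc).
have [h1 h2] := index_defect_le t km.
move: ku; rewrite unit_index_sum => /eqP E; move: kE; rewrite rank_defect; lia.
Qed.

(** ** Solutions with few squares are fractions *)

Lemma rational_near S r t M q p : holomorphic_at S 0 -> taylor S r t M ->
  (forall m, scong t m q p) -> exists2 e, 0 < e & forall z, punctured 0 e z -> S z * q.[z] = p.[z].
Proof.
move=> /holomorphic_atP[r1 r10 Hd] T sc.
pose F z := S z * q.[z] + (-1) * p.[z].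
have Fd z : normc z < r1 -> cdiff F z.
  move=> zr; apply: cdiffD; first by apply: cdiffM; [apply: Hd; rewrite subr0|apply: cdiff_horner].
  by apply: cdiffM; [apply: cdiff_cst|apply: cdiff_horner].
have [u [M1 TF]] := taylor_disc r10 Fd.
have u0 k : u k = 0.
  have [g Hg] := scong_partial (sc k.+1); have [r0 M0 H] := T.
  have [A A0 [d1 d10 H1]] := horner_bounded q; have [B B0 [d2 d20 H2]] := horner_bounded g.
  apply: (taylor_eq TF (n := k.+1) (a := fun _ => 0) (d := Num.min r (Num.min d1 d2))
    (D := M / (2 * r) ^+ k.+1 * A + B)) (ltnSn k); first by rewrite !lt_min r0 d10.
  move=> z _; rewrite !lt_min => /andP[zr /andP[z1 z2]].
  rewrite big1 ?subr0 => [|i _]; last by rewrite mul0r.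
  have -> : F z = (S z - partial t k.+1 z) * q.[z] + z ^+ k.+1 * g.[z].
    by rewrite -Hg /F; ring.
  apply: le_trans (normcD _ _) _; rewrite !normcM normcX mulrDl; apply: lerD.
    have -> : M / (2 * r) ^+ k.+1 * A * normc z ^+ k.+1 = M * (normc z / (2 * r)) ^+ k.+1 * A.
      by rewrite expr_div_n; ring.
    by apply: ler_pM; rewrite ?normc_ge0 ?H1 // H // ltW.
  by rewrite mulrC; apply: ler_wpM2r; [rewrite exprn_ge0 ?normc_ge0|apply: H2].
exists (r1 / 4); first by lra.
move=> z [_]; rewrite subr0 => /ltW zr; have := taylor_null TF u0 zr.
by rewrite /F mulN1r => /eqP; rewrite subr_eq0 => /eqP.
Qed.

Definition is_fraction S t m k c q := [/\ blaschke_data k c q, S = rat_fun (c *: crev k q) q,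
  k = \rank (defect t m), (k < m)%N & defect t k \in unitmx /\
  forall n, scong t n q (c *: crev k q)].

Lemma solution_rational S r t M m : meromorphic_disk S -> holomorphic_at S 0 ->
  taylor S r t M -> (0 < m)%N ->
  (forall k, (pos_index (defect t (m + k)) < pos_index (defect t m) + dim_ker (defect t m))%N \/
    (neg_index (defect t (m + k)) < neg_index (defect t m) + dim_ker (defect t m))%N) ->
  exists k c q, is_fraction S t m k c q.
Proof.
case: m => // m mS hS T _ /defect_rational[k [c [q [km H sc]]]].
have ku := defect_blaschke_unit H (sc k).
have rk : k = \rank (defect t m.+1).
  apply/eqP; rewrite eqn_leq (rank_defect_blaschke H (sc m.+1)) andbT.
  have := rank_defect_le t (leqW km).
  by move: ku; rewrite -row_free_unit /row_free => /eqP ->.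
exists k, c, q; split=> //; apply: meromorphic_rational_eq => //.
- by case: H.
- exact: blaschke_den0 H.
- exact: rational_near hS T sc.
Qed.

Lemma fraction_class S t m k c q : is_fraction S t m k c q ->
  schur_class (neg_index (defect t m)) S /\
  schur_class2 (neg_index (defect t m)) (pos_index (defect t m)) S.
Proof.
move=> [H -> kE /ltnW km [ku sc]]; have [E1 E2] := blaschke_indices H (sc m) kE km ku.
by have [_] := rational_solution H; rewrite E1 E2.
Qed.

(** A region has infinitely many points, so the number of squares of a fraction
    on it is the index of the Bezout matrix. *)
Lemma schur_class_unique nu nu' k c q : blaschke_data k c q ->
  schur_class nu (rat_fun (c *: crev k q) q) ->
  nu' = neg_index (bezout_mx q (c *: crev k q) k) -> nu = nu'.
Proof.
move=> H [mS [X [f [[[oX _ [x0 Xx0]] XD] fd sq Sf]]]] ->.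
have [_ _ _ cop] := H.
have [e e0 He] := open_ball_at oX Xx0.
have [|sq' _] := @rational_squares R k c q H f X _ (open_points e0 He).
  move=> z Xz; have z1 : normc z < 1 by apply/unit_diskP/XD.
  split=> //; have [d d0 Hd] := open_ball_at oX Xz.
  have hz : holomorphic_at (rat_fun (c *: crev k q) q) z.
    apply/holomorphic_atP; exists (d / 2) => [|w wd]; first by rewrite divr_gt0.
    have d2 : 0 < d / 2 by lra.
    apply: (cdiff_near d2 (g := f)) => [u uw|].
      by apply: Sf; apply: Hd; apply: le_lt_trans (normc_tri _ w _) _; lra.
    by apply/(derivable_cdiffP f)/fd/Hd; lra.
  have qz := holo_rat_den cop (blaschke_den0 H) z1 hz.
  by rewrite -Sf // /rat_fun z1 divfK.
exact: squares_unique sq sq'.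
Qed.

(** Too few negative squares for a full jump at every order make the function a
    fraction, whose number of squares is then known. *)
Lemma class_alternative nu S r t M m : schur_class nu S -> holomorphic_at S 0 ->
  taylor S r t M -> r <= 1 / 2 -> (0 < m)%N ->
  (nu < neg_index (defect t m) + dim_ker (defect t m))%N ->
  nu = neg_index (defect t m) /\ exists k c q, is_fraction S t m k c q.
Proof.
move=> cS hS T r1 m0 lt; have [mS _] := cS; have le := schur_class_defect cS T r1.
have [|k [c [q F]]] := solution_rational mS hS T m0.
  by move=> k; right; apply: leq_ltn_trans (le _) lt.
split; last by exists k, c, q.
have [H SE kE /ltnW km [ku sc]] := F; have [_ E2] := blaschke_indices H (sc m) kE km ku.
by rewrite SE in cS; rewrite -E2; apply: schur_class_unique H cS _.
Qed.

Lemma class2_alternative nu pi S r t M m : schur_class2 nu pi S -> holomorphic_at S 0 ->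
  taylor S r t M -> r <= 1 / 2 -> (0 < m)%N ->
  (nu < neg_index (defect t m) + dim_ker (defect t m))%N \/
  (pi < pos_index (defect t m) + dim_ker (defect t m))%N ->
  [/\ nu = neg_index (defect t m), pi = pos_index (defect t m) &
      exists k c q, is_fraction S t m k c q].
Proof.
move=> cS hS T r1 m0 lt; have [mS neg pos] := cS; have le := schur_class2_defect cS hS T r1.
have [|k [c [q F]]] := solution_rational mS hS T m0.
  move=> k; have [l1 l2] := le (m + k)%N.
  by case: lt => lt; [right; apply: leq_ltn_trans l1 lt|left; apply: leq_ltn_trans l2 lt].
have [_ [_ neg' pos']] := fraction_class F.
split; [exact: squares_unique neg neg'|exact: squares_unique pos pos'|by exists k, c, q].
Qed.

(** The fractions differ in the Taylor coefficient of index [pi + nu]. *)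
Lemma family_infinite (s : nat -> C) n nu pi : (0 < n)%N ->
  (pos_index (defect s n) + dim_ker (defect s n) <= pi)%N ->
  (neg_index (defect s n) + dim_ker (defect s n) <= nu)%N ->
  infinite_set [set S : C -> C | [/\ schur_class2 nu pi S, schur_class nu S,
    holomorphic_at S 0 & agrees s n S]].
Proof.
move=> n0 hpi hnu; have [f [nle fs finj fH]] := blaschke_family n0 hpi hnu.
have /choice[F HF] : forall u : nat, exists S : C -> C,
    [/\ schur_class2 nu pi S, schur_class nu S, holomorphic_at S 0 & agrees (f u) (pi + nu).+1 S].
  move=> u; have [c [q [H sc E1 E2]]] := fH u; exists (rat_fun (c *: crev (pi + nu) q) q).
  have [h1 h2 h3] := rational_solution H; rewrite E1 E2 in h2 h3; split=> //.
  by apply: rat_fun_agrees sc; case: H.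
have Finj : injective F.
  move=> u v uv; apply: finj; have [_ _ hu au] := HF u; have [_ _ _ av] := HF v.
  have [r [t [M [T _]]]] := holo_taylor hu.
  have T' : taylor (F v) r t M by rewrite -uv.
  by rewrite -(agrees_taylor au T (ltnSn _)) (agrees_taylor av T' (ltnSn _)).
move=> fin; apply: infinite_nat.
rewrite -(eq_finite_set (inj_card_eq (A := [set: nat]) (f := F) _)); last by move=> u v _ _; apply: Finj.
apply: sub_finite_set fin => _ [u _ <-]; have [h1 h2 h3 [M [d d0 Hd]]] := HF u; split=> //.
have [r [t [M' [T r1]]]] := holo_taylor h3; have [r0 M'0 H] := T.
exists (M' / (2 * r) ^+ n); exists r => // z zr.
have ts k : (k < n)%N -> t k = s k.
  move=> kn; rewrite -(fs u k kn); apply: (agrees_taylor _ T (n := (pi + nu).+1)); first by exists M, d.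
  by rewrite ltnS ltnW // (leq_trans kn).
have -> : partial s n z = partial t n z by apply: eq_bigr => k _; rewrite ts.
by apply: le_trans (H n z (ltW zr)) _; rewrite expr_div_n mulrA mulrAC.
Qed.

End Solutions.

(** * The alternatives for given data *)

Section Data.
Variables (R : realType) (n : nat).
Local Notation C := (R[i]).
Hypothesis hn : (0 < n)%N.
Variable s : nat -> C.
Implicit Types (S : C -> C).

Local Notation N := (defect s n).
Local Notation d := (dim_ker N).
Local Notation normc := (@ComplexField.Normc.normc R).

Definition solves S := holomorphic_at S 0 /\ agrees s n S.

Let defect_taylor S r (t : nat -> C) M : solves S -> taylor S r t M ->
  forall m, (m <= n)%N -> defect t m = defect s m.
Proof.
move=> [_ ag] T m mn; apply: defect_eq => k km; apply: (agrees_taylor ag T).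
exact: leq_trans km mn.
Qed.

Lemma few_negative_squares nu S : schur_class nu S -> solves S ->
  (nu < neg_index N + d)%N ->
  [/\ nu = neg_index N, defect s (\rank N) \in unitmx, (\rank N < n)%N &
   exists c q, [/\ blaschke_data (\rank N) c q, S = rat_fun (c *: crev (\rank N) q) q,
     scong s n q (c *: crev (\rank N) q) & schur_class2 (neg_index N) (pos_index N) S]].
Proof.
move=> cS sS lt; have [hS ag] := sS; have [r [t [M [T r1]]]] := holo_taylor hS.
have E := defect_taylor sS T; have EN := E n (leqnn n); rewrite -EN in lt.
have [-> [k [c [q F]]]] := class_alternative cS hS T r1 hn lt.
have [_ c2] := fraction_class F; have [H SE kE kn [ku sc]] := F.
have Ek := E k (ltnW kn); rewrite EN in kE c2 *; rewrite -kE -Ek.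
split; [by []|exact: ku|exact: kn|exists c, q; split; [exact: H|exact: SE| |exact: c2]].
rewrite -(scong_eq (s := t)); first exact: sc.
by move=> j jn; apply: (agrees_taylor ag T).
Qed.

Lemma few_squares nu pi S : schur_class2 nu pi S -> solves S ->
  (nu < neg_index N + d)%N \/ (pi < pos_index N + d)%N ->
  [/\ nu = neg_index N, pi = pos_index N & defect s (\rank N) \in unitmx].
Proof.
move=> cS sS lt; have [hS ag] := sS; have [r [t [M [T r1]]]] := holo_taylor hS.
have E := defect_taylor sS T; have EN := E n (leqnn n); rewrite -EN in lt.
have [-> -> [k [c [q F]]]] := class2_alternative cS hS T r1 hn lt.
have [H SE kE kn [ku sc]] := F.
have Ek := E k (ltnW kn); rewrite EN in kE *; rewrite -kE -Ek.
by split; [| |exact: ku].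
Qed.

(** With [nu + pi = n] squares allowed in all, the defect matrix of size [n + 1]
    is singular, so the function is already one of the fractions, for which the
    number of negative squares does not depend on the region. *)
Lemma minimal_squares_class S : N \in unitmx -> solves S ->
  schur_class2 (neg_index N) (pos_index N) S -> schur_class (neg_index N) S.
Proof.
move=> Nu sS cS; have [hS ag] := sS; have [r [t [M [T r1]]]] := holo_taylor hS.
have EN := defect_taylor sS T (leqnn n).
have [l1 l2] := schur_class2_defect cS hS T r1 n.+1.
have [g1 g2] := index_defect_le t (leqnSn n); rewrite EN in g1 g2.
have Nn : (pos_index N + neg_index N = n)%N by apply/eqP; rewrite -unit_index_sum.
have lt : (neg_index N < neg_index (defect t n.+1) + dim_ker (defect t n.+1))%N.
  by rewrite dim_kerE rank_defect; lia.
have [-> _ [k [c [q F]]]] := class2_alternative cS hS T r1 (ltn0Sn n) (or_introl lt).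
by have [] := fraction_class F.
Qed.

Lemma unit_dim_ker : N \in unitmx -> d = 0%N.
Proof.
rewrite dim_kerE -row_free_unit /row_free => /eqP ->; exact: subnn.
Qed.

Lemma singular_rank : \det N = 0 -> (\rank N < n)%N.
Proof. by move/eqP; rewrite det0_rank. Qed.

Lemma singular_dim_ker : \det N = 0 -> (0 < d)%N.
Proof. by move/singular_rank; rewrite dim_kerE subn_gt0. Qed.

(** The candidate comes from the kernel of the defect matrix of size
    [\rank N + 1]. *)
Lemma singular_solution : (\rank N < n)%N -> defect s (\rank N) \in unitmx ->
  exists c q, [/\ blaschke_data (\rank N) c q, scong s n q (c *: crev (\rank N) q) &
    let S := rat_fun (c *: crev (\rank N) q) q in
    [/\ schur_class (neg_index N) S, schur_class2 (neg_index N) (pos_index N) S & solves S]].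
Proof.
move=> rn ru; have [c [q [H sc]]] := defect_rank_rational rn ru.
exists c, q; split=> //=; have [E1 E2] := blaschke_indices H sc erefl (ltnW rn) ru.
have := rational_solution H; rewrite E1 E2 => -[hS c1 c2]; split=> //; split=> //.
by apply: rat_fun_agrees sc; case: H.
Qed.

(** Both functions are fractions of degree [\rank N] that agree with the data to
    order [\rank N + 1], hence equal. *)
Lemma singular_unique S S' nu : (nu < neg_index N + d)%N ->
  schur_class nu S -> solves S -> schur_class nu S' -> solves S' -> S = S'.
Proof.
move=> lt c1 s1 c2 s2.
have [_ _ rn [c [q [H -> sc _]]]] := few_negative_squares c1 s1 lt.
have [_ _ _ [c' [q' [H' -> sc' _]]]] := few_negative_squares c2 s2 lt.
have E := blaschke_unique H H' (scong_trunc rn sc) (scong_trunc rn sc').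
have [_ q00 _ cop] := H; have [_ q00' _ cop'] := H'.
apply/funext => z; rewrite /rat_fun; case: ifP => // _.
move: E cop cop'; set p := c *: _; set p' := c' *: _ => E cop cop'.
have Ez : p.[z] * q'.[z] = p'.[z] * q.[z] by rewrite -!hornerM E.
have nz (u v : {poly C}) : coprimep u v -> v.[z] = 0 -> u.[z] != 0.
  move=> uv vz; apply/negP => /eqP uz; have /(coprimep_root uv) : root u z by apply/rootP.
  by rewrite vz eqxx.
have [qz|qz] := eqVneq q.[z] 0; have [qz'|qz'] := eqVneq q'.[z] 0.
- by rewrite qz qz' !invr0 !mulr0.
- have := nz _ _ cop qz; have := Ez; rewrite qz mulr0 => /eqP.
  by rewrite mulf_eq0 (negPf qz') orbF => ->.
- have := nz _ _ cop' qz'; have := esym Ez; rewrite qz' mulr0 => /eqP.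
  by rewrite mulf_eq0 (negPf qz) orbF => ->.
by apply: (mulIf (mulf_neq0 qz qz')); rewrite !mulrA divfK // Ez; field.
Qed.

End Data.

Theorem theorem3p7 (R : realType) (n : nat) (hn : (1 <= n)%N)
    (a : n.-tuple R[i]) :
  let N := gram_defect a n in
  let d := dim_ker N in
  let nuN := neg_index N in
  let piN := pos_index N in
  let Ir := gram_defect a (rho N) in
  let sol1 := fun nu => solutions (schur_class nu) a n in
  let sol2 := fun nu pi => solutions (schur_class2 nu pi) a n in
  [/\ \det N != 0 ->
        [/\ infinite_set (sol1 nuN),
            sol2 nuN piN `<=` sol1 nuN,
            infinite_set (sol2 nuN piN)
          & forall nu pi : nat, (nuN <= nu)%N -> (piN <= pi)%N ->
              infinite_set (sol2 nu pi)],
      \det N = 0 -> \det Ir != 0 ->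
        [/\ exists S, sol1 nuN = [set S] /\ schur_class2 nuN piN S,
            forall nu : nat, (nuN < nu < nuN + d)%N -> sol1 nu = set0,
            forall nu pi : nat,
              (nuN < nu < nuN + d)%N \/ (piN < pi < piN + d)%N ->
              sol2 nu pi = set0
          & forall nu pi : nat, (nuN + d <= nu)%N -> (piN + d <= pi)%N ->
              infinite_set (sol2 nu pi)]
    & \det N = 0 -> \det Ir = 0 ->
        [/\ sol1 nuN = set0,
            forall nu : nat, (nu < nuN + d)%N -> sol1 nu = set0,
            forall nu pi : nat,
              (nu < nuN + d)%N \/ (pi < piN + d)%N -> sol2 nu pi = set0
          & forall nu pi : nat, (nuN + d <= nu)%N -> (piN + d <= pi)%N ->
              infinite_set (sol2 nu pi)]].
Proof.
pose s := nth 0 a; rewrite /= /rho gram_defectE -/s.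
have -> : (pos_index (defect s n) + neg_index (defect s n))%N = \rank (defect s n).
  by rewrite rank_defect.
rewrite gram_defectE -/s.
set N := defect s n; set d := dim_ker N; set nuN := neg_index N; set piN := pos_index N.
have sol1P nu S : solutions (schur_class nu) a n S <-> schur_class nu S /\ solves n s S.
  by split=> -[h1 /interpolatesP h2].
have sol2P nu pi S : solutions (schur_class2 nu pi) a n S <-> schur_class2 nu pi S /\ solves n s S.
  by split=> -[h1 /interpolatesP h2].
have many nu pi : (nuN + d <= nu)%N -> (piN + d <= pi)%N ->
    infinite_set (solutions (schur_class2 nu pi) a n) /\
    infinite_set (solutions (schur_class nu) a n).
  move=> h1 h2; have := family_infinite hn h2 h1 => inf.
  by split; apply: sub_infinite_set inf => S [c1 c2 h ag]; [apply/sol2P|apply/sol1P].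
split.
- rewrite -unitfE -unitmxE => Nu; have d0 : d = 0%N := unit_dim_ker Nu.
  have min1 : (nuN + d <= nuN)%N by rewrite d0 addn0.
  have min2 : (piN + d <= piN)%N by rewrite d0 addn0.
  have [inf2 inf1] := many _ _ min1 min2; split=> //.
    move=> S /sol2P[cS sS]; apply/sol1P; split=> //; exact: (minimal_squares_class hn).
  by move=> nu pi h1 h2; apply: (many _ _ _ _).1; rewrite d0 addn0.
- move=> N0; rewrite -unitfE -unitmxE => ru; have rn := singular_rank N0.
  have d0 := singular_dim_ker N0; have lt : (nuN < nuN + d)%N by rewrite -addn1 leq_add2l.
  have [c [q [H sc [c1 c2 sS]]]] := singular_solution rn ru.
  split; last by move=> nu pi h1 h2; apply: (many _ _ _ _).1.
  + exists (rat_fun (c *: crev (\rank N) q) q); split=> //; apply/seteqP; split=> S.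
      by move=> /sol1P[cS sS']; apply: (singular_unique hn lt).
    by move=> ->; apply/sol1P.
  + move=> nu /andP[h1 h2]; apply/seteqP; split=> // S /sol1P[cS sS'].
    by have [E _ _ _] := few_negative_squares hn cS sS' h2; rewrite E ltnn in h1.
  + move=> nu pi h; apply/seteqP; split=> // S /sol2P[cS sS'].
    have [|E1 E2 _] := few_squares hn cS sS'.
      by case: h => /andP[_ h]; [left|right].
    by case: h => /andP[h _]; [rewrite E1 ltnn in h|rewrite E2 ltnn in h].
- move=> N0 r0; have rn := singular_rank N0.
  have d0 := singular_dim_ker N0; have lt : (nuN < nuN + d)%N by rewrite -addn1 leq_add2l.
  have no : defect s (\rank N) \notin unitmx by rewrite unitmxE unitfE r0 eqxx.
  have no1 nu : (nu < nuN + d)%N -> solutions (schur_class nu) a n = set0.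
    move=> h; apply/seteqP; split=> // S /sol1P[cS sS].
    by have [_ ru _ _] := few_negative_squares hn cS sS h; rewrite ru in no.
  split=> //; first exact: no1.
    move=> nu pi h; apply/seteqP; split=> // S /sol2P[cS sS].
    by have [_ _ ru] := few_squares hn cS sS h; rewrite ru in no.
  by move=> nu pi h1 h2; apply: (many _ _ _ _).1.
Qed.
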